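(* Let $(K,v)$ be a valued field and $w$ an extension of $v$ to $K[x]$. Then for any abstract key polynomial $F$ for $w$ which is irreducible over $K^h$ and any monic $Q\in K[x]$, the following are equivalent: (i) $(F,Q)$ is a distinguished pair. (ii) $Q$ is an abstract key polynomial for $w$ such that $w_Q<w$, $F\in\Phi(w_Q,w)$ and $\deg F>\deg Q$. (iii) $Q$ is an abstract key polynomial for $w$ such that $w_Q<w$, and $F$ is a nontrivial lifting of some monic irreducible polynomial $G(Y)\ne Y$ (an element of $k_\alpha[Y]\subseteq k_{w_Q}$) with respect to $w_Q$.
   Context: $(K,v)$ is a valued field of arbitrary rank, $\overline K$ a fixed algebraic closure, $\bar v$ a fixed extension of $v$ to $\overline K$, $K^h\subseteq\overline K$ the Henselization of $K$ with respect to $\bar v$, $\Gamma$ an ordered abelian group containing the value group of $\bar v$. A valuation on $K[x]$ extending $v$ is a map $w:K[x]\to\Gamma\cup\{\infty\}$ with $w(fg)=w(f)+w(g)$, $w(f+g)\ge\min\{w(f),w(g)\}$, restricting to $v$ on $K$ (its support $w^{-1}(\infty)$ may be nonzero). $w<w'$ means $w\ne w'$ and $w(f)\le w'(f)$ for all $f$; $\Phi(w,w')$ is then the set of monic $g\in K[x]$ of minimal degree with $w(g)<w'(g)$. Abstract key polynomials: let $\overline w$ be any valuation on $\overline K[x]$ extending both $w$ and $\bar v$; for $f\in K[x]$, $\delta(f)=\max\{\overline w(x-\alpha):\alpha\in\overline K,\ f(\alpha)=0\}$ (independent of $\overline w$). A monic $Q\in K[x]$ is an abstract key polynomial for $w$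 if $\delta(f)<\delta(Q)$ for every $f\in K[x]$ with $\deg f<\deg Q$. The $Q$-truncation of $w$ is $w_Q(f)=\min_i w(f_iQ^i)$, where $f=\sum f_iQ^i$, $\deg f_i<\deg Q$; it is a valuation when $Q$ is an abstract key polynomial. Distinguished pairs: for $\alpha\in\overline K$, $\deg\alpha=[K(\alpha):K]$. $(\theta,\alpha)\in\overline K^2$ is a $(K,v)$-distinguished pair if: $\deg\theta>\deg\alpha$; $\bar v(\theta-\alpha)=\max\{\bar v(\theta-\beta):\beta\in\overline K,\ \deg\beta<\deg\theta\}$; and $\bar v(\theta-\eta)<\bar v(\theta-\alpha)$ for every $\eta\in\overline K$ with $\deg\eta<\deg\alpha$. For irreducible $f,g\in K[x]$, $(g,f)$ is a distinguished pair if some root $\theta$ of $g$ and root $\alpha$ of $f$ form a $(K,v)$-distinguished pair. Liftings: for $(\alpha,\delta)\in\overline K\times\Gamma_{\bar v}$ let $\overline w_{\alpha,\delta}\big(\sum c_i(x-\alpha)^i\big)=\min_i\{\bar v(c_i)+i\delta\}$. $(\alpha,\delta)$ is a $(K,v)$-minimal pair if $\deg\beta\ge\deg\alpha$ for all $\beta\in\overline K$ with $\bar v(\alpha-\beta)\ge\delta$. Let $u$ be a residue-transcendental extension of $v$ to $K(x)$ (i.e. $k_u|k_v$ has transcendence degree $1$); some common extension of $u$ and $\bar v$ is $\overline w_{\alpha,\delta}$ with $(\alpha,\delta)$ a $(K,v)$-minimal pair. Let $\phi$ be the minimal polynomial of $\alpha$ over $K$, $n=\deg\phi$, $\gamma=u(\phi)$,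 $\Gamma_\alpha,k_\alpha$ the value group and residue field of $\bar v|_{K(\alpha)}$, $e$ the smallest positive integer with $e\gamma\in\Gamma_\alpha$, and $h\in K[x]$ with $\deg h<n$ and $u(h)=\bar v(h(\alpha))=e\gamma$. Then the $u$-residue $Y=(\phi^e/h)^*$ is transcendental over $k_\alpha$ and $k_u=k_\alpha(Y)$. A monic $f\in K[x]$ is a lifting of a monic polynomial $U(Y)\in k_\alpha[Y]$ of degree $m\ge1$ with respect to $u$ if $\deg f=emn$, $u(f)=u(h^m)=em\gamma$, and the $u$-residue of $f/h^m$ is $U(Y)$; it is trivial if $\deg f=\deg\phi$. In (iii), this is applied with $u=w_Q$ (which is thus understood to be residue-transcendental), $\phi=Q$ and $\alpha$ a root of $Q$. *)

(* Defs.v *)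
From HB Require Import structures.
From mathcomp Require Import all_boot all_order all_algebra all_field.
From mathcomp Require Import generic_quotient ring_quotient.
From mathcomp Require Import boolp classical_sets.

Set Implicit Arguments.
Unset Strict Implicit.
Unset Printing Implicit Defensive.

Import Order.TTheory GRing.Theory Num.Theory.

Local Open Scope classical_set_scope.
Local Open Scope quotient_scope.
Local Open Scope ring_scope.

(* Totally ordered abelian groups.  Num.POrderedZmodule only joins an order   *)
(* and a group law, without any compatibility; HB does not allow a new join   *)
(* of Order.Total with GRing.Zmodule, so totality is a field of the mixin.    *)
HB.mixin Record isOrderedGroup G of Num.POrderedZmodule G := {
  oag_le_total : forall x y : G, (x <= y) || (y <= x);
  oag_leD2l_subproof : forall x y z : G, y <= z -> x + y <= x + z
}.

#[short(type="orderedGroupType")]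
HB.structure Definition OrderedGroup :=
  {G of Num.POrderedZmodule G & isOrderedGroup G}.

Section OrderedGroupTheory.
Variable G : orderedGroupType.
Implicit Types x y z : G.

Lemma oag_leD2l x y z : (x + y <= x + z) = (y <= z).
Proof.
apply/idP/idP => [h|]; last exact: oag_leD2l_subproof.
by have := oag_leD2l_subproof (- x) _ _ h; rewrite !addKr.
Qed.

Lemma oag_leD2r x y z : (y + x <= z + x) = (y <= z).
Proof. by rewrite ![_ + x]addrC oag_leD2l. Qed.

Lemma oag_ltD2l x y z : (x + y < x + z) = (y < z).
Proof. by rewrite !lt_def oag_leD2l (inj_eq (addrI x)). Qed.

End OrderedGroupTheory.

(* G with a greatest, absorbing element added: the order and the addition of  *)
(* the union of G and {oo}, with None as oo.                                  *)
Definition withtop (G : Type) := option G.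
Definition fin (G : Type) (g : G) : withtop G := Some g.
Definition top (G : Type) : withtop G := None.
Arguments top {G}.

Definition withtop_map (G G' : Type) (j : G -> G') (x : withtop G) :
  withtop G' := omap j x.

HB.instance Definition _ (G : choiceType) := Choice.on (withtop G).

Section WithTop.
Variable G : orderedGroupType.
Implicit Types x y z : withtop G.

Definition wt_add x y : withtop G :=
  if x is Some a then (if y is Some b then fin (a + b) else top) else top.

Lemma wt_addA : associative wt_add.
Proof. by case=> [a|] [b|] [c|] //=; rewrite addrA. Qed.
Lemma wt_addC : commutative wt_add.
Proof. by case=> [a|] [b|] //=; rewrite addrC. Qed.
Lemma wt_add0 : left_id (fin 0) wt_add.
Proof. by case=> [a|] //=; rewrite add0r. Qed.

HB.instance Definition _ :=
  GRing.isNmodule.Build (withtop G) wt_addA wt_addC wt_add0.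

Definition wt_le x y : bool :=
  if y is Some b then (if x is Some a then a <= b else false) else true.
Definition wt_lt x y : bool := (y != x) && wt_le x y.

Lemma wt_le_anti : antisymmetric wt_le.
Proof. by move=> [a|] [b|] //= /le_anti->. Qed.
Lemma wt_le_trans : transitive wt_le.
Proof. by move=> [a|] [b|] [c|] //=; exact: le_trans. Qed.
Lemma wt_le_total : total wt_le.
Proof. by move=> [a|] [b|] //=; exact: oag_le_total. Qed.

HB.instance Definition _ := Order.isOrder.Build ring_display (withtop G)
  (fun _ _ => erefl) (fun _ _ => erefl) (fun _ _ => erefl)
  wt_le_anti wt_le_trans wt_le_total.

Lemma le_fin (a b : G) : (fin a <= fin b) = (a <= b). Proof. by []. Qed.
Lemma le_top x : x <= top. Proof. by []. Qed.
Lemma finD (a b : G) : fin (a + b) = fin a + fin b. Proof. by []. Qed.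
Lemma fin0 : fin (0 : G) = 0. Proof. by []. Qed.
Lemma lt_fin (a b : G) : (fin a < fin b) = (a < b).
Proof. by rewrite !lt_def le_fin. Qed.
Lemma lt_fin_top (a : G) : fin a < top. Proof. by []. Qed.
Lemma addtop x : top + x = top. Proof. by []. Qed.
Lemma wt_leD2r z x y : x <= y -> x + z <= y + z.
Proof.
case: z x y => [c|] [a|] [b|] //=; rewrite -?finD ?le_fin ?oag_leD2r //.
Qed.

End WithTop.

(* Valuations on a commutative ring, possibly with nonzero support.           *)
Record valuation (R : comNzRingType) (G : orderedGroupType) := Valuation {
  val_fun :> R -> withtop G;
  val_fun0 : val_fun 0 = top;
  val_fun1 : val_fun 1 = 0;
  val_funM : forall f g, val_fun (f * g) = val_fun f + val_fun g;
  val_funD : forall f g, Order.min (val_fun f) (val_fun g) <= val_fun (f + g)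
}.

Section ResidueField.
Variables (L : fieldType) (G : orderedGroupType) (v : valuation L G).

Lemma val_eq_top x : (v x == top) = (x == 0).
Proof.
have [->|x0] := eqVneq x 0; first by rewrite val_fun0 eqxx.
apply/negP => /eqP vx; have := val_fun1 v.
by rewrite -(divff x0) val_funM vx.
Qed.

Lemma wt_double_eq0 (a : withtop G) : a + a = 0 -> a = 0.
Proof.
case: a => [a|] //; rewrite -finD -fin0 => -[aa]; congr fin; apply/le_anti.
have [h|h] := orP (oag_le_total a 0); rewrite h ?andbT /=.
  by rewrite -(oag_leD2l a) aa addr0.
by rewrite -(oag_leD2l a) aa addr0.
Qed.

Lemma valN1 : v (-1) = 0.
Proof. by apply: wt_double_eq0; rewrite -val_funM mulrNN mulr1 val_fun1. Qed.

Lemma valN x : v (- x) = v x.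
Proof. by rewrite -mulN1r val_funM valN1 add0r. Qed.

Definition valring_pred : {pred L} := fun x => fin 0 <= v x.

Lemma valring_closed : subring_closed valring_pred.
Proof.
split; rewrite /valring_pred.
- by rewrite unfold_in val_fun1.
- move=> x y; rewrite !unfold_in => vx vy.
  by apply: le_trans (val_funD v _ _); rewrite valN le_min vx.
- move=> x y; rewrite !unfold_in => vx vy.
  by rewrite val_funM (le_trans vy) // -{1}[v y]add0r wt_leD2r.
Qed.

HB.instance Definition _ := GRing.isSubringClosed.Build L valring_pred
  valring_closed.

Record valring := ValRing { valring_val :> L; _ : valring_val \in valring_pred }.

HB.instance Definition _ := [isSub for valring_val].
HB.instance Definition _ := [Choice of valring by <:].
HB.instance Definition _ := [SubChoice_isSubComNzRing of valring by <:].

Definition maxideal_pred : {pred valring} := fun x => fin 0 < v (val x).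

Lemma maxideal_closed : idealr_closed maxideal_pred.
Proof.
split; rewrite /maxideal_pred.
- by rewrite unfold_in rmorph0 val_fun0.
- by rewrite unfold_in rmorph1 val_fun1 ltxx.
- move=> a x y; rewrite !unfold_in => vx vy; rewrite rmorphD rmorphM.
  apply: lt_le_trans (val_funD v _ _); rewrite lt_min vy andbT val_funM.
  apply: lt_le_trans vx _; rewrite -{1}[v (val x)]add0r wt_leD2r //.
  by case: a.
Qed.

HB.instance Definition _ := isIdealr.Build valring maxideal_pred maxideal_closed.

Definition residue_field := {ideal_quot maxideal_pred}.
HB.instance Definition _ := GRing.ComNzRing.on residue_field.

(* The residue of x; only meaningful when v x >= 0.                           *)
Definition residue (x : L) : residue_field := \pi_residue_field (insubd (0 : valring) x).

Lemma insubd_valring x : fin 0 <= v x -> val (insubd (0 : valring) x) = x.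
Proof. by move=> vx; rewrite val_insubd [x \in _]vx. Qed.

Lemma residue_val (a : valring) : residue (val a) = \pi_residue_field a.
Proof. by rewrite /residue valKd. Qed.

Lemma residueP (a : residue_field) : exists2 x, fin 0 <= v x & a = residue x.
Proof.
exists (val (repr a)); first by case: (repr a).
by rewrite residue_val reprK.
Qed.

Lemma residue1 : residue 1 = 1.
Proof.
by rewrite -[1 in LHS](rmorph1 (val : valring -> L)) residue_val rmorph1.
Qed.

Lemma residueB x y : fin 0 <= v x -> fin 0 <= v y ->
  residue (x - y) = residue x - residue y.
Proof.
move=> vx vy; rewrite -{1}(insubd_valring vx) -{1}(insubd_valring vy).
by rewrite -rmorphB residue_val rmorphB.
Qed.

Lemma residueM x y : fin 0 <= v x -> fin 0 <= v y ->
  residue (x * y) = residue x * residue y.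
Proof.
move=> vx vy; rewrite -{1}(insubd_valring vx) -{1}(insubd_valring vy).
by rewrite -rmorphM residue_val rmorphM.
Qed.

Lemma residue_eq0 x : fin 0 <= v x -> (residue x == 0) = (fin 0 < v x).
Proof.
move=> vx; rewrite -[0 in LHS](rmorph0 (\pi_residue_field)) /residue.
rewrite -Quotient.idealrBE subr0.
by rewrite -[insubd _ _ \in _]/(fin 0 < v (val (insubd _ x))) insubd_valring.
Qed.

Definition residue_inv (a : residue_field) : residue_field :=
  residue (valring_val (repr a))^-1.

Lemma residue_mulV a : a != 0 -> residue_inv a * a = 1.
Proof.
rewrite /residue_inv -{1 3}[a]reprK -residue_val.
have vx : fin 0 <= v (val (repr a)) by case: (repr a).
rewrite residue_eq0 // -leNgt => vx0.
have vx1 : v (val (repr a)) = 0 by apply/le_anti; rewrite vx vx0.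
have x0 : val (repr a) != 0 by rewrite -val_eq_top vx1.
have vV : v (val (repr a))^-1 = 0.
  by have := val_fun1 v; rewrite -(mulVf x0) val_funM vx1 addr0.
by rewrite -residueM ?vV // mulVf // residue1.
Qed.

Lemma residue_inv0 : residue_inv 0 = 0.
Proof.
rewrite /residue_inv; set x := valring_val (repr 0).
have vx : fin 0 <= v x by rewrite /x; case: (repr _).
have : residue x == 0 by rewrite /x residue_val reprK.
rewrite residue_eq0 // => vx0; apply/eqP.
have [->|x0] := eqVneq x 0.
  by rewrite invr0 residue_eq0 val_fun0.
rewrite /residue /insubd insubF.
  by rewrite /= (rmorph0 \pi_residue_field).
apply/negP; rewrite unfold_in => vV; have vxV := val_fun1 v.
rewrite -(mulVf x0) val_funM in vxV.
have := wt_leD2r (v x) vV; rewrite vxV -fin0 add0r => vx1.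
by have := lt_le_trans vx0 vx1; rewrite ltxx.
Qed.

HB.instance Definition _ :=
  GRing.ComNzRing_isField.Build residue_field residue_mulV residue_inv0.

End ResidueField.

Section Subfields.
Variable L : fieldType.
Implicit Types (S : set L) (p q : {poly L}).

Definition is_subfield S : Prop :=
  [/\ S 1, forall x y, S x -> S y -> S (x - y)
         & forall x y, S x -> S y -> S (x / y)].

Definition field_gen S : set L := smallest is_subfield S.

Definition coefs_in S p : Prop := forall i, S p`_i.

(* Irreducibility in S[X], for a subfield S of L.                             *)
Definition irreducible_over S p : Prop :=
  [/\ coefs_in S p, (1 < size p)%N
    & forall q r, coefs_in S q -> coefs_in S r -> p = q * r ->
        size q = 1%N \/ size r = 1%N].

Definition algebraic_over S (z : L) : Prop :=
  exists p, [/\ p != 0, coefs_in S p & root p z].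

(* L has transcendence degree 1 over its subfield S: {y} is a transcendence   *)
(* basis.                                                                     *)
Definition trdeg_eq1 S : Prop :=
  exists y, ~ algebraic_over S y /\
    forall z, algebraic_over (field_gen (S `|` [set y])) z.

End Subfields.

(* K is embedded by iota in Kb, which in the statement is an algebraic        *)
(* closure of K.                                                              *)
Section AlgebraicElements.
Variables (K : fieldType) (Kb : closedFieldType) (iota : {rmorphism K -> Kb}).

Definition is_minpoly (a : Kb) (p : {poly K}) : Prop :=
  [/\ p \is monic, root (map_poly iota p) a
    & forall q, q != 0 -> root (map_poly iota q) a -> (size p <= size q)%N].

Definition minpoly (a : Kb) : {poly K} := xget 0 [set p | is_minpoly a p].

(* [K(a) : K] *)
Definition alg_deg (a : Kb) : nat := (size (minpoly a)).-1.

(* K(a) *)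
Definition adjoin (a : Kb) : set Kb := field_gen (range iota `|` [set a]).

Variables (G : orderedGroupType) (vb : valuation Kb G).

(* The Henselization of K with respect to vb, as the decomposition field of   *)
(* vb: the elements of the separable closure of K in Kb that are fixed by     *)
(* every automorphism s of Kb over K such that vb \o s = vb.                  *)
Definition henselization : set Kb :=
  [set a | separable_poly (minpoly a) /\
     forall s : {rmorphism Kb -> Kb}, bijective s ->
       (forall c, s (iota c) = iota c) -> (forall b, vb (s b) = vb b) ->
       s a = a].

Definition distinguished_pair (t a : Kb) : Prop :=
  [/\ (alg_deg a < alg_deg t)%N,
      forall b, (alg_deg b < alg_deg t)%N -> vb (t - b) <= vb (t - a)
    & forall c, (alg_deg c < alg_deg a)%N -> vb (t - c) < vb (t - a)].

Definition distinguished_pair_poly (g f : {poly K}) : Prop :=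
  [/\ irreducible_poly g, irreducible_poly f
    & exists t a, [/\ root (map_poly iota g) t, root (map_poly iota f) a
                    & distinguished_pair t a]].

End AlgebraicElements.

Section ValuationsOnPolynomials.
Variables (K : fieldType) (G : orderedGroupType).
Implicit Types (w : {poly K} -> withtop G) (f g Q : {poly K}).

Definition val_lt w w' : Prop := (forall f, w f <= w' f) /\ ~ w =1 w'.

Definition Phi w w' : set {poly K} :=
  [set g | [/\ g \is monic, w g < w' g
             & forall h, h \is monic -> w h < w' h -> (size g <= size h)%N]].

(* (f %/ Q ^+ i) %% Q is the i-th coefficient of the Q-expansion of f; for    *)
(* nonconstant Q those with i >= size f vanish.                               *)
Definition truncation Q w f : withtop G :=
  \big[Order.min/top]_(i < size f) w (((f %/ Q ^+ i) %% Q) * Q ^+ i).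

End ValuationsOnPolynomials.

Section KeyPolynomials.
Variables (K : fieldType) (Kb : closedFieldType) (iota : {rmorphism K -> Kb}).
Variables (G : orderedGroupType) (wb : valuation {poly Kb} G).

(* The maximum of wb (x - a) over the roots a of f, for nonconstant f.        *)
Definition delta (f : {poly K}) : withtop G :=
  xget top [set d |
    (exists2 a, root (map_poly iota f) a & wb ('X - a%:P) = d) /\
    (forall a, root (map_poly iota f) a -> wb ('X - a%:P) <= d)].

(* delta is not defined on constants (its value there is the maximum of the   *)
(* empty set), so that they impose no condition on Q.                         *)
Definition abstract_key_poly (Q : {poly K}) : Prop :=
  [/\ Q \is monic, (1 < size Q)%N
    & forall f : {poly K}, (1 < size f < size Q)%N -> delta f < delta Q].

End KeyPolynomials.

Notation "x %:F" := (tofrac x) : ring_scope.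

Section ResidueTranscendental.
Variables (K : fieldType) (G : orderedGroupType) (v : valuation K G).
Variable u : valuation {fraction {poly K}} G.

(* k_v inside k_u *)
Definition base_residue_field : set (residue_field u) :=
  [set a | exists2 c, fin 0 <= v c & a = residue u (c%:P)%:F].

Definition residue_transcendental : Prop :=
  (forall c, u (c%:P)%:F = v c) /\ trdeg_eq1 base_residue_field.

End ResidueTranscendental.

Section Liftings.
Variables (K : fieldType) (Kb : closedFieldType) (iota : {rmorphism K -> Kb}).
Variables (G : orderedGroupType) (vb : valuation Kb G).
Implicit Types (a : Kb) (d c : G).

(* sum_i c_i (x - a)^i |-> min_i (vb c_i + i d): the c_i are the coefficients *)
(* of p \Po ('X + a%:P).                                                      *)
Definition pair_valuation a d (p : {poly Kb}) : withtop G :=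
  let q := p \Po ('X + a%:P) in
  \big[Order.min/top]_(i < size q) (vb q`_i + fin (d *+ i)).

Definition value_group : set G := [set c | exists b, vb b = fin c].

Definition minimal_pair a d : Prop :=
  value_group d /\
  forall b, fin d <= vb (a - b) -> (alg_deg iota a <= alg_deg iota b)%N.

Definition value_group_adjoin a : set G :=
  [set c | exists2 b, adjoin iota a b & vb b = fin c].

Variable u : valuation {fraction {poly K}} G.
Variable W : valuation {fraction {poly Kb}} G.

(* k_a inside k_W.  The fields k_u and k_a are both subfields of k_W, where W *)
(* is a common extension of u and vb, and this is how k_a is a subfield of    *)
(* k_u.                                                                       *)
Definition residue_field_adjoin a : set (residue_field W) :=
  [set r | exists2 b, adjoin iota a b /\ fin 0 <= vb b
         & r = residue W (b%:P)%:F].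

(* The data with respect to which liftings for u are defined: W is a common   *)
(* extension of u and vb which is given by the minimal pair (a, d), c is the  *)
(* value of the minimal polynomial of a, e is the order of c modulo the value *)
(* group of K(a), and h is the normalizing polynomial.                        *)
Record lifting_data a d c (e : nat) (h : {poly K}) : Prop := LiftingData {
  ld_minimal_pair : minimal_pair a d;
  ld_W : forall p, W p%:F = pair_valuation a d p;
  ld_u : forall p : {poly K}, W (map_poly iota p)%:F = u p%:F;
  ld_c : u (minpoly iota a)%:F = fin c;
  ld_e_gt0 : (0 < e)%N;
  ld_e : value_group_adjoin a (c *+ e);
  ld_e_min : forall i, (0 < i)%N -> value_group_adjoin a (c *+ i) -> (e <= i)%N;
  ld_h_size : (size h < size (minpoly iota a))%N;
  ld_h_u : u h%:F = fin (c *+ e);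
  ld_h_vb : vb (map_poly iota h).[a] = fin (c *+ e)
}.

(* The residue in k_W of an element of K(x). *)
Definition quot_residue (f g : {poly K}) : residue_field W :=
  residue W ((map_poly iota f)%:F / (map_poly iota g)%:F).

Definition lifting a c (e : nat) (h f : {poly K})
    (U : {poly residue_field W}) : Prop :=
  let phi := minpoly iota a in
  exists2 m : nat,
    [/\ (0 < m)%N, U \is monic, size U = m.+1
      & coefs_in (residue_field_adjoin a) U]
  & [/\ f \is monic, (size f).-1 = (e * m * (size phi).-1)%N,
        u f%:F = u (h ^+ m)%:F, u f%:F = fin (c *+ (e * m))
      & quot_residue f (h ^+ m) = U.[quot_residue (phi ^+ e) h]].

End Liftings.

(* F is a nontrivial lifting, with respect to u and with Q in the role of the *)
(* minimal polynomial, of a monic irreducible polynomial other than Y.        *)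
Definition nontrivial_irreducible_lifting (K : fieldType) (Kb : closedFieldType)
    (iota : {rmorphism K -> Kb}) (G : orderedGroupType) (vb : valuation Kb G)
    (u : valuation {fraction {poly K}} G) (Q F : {poly K}) : Prop :=
  exists (W : valuation {fraction {poly Kb}} G) (a : Kb) (d c : G) (e : nat)
         (h : {poly K}) (U : {poly residue_field W}),
    [/\ lifting_data iota vb u W a d c e h, minpoly iota a = Q,
        irreducible_over (residue_field_adjoin iota vb a) U, U != 'X
      & lifting iota vb u a c e h F U /\ (size F).-1 <> (size Q).-1].

(* Main.v *)
From HB Require Import structures.
Require Import Defs.
From mathcomp Require Import all_boot all_order all_algebra all_field.
From mathcomp Require Import generic_quotient.
From mathcomp Require Import boolp classical_sets.

Set Implicit Arguments.
Unset Strict Implicit.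
Unset Printing Implicit Defensive.

Import Order.TTheory GRing.Theory Num.Theory.

Local Open Scope classical_set_scope.
Local Open Scope ring_scope.

(* Let a be a root of Q for which wb (X - a) = delta Q.  The truncation of w at Q   *)
(* is the restriction of the pair valuation at (a, delta Q): in a Q-expansion, the  *)
(* minima of the Gauss valuation at a are last attained at distinct indices, so no  *)
(* cancellation occurs.  Comparing linear factors, w_Q f < w f holds iff f has a    *)
(* root b with wb (X - b) > delta Q.                                                *)
(*                                                                                  *)
(* (i) <-> (ii): for a root t of F with wb (X - t) = delta F, elements b of smaller *)
(* degree satisfy vb (t - b) = wb (X - b), so both statements express that delta Q  *)
(* is the maximum of wb (X - b) over deg b < deg F.  Irreducibility over K^h makes  *)
(* the decomposition group transitive on the roots of F, so that any root of F in   *)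
(* a distinguished pair may be moved to t.                                          *)
(*                                                                                  *)
(* (ii) -> (iii): if F has minimal degree with w_Q F < w F, dividing the initial    *)
(* form of F by its leading coefficient and by a power of Q cannot lower the        *)
(* degree; hence F = Q^(em) + ... + f_0 and F / h^m has a residue U(Y) with         *)
(* U(0) <> 0.  Lifting a factorization of U would give a smaller polynomial.        *)
(*                                                                                  *)
(* (iii) -> (ii): delta Q < delta F because F is a key polynomial.  If g has        *)
(* minimal degree with w_Q g < w g and deg g < deg F, dividing F by g shows that    *)
(* the residue polynomial of g is a proper factor of U.                             *)

(** * Valuations with values in an ordered group *)

(** For a key polynomial [Q], let [a] be a root at which [delta Q] is attained. Polynomials of
    degree below [deg Q] have no root in the ball of radius [delta Q] around [a], so they behave
    near [a] like constants, while [Q] does not. This identifies [w_Q] with the restriction of the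
    pair valuation at [a] and [delta Q] ([pairv_truncation]). Comparing linear factors then shows
    that [w_Q f < w f] exactly when [f] has a root [b] with [delta Q < wb (X - b)]
    ([truncation_ltP]).

    For (i) and (ii), let [t] be a root of [F] realizing [delta F]. Every [b] of smaller degree
    satisfies [vb (t - b) = wb (X - b)] ([wX_difference]). So [(t, a)] is distinguished when [a]
    maximizes [wb (X - b)] over the degrees below [deg F] and no degree below [deg Q] reaches this
    maximum. The first condition expresses the minimality of [F], the second that [Q] is a key
    polynomial. A distinguished pair at another root of [F] is moved to [t] by
    [decomposition_transitive].

    For (ii) and (iii), whether [w] exceeds [w_Q] at [f] depends only on the initial form of [f].
    Divided by a power of [h], initial forms of suitable value become polynomials in Y over the
    residue field of [K(a)]: [residue_expansion] computes them, [residue_lift] lifts them back, and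
    [yres_transcendental] makes them unique. Minimality of [F] corresponds to irreducibility of its
    residue polynomial ([increase_minimal_leading], [increase_minimal_lifting],
    [lifting_increase_minimal]). The data for these computations come from
    [key_poly_lifting_data]. *)

Section OrderedGroups.
Variable G : orderedGroupType.
Implicit Types (a b c : G) (x y z t : withtop G).

Lemma oag_ltD2r a b c : (b + a < c + a) = (b < c).
Proof. by rewrite ![_ + a]addrC oag_ltD2l. Qed.

Lemma oag_ltMn a b n : (0 < n)%N -> a < b -> a *+ n < b *+ n.
Proof.
case: n => // n _ ab; elim: n => // n IH; rewrite ![_ *+ n.+2]mulrS.
by apply: (@lt_trans _ _ (a + b *+ n.+1)); rewrite ?oag_ltD2l ?oag_ltD2r.
Qed.

Lemma oag_mulrnI n a b : (0 < n)%N -> a *+ n = b *+ n -> a = b.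
Proof.
move=> n0 ab; have [h|h] := orP (oag_le_total a b); apply/eqP; apply: contraT => ne.
  by have := oag_ltMn n0 (_ : a < b); rewrite lt_def h eq_sym ne ab ltxx => /(_ isT).
by have := oag_ltMn n0 (_ : b < a); rewrite lt_def h ne ab ltxx => /(_ isT).
Qed.

Lemma fin_inj : injective (@fin G). Proof. by move=> a b []. Qed.

Lemma finMn a n : fin (a *+ n) = fin a *+ n.
Proof. by elim: n => // n IH; rewrite !mulrS finD IH. Qed.

Lemma ntopP x : reflect (exists a, x = fin a) (x != top).
Proof. by case: x => [a|]; constructor; [exists a | case]. Qed.

Lemma wt_addtop x : x + top = top. Proof. by rewrite addrC addtop. Qed.

Lemma wt_leD x y z t : x <= y -> z <= t -> x + z <= y + t.
Proof.
by move=> xy zt; apply: le_trans (wt_leD2r z xy) _; rewrite ![y + _]addrC wt_leD2r.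
Qed.

Lemma wt_leD2rE z x y : z != top -> (x + z <= y + z) = (x <= y).
Proof.
case: z => // c _; case: x => [a|]; case: y => [b|] //=.
by rewrite -!finD !le_fin oag_leD2r.
Qed.

Lemma wt_addI z x y : z != top -> x + z = y + z -> x = y.
Proof. by move=> zt e; apply/le_anti; rewrite -(wt_leD2rE x y zt) -(wt_leD2rE y x zt) e lexx. Qed.

Lemma wt_ltD2rE z x y : z != top -> (x + z < y + z) = (x < y).
Proof. by move=> zt; rewrite !ltNge wt_leD2rE. Qed.

Lemma wt_ltD x y z t : x < y -> z <= t -> z != top -> x + z < y + t.
Proof.
move=> xy zt z0; apply: lt_le_trans (_ : y + z <= _); first by rewrite wt_ltD2rE.
by rewrite ![y + _]addrC wt_leD2r.
Qed.

Lemma wt_lt_ntop x y : x < y -> x != top.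
Proof. by case: x => //; rewrite ltNge le_top. Qed.

Lemma wt_add_eqtop x y : (x + y == top) = (x == top) || (y == top).
Proof. by case: x; case: y. Qed.

Lemma wt_min_topl : left_id (top : withtop G) Order.min.
Proof. by move=> x; rewrite min_r ?le_top. Qed.

Lemma wt_min_topr : right_id (top : withtop G) Order.min.
Proof. by move=> x; rewrite min_l ?le_top. Qed.

HB.instance Definition _ := Monoid.isMonoidLaw.Build (withtop G) top Order.min
  wt_min_topl wt_min_topr.

Lemma wt_bigmin_ge (I : finType) (P : pred I) (F : I -> withtop G) x :
  reflect (forall i, P i -> x <= F i) (x <= \big[Order.min/top]_(i | P i) F i).
Proof.
apply: (iffP idP) => [h i Pi|h].
  by apply: le_trans h _; rewrite (bigD1 i) //= ge_min lexx.
by elim/big_ind: _ => // a b ax bx; rewrite le_min ax.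
Qed.

Lemma wt_bigmin_eq (I : finType) (F : I -> withtop G) x i :
  (forall k, x <= F k) -> F i = x -> \big[Order.min/top]_k F k = x.
Proof.
move=> h e; apply/le_anti/andP; split; last by apply/wt_bigmin_ge => k _; exact: h.
by rewrite -e (bigD1 i) //= ge_min lexx.
Qed.

Lemma wt_bigmin_attained (I : finType) (F : I -> withtop G) (i0 : I) :
  exists i, F i = \big[Order.min/top]_k F k.
Proof.
pose i := [arg min_(k < i0) F k]%O; exists i.
apply/esym/wt_bigmin_eq; last by [].
by move=> k; rewrite /i; case: arg_minP => // m _; apply.
Qed.

Lemma wt_bigmin_ordP n (F : nat -> withtop G) :
  \big[Order.min/top]_(i < n) F i = top \/
  exists2 i, (i < n)%N & F i = \big[Order.min/top]_(k < n) F k.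
Proof.
elim: n => [|n [IH|[i i_n IH]]]; first by left; rewrite big_ord0.
  by right; exists n => //; rewrite big_ord_recr /= IH wt_min_topl.
right; rewrite big_ord_recr /= -IH; have [h|h] := leP (F i) (F n).
  by exists i => //; apply: ltnW.
by exists n.
Qed.
End OrderedGroups.

Section Valuations.
Variables (R : comNzRingType) (G : orderedGroupType) (v : valuation R G).
Implicit Types (f g : R) (x : withtop G).

Lemma vN f : v (- f) = v f.
Proof.
by rewrite -mulN1r val_funM (wt_double_eq0 (_ : v (-1) + v (-1) = 0)) ?add0r // -val_funM
  mulrNN mulr1 val_fun1.
Qed.

Lemma vB f g : Order.min (v f) (v g) <= v (f - g).
Proof. by rewrite -(vN g) val_funD. Qed.

Lemma vD_lt f g : v f < v g -> v (f + g) = v f.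
Proof.
move=> fg; apply/le_anti/andP; split; last first.
  by apply: le_trans (val_funD v _ _); rewrite le_min lexx ltW.
rewrite leNgt; apply/negP => h.
have := vB (f + g) g; rewrite addrK; apply/negP; rewrite -ltNge lt_min h fg //.
Qed.

(** The inequality [v f < v (f - g)] says that [f] and [g] have the same initial form. The relation
    respects products, inverses and powers ([v_simM], [v_simV], [v_simX]) and stands in for the
    graded ring of [v]. *)
Lemma v_sim f g : v f < v (f - g) -> v g = v f.
Proof.
move=> h; have -> : g = f + - (f - g) by rewrite opprB addrC subrK.
by rewrite vD_lt // vN.
Qed.

Lemma v_sum_ge (I : Type) (r : seq I) (P : pred I) (F : I -> R) x :
  (forall i, P i -> x <= v (F i)) -> x <= v (\sum_(i <- r | P i) F i).
Proof.
move=> h; elim/big_ind: _ => //; first by rewrite val_fun0 le_top.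
by move=> a b ha hb; apply: le_trans (val_funD v _ _); rewrite le_min ha.
Qed.

Lemma v_sum_gt (I : Type) (r : seq I) (P : pred I) (F : I -> R) x : x != top ->
  (forall i, P i -> x < v (F i)) -> x < v (\sum_(i <- r | P i) F i).
Proof.
move=> xt h; elim/big_ind: _ => //; first by rewrite val_fun0; case: x xt {h}.
by move=> a b ha hb; apply: lt_le_trans (val_funD v _ _); rewrite lt_min ha.
Qed.

Lemma vX f n : v (f ^+ n) = v f *+ n.
Proof. by elim: n => [|n IH]; rewrite ?val_fun1 // exprS mulrS val_funM IH. Qed.

Lemma vX_fin f n (c : G) : v f = fin c -> v (f ^+ n) = fin (c *+ n).
Proof. by rewrite vX finMn => ->. Qed.

Lemma v_simM f f' g g' : v f < v (f - f') -> v g < v (g - g') ->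
  v (f * g) < v (f * g - f' * g').
Proof.
move=> hf hg; have f't := wt_lt_ntop hf; have gt := wt_lt_ntop hg.
have -> : f * g - f' * g' = (f - f') * g + f' * (g - g').
  by rewrite mulrBl mulrBr addrA subrK.
apply: lt_le_trans (val_funD v _ _); rewrite lt_min !val_funM wt_ltD2rE // hf /=.
by rewrite (v_sim hf) [in ltRHS]addrC [in ltLHS]addrC wt_ltD2rE.
Qed.

(** If the partial sum and the next term have equal value, this is also the value of an earlier term
    unless it is infinite; by hypothesis it is then infinite in any case, and nothing can cancel. *)
Lemma v_sum_distinct n (F : nat -> R) :
  (forall i k, (i < k < n)%N -> v (F i) = v (F k) -> v (F i) = top) ->
  v (\sum_(i < n) F i) = \big[Order.min/top]_(i < n) v (F i).
Proof.
elim: n => [|n IH] h; first by rewrite !big_ord0 val_fun0.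
have {}IH : v (\sum_(i < n) F i) = \big[Order.min/top]_(i < n) v (F i).
  by apply: IH => i k /andP[ik kn]; apply: h; rewrite ik ltnW.
rewrite !big_ord_recr /= -IH; set s := \sum_(i < n) _ in IH *.
have [lt|gt|e] := ltgtP (v s) (v (F n)); first exact: vD_lt.
  by rewrite addrC vD_lt.
have st : v s = top.
  have [E|[i i_n Ei]] := wt_bigmin_ordP n (fun i => v (F i)); first by rewrite IH.
  by rewrite IH -Ei; apply: (h i n); rewrite ?i_n ?ltnSn // Ei -IH.
have := val_funD v s (F n); rewrite -e minxx st => le.
by apply/le_anti; rewrite le le_top.
Qed.
End Valuations.

Section FieldValuations.
Variables (L : fieldType) (G : orderedGroupType) (v : valuation L G).

Lemma v_ntop x : (v x != top) = (x != 0). Proof. by rewrite val_eq_top. Qed.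

Lemma vdiv x y (a b : G) : v x = fin a -> v y = fin b -> v (x / y) = fin (a - b).
Proof.
move=> vx vy; have y0 : y != 0 by rewrite -(val_eq_top v) vy.
by apply: (@wt_addI _ (v y)); rewrite ?vy // -{1}vy -val_funM divfK // vx -finD subrK.
Qed.

Lemma vdiv_ge0 x y : y != 0 -> v y <= v x -> fin 0 <= v (x / y).
Proof.
move=> y0 h; rewrite -(wt_leD2rE _ _ (_ : v y != top)) ?v_ntop //.
by rewrite -val_funM divfK // fin0 add0r.
Qed.

Lemma vdiv_gt0E x y : y != 0 -> (fin 0 < v (x / y)) = (v y < v x).
Proof.
move=> y0; rewrite -(wt_ltD2rE _ _ (_ : v y != top)) ?v_ntop //.
by rewrite -val_funM divfK // fin0 add0r.
Qed.
End FieldValuations.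

(** * Gauss and pair valuations *)

Section GaussValuation.
Variables (L : fieldType) (G : orderedGroupType) (v : valuation L G) (d : G).
Implicit Types (p q : {poly L}) (t s : G) (k l : nat).

Lemma wt_leBr (x c : G) (y : withtop G) : (fin x <= y + fin c) = (fin (x - c) <= y).
Proof. by rewrite -[in RHS](wt_leD2rE _ _ (_ : fin c != top)) // -finD subrK. Qed.

Lemma wt_ltBr (x c : G) (y : withtop G) : (fin x < y + fin c) = (fin (x - c) < y).
Proof. by rewrite -[in RHS](wt_ltD2rE _ _ (_ : fin c != top)) // -finD subrK. Qed.

Definition wcoef q k : withtop G := v q`_k + fin (d *+ k).

Definition gauss q : withtop G := \big[Order.min/top]_(i < size q) wcoef q i.

Lemma wcoef_top q k : (wcoef q k == top) = (q`_k == 0).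
Proof. by rewrite wt_add_eqtop orbF val_eq_top. Qed.

Lemma gauss_geP q x : x <= gauss q <-> forall k, x <= wcoef q k.
Proof.
split=> [/wt_bigmin_ge h k|h]; last by apply/wt_bigmin_ge => i _.
have [kq|qk] := ltnP k (size q); first exact: (h (Ordinal kq)).
by rewrite (eqP (_ : wcoef q k == top)) ?le_top // wcoef_top nth_default.
Qed.

Lemma gauss_le q k : gauss q <= wcoef q k.
Proof. by move: k; apply/gauss_geP. Qed.

(* For a product of linear factors X - b, the last index k where the minimum is      *)
(* attained counts the roots b with v b >= d.                                        *)
Definition top_at q k t : Prop :=
  [/\ wcoef q k = fin t, forall i, fin t <= wcoef q i
    & forall i, (k < i)%N -> fin t < wcoef q i].

Lemma top_at_gauss q k t : top_at q k t -> gauss q = fin t.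
Proof.
case=> e h _; apply/le_anti; rewrite -[X in _ <= X]e gauss_le /=.
by apply/gauss_geP.
Qed.

Lemma top_at_neq0 q k t : top_at q k t -> q != 0.
Proof. by case=> e _ _; apply: contra_eq_neq e => ->; rewrite /wcoef coef0 val_fun0. Qed.

Lemma top_at_ex q : q != 0 -> exists k t, top_at q k t.
Proof.
move=> q0; have sq : (0 < size q)%N by rewrite size_poly_gt0.
have [i0 Ei0] := wt_bigmin_attained (fun i : 'I_(size q) => wcoef q i) (Ordinal sq).
have gE : gauss q != top.
  apply: contraT => /negPn/eqP g; have := gauss_le q (size q).-1.
  by rewrite g leNgt lt_neqAle le_top andbT wcoef_top -lead_coefE lead_coef_eq0 q0.
have {gE} [t gt] := ntopP _ gE.
have P0 : wcoef q i0 == fin t by rewrite -gt; apply/eqP.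
exists [arg max_(i > i0 | wcoef q i == fin t) (i : nat)], t.
case: arg_maxnP => // k /eqP Pk kmax; split=> // [i|i ki]; first by rewrite -gt gauss_le.
rewrite lt_neqAle -{2}gt gauss_le andbT; apply: contraTN ki => /eqP e.
have iq : (i < size q)%N.
  by rewrite ltnNge; apply/negP => /(nth_default 0)/eqP; rewrite -wcoef_top -e.
by rewrite -leqNgt; apply: (kmax (Ordinal iq)); rewrite /= -e.
Qed.

Lemma wcoefM_term p q i k : v (p`_i * q`_k) + fin (d *+ (i + k)) = wcoef p i + wcoef q k.
Proof. by rewrite val_funM mulrnDr finD /wcoef addrACA. Qed.

(** Gauss's lemma: in the coefficient of index [k + l], every contribution other than that of [k]
    and [l] has an index beyond [k] or beyond [l], hence strictly larger value. Past [k + l] this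
    holds for all contributions. *)
Lemma top_at_mul p q k l t s :
  top_at p k t -> top_at q l s -> top_at (p * q) (k + l) (t + s).
Proof.
move=> [pk p_ge p_gt] [ql q_ge q_gt].
have term n i : (i <= n)%N -> wcoef p i + wcoef q (n - i) = v (p`_i * q`_(n - i)) + fin (d *+ n).
  by move=> i_n; rewrite -wcoefM_term subnKC.
have gt n i : (i <= n)%N -> (k < i)%N || (l < n - i)%N ->
    fin (t + s - d *+ n) < v (p`_i * q`_(n - i)).
  move=> i_n h; rewrite -wt_ltBr -term // finD; case/orP: h => h.
    by apply: wt_ltD; rewrite ?p_gt.
  by rewrite addrC [ltRHS]addrC; apply: wt_ltD; rewrite ?q_gt.
split=> [|n|n kln].
- have kl : (k < (k + l).+1)%N by rewrite ltnS leq_addr.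
  rewrite /wcoef coefM (bigD1 (Ordinal kl)) //= addKn.
  rewrite vD_lt; first by rewrite wcoefM_term pk ql.
  have e : v (p`_k * q`_l) = fin (t + s - d *+ (k + l)).
    by apply: (@wt_addI _ (fin (d *+ (k + l)))); rewrite // wcoefM_term pk ql -!finD subrK.
  rewrite e; apply: v_sum_gt => // i ik; apply: gt; first by rewrite -ltnS.
  have : (i : nat) != k by apply: contraNneq ik => e'; apply/eqP/val_inj.
  by rewrite neq_ltn => /orP[ik'|->//]; rewrite ltn_subRL ltn_add2r ik' orbT.
- rewrite /wcoef wt_leBr coefM; apply: v_sum_ge => i _.
  by rewrite -wt_leBr -term -1?ltnS // finD wt_leD.
- rewrite /wcoef wt_ltBr coefM; apply: v_sum_gt => // i _; apply: gt; first by rewrite -ltnS.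
  case: ltnP => //= ik; rewrite ltn_subRL; apply: leq_ltn_trans kln.
  by rewrite leq_add2r.
Qed.

Lemma gauss0 : gauss 0 = top.
Proof. by rewrite /gauss size_poly0 big_ord0. Qed.

Lemma gaussM p q : gauss (p * q) = gauss p + gauss q.
Proof.
have [->|p0] := eqVneq p 0; first by rewrite mul0r gauss0 addtop.
have [->|q0] := eqVneq q 0; first by rewrite mulr0 gauss0 wt_addtop.
have [k [t pt]] := top_at_ex p0; have [l [s qs]] := top_at_ex q0.
by rewrite (top_at_gauss (top_at_mul pt qs)) (top_at_gauss pt) (top_at_gauss qs) finD.
Qed.

Lemma top_atC (c : L) t : v c = fin t -> top_at c%:P 0 t.
Proof.
have wC i : wcoef c%:P i = if i == 0%N then v c else top.
  by rewrite /wcoef coefC; case: ifP => [/eqP->|_]; rewrite ?fin0 ?addr0 ?val_fun0.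
by move=> ct; split=> [|i|[|i] //]; rewrite wC //; case: ifP; rewrite ?ct ?le_top.
Qed.

Lemma gaussC c : gauss c%:P = v c.
Proof.
have [->|c0] := eqVneq c 0; first by rewrite gauss0 val_fun0.
have /ntopP[t ct] : v c != top by rewrite v_ntop.
by rewrite (top_at_gauss (top_atC ct)).
Qed.

Lemma wcoefD p q i : Order.min (wcoef p i) (wcoef q i) <= wcoef (p + q) i.
Proof.
rewrite /wcoef coefD; apply: le_trans (wt_leD2r _ (val_funD v _ _)).
by case: (leP (v p`_i) (v q`_i)) => h; rewrite ge_min lexx ?orbT.
Qed.

Lemma gaussD p q : Order.min (gauss p) (gauss q) <= gauss (p + q).
Proof.
apply/gauss_geP => i; apply: le_trans (wcoefD p q i).
by rewrite le_min !ge_min !gauss_le orbT.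
Qed.

Lemma gauss1 : gauss 1 = 0. Proof. by rewrite -polyC1 gaussC val_fun1. Qed.

Lemma top_atD_lt p q k t : top_at p k t -> fin t < gauss q -> top_at (p + q) k t.
Proof.
move=> [pk p_ge p_gt] tq; have q_gt i : fin t < wcoef q i := lt_le_trans tq (gauss_le q i).
split=> [|i|i ki].
- apply/le_anti/andP; split; last first.
    by apply: le_trans (wcoefD p q k); rewrite le_min pk lexx ltW.
  rewrite leNgt; apply/negP => h.
  have := wcoefD (p + q) (- q) k; rewrite addrK pk leNgt => /negP; apply.
  by rewrite lt_min h /= /wcoef coefN valN; exact: q_gt.
- by apply: le_trans (wcoefD p q i); rewrite le_min p_ge (ltW (q_gt i)).
- by apply: lt_le_trans (wcoefD p q i); rewrite lt_min p_gt // q_gt.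
Qed.

(** With equal minima, the summand attaining its minimum last decides: at index [l] the coefficient
    of [p] has strictly larger value. *)
Lemma top_atD_eq p q k l t : top_at p k t -> top_at q l t -> (k < l)%N -> top_at (p + q) l t.
Proof.
move=> [pk p_ge p_gt] [ql q_ge q_gt] kl; split=> [|i|i li].
- rewrite /wcoef coefD [p`_l + _]addrC vD_lt //.
  by have := p_gt _ kl; rewrite -ql /wcoef wt_ltD2rE.
- by apply: le_trans (wcoefD p q i); rewrite le_min p_ge; exact: q_ge.
- by apply: lt_le_trans (wcoefD p q i); rewrite lt_min q_gt // p_gt // (ltn_trans kl).
Qed.

(* No cancellation: the minima are attained last at pairwise distinct indices. *)
Lemma gauss_sum N n (p : nat -> {poly L}) : (0 < N)%N ->
  (forall i, (i < n)%N -> p i = 0 \/ exists t, top_at (p i) (i * N) t) ->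
  gauss (\sum_(i < n) p i) = \big[Order.min/top]_(i < n) gauss (p i).
Proof.
move=> N0 hp; suff [] : gauss (\sum_(i < n) p i) = \big[Order.min/top]_(i < n) gauss (p i)
  /\ (\sum_(i < n) p i = 0 \/
      exists m t, (m < n)%N /\ top_at (\sum_(i < n) p i) (m * N) t) by [].
elim: n hp => [|n IH] hp; first by rewrite !big_ord0 gauss0; split; [|left].
have [IHg IHt] := IH (fun i i_n => hp i (ltnW i_n)).
rewrite !big_ord_recr /= -IHg; set s := \sum_(i < n) _ in IHg IHt *.
have [pn0|[t pt]] := hp n (ltnSn n).
  rewrite pn0 addr0 gauss0 wt_min_topr; split=> //.
  case: IHt => [->|[m [t [mn mt]]]]; [by left | right; exists m, t].
  by rewrite ltnW.
case: IHt => [->|[m [u [mn mu]]]].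
  by rewrite add0r gauss0 wt_min_topl; split=> //; right; exists n, t.
have [mn' nlt] : (m * N < n * N)%N /\ (n < n.+1)%N by rewrite ltn_mul2r N0 mn.
have [gu gt] := (top_at_gauss mu, top_at_gauss pt).
have [lt|lt|e] := ltgtP (gauss s) (gauss (p n)).
- have h := top_atD_lt mu (_ : fin u < gauss (p n)).
  rewrite (top_at_gauss (h _)) -?gu //; split=> //; right; exists m, u.
  by split; [rewrite ltnW | apply: h; rewrite -gu].
- have h := top_atD_lt pt (_ : fin t < gauss s).
  rewrite addrC (top_at_gauss (h _)) -?gt //; split=> //; right; exists n, t.
  by split=> //; apply: h; rewrite -gt.
- have eut : u = t by apply: fin_inj; rewrite -gu -gt.
  rewrite eut in mu *; have h := top_atD_eq mu pt mn'.
  by rewrite (top_at_gauss h) gu eut; split=> //; right; exists n, t.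
Qed.
End GaussValuation.

(** * Minimal polynomials, Q-expansions and truncations *)

Section MinimalPolynomials.
Variables (K : fieldType) (Kb : closedFieldType) (iota : {rmorphism K -> Kb}).
Hypothesis Kb_algebraic : forall a : Kb, algebraicOver iota a.
Implicit Types (a b : Kb) (f g Q : {poly K}).

Local Notation "f ^i" := (map_poly iota f) (at level 2, format "f ^i").

Lemma minpolyP a : is_minpoly iota a (minpoly iota a).
Proof.
apply: xgetPex; pose P n := `[< exists p, [/\ p != 0, root p^i a & size p = n] >].
have exP : exists n, P n.
  by have [p p0 pa] := Kb_algebraic a; exists (size p); apply/asboolP; exists p.
case: (ex_minnP exP) => n /asboolP[p [p0 pa sp]] nmin.
exists ((lead_coef p)^-1 *: p); split.
- by rewrite monicE lead_coefZ mulVf // lead_coef_eq0.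
- by rewrite map_polyZ rootZ // fmorph_eq0 invr_eq0 lead_coef_eq0.
- move=> q q0 qa; rewrite size_scale ?invr_eq0 ?lead_coef_eq0 // sp.
  by apply: nmin; apply/asboolP; exists q.
Qed.

Lemma minpoly_monic a : minpoly iota a \is monic. Proof. by case: (minpolyP a). Qed.
Lemma minpoly_root a : root (minpoly iota a)^i a. Proof. by case: (minpolyP a). Qed.
Lemma minpoly_neq0 a : minpoly iota a != 0. Proof. exact/monic_neq0/minpoly_monic. Qed.
Lemma minpoly_size a f : f != 0 -> root f^i a -> (size (minpoly iota a) <= size f)%N.
Proof. by case: (minpolyP a) => _ _; apply. Qed.

Lemma minpoly_size_gt1 a : (1 < size (minpoly iota a))%N.
Proof.
rewrite -(size_map_poly iota); apply: root_size_gt1 (minpoly_root a).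
by rewrite map_poly_eq0 minpoly_neq0.
Qed.

Lemma minpoly_dvd a f : root f^i a -> minpoly iota a %| f.
Proof.
move=> fa; rewrite /dvdp; apply: contraT => r0.
have ra : root (f %% minpoly iota a)^i a.
  rewrite -(addKr (f %/ minpoly iota a * minpoly iota a) (f %% _)) -divp_eq.
  rewrite rmorphD rmorphN rmorphM /= rootE !hornerE (rootP (minpoly_root a)).
  by rewrite (rootP fa) mulr0 oppr0 addr0.
by have := minpoly_size r0 ra; rewrite leqNgt ltn_modp minpoly_neq0.
Qed.

Lemma irreducible_minpoly a Q : irreducible_poly Q -> root Q^i a ->
  minpoly iota a %= Q.
Proof.
move=> [_ Qirr] Qa; apply: Qirr (minpoly_dvd Qa).
by rewrite neq_ltn minpoly_size_gt1 orbT.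
Qed.

Lemma minpoly_irreducible a : irreducible_poly (minpoly iota a).
Proof.
split=> [|q sq qm]; first exact: minpoly_size_gt1.
have mE := divpK qm; set r := _ %/ q in mE.
have r0 : r != 0 by apply: contra_neq (minpoly_neq0 a) => r0; rewrite -mE r0 mul0r.
have q0 : q != 0 by apply: contra_neq (minpoly_neq0 a) => q0; rewrite -mE q0 mulr0.
have := minpoly_root a; rewrite -{1}mE rmorphM rootM => /orP[ra|qa]; last first.
  by rewrite -dvdp_size_eqp // eqn_leq dvdp_leq ?minpoly_neq0 // minpoly_size.
have := minpoly_size r0 ra; rewrite -{1}mE size_mul // -subn1 -addnBA ?size_poly_gt0 //.
rewrite -[leqRHS]addn0 leq_add2l leqn0 subn_eq0 => sq1.
by move: sq; rewrite eqn_leq sq1 size_poly_gt0 q0.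
Qed.

Lemma minpoly_eq a Q : Q \is monic -> irreducible_poly Q -> root Q^i a ->
  minpoly iota a = Q.
Proof.
by move=> Qm Qi Qa; apply/eqP; rewrite -eqp_monic ?minpoly_monic // irreducible_minpoly.
Qed.

Lemma size_minpoly a : size (minpoly iota a) = (alg_deg iota a).+1.
Proof. by rewrite prednK // ltnW // minpoly_size_gt1. Qed.

Lemma irreducible_alg_deg a Q : irreducible_poly Q -> root Q^i a ->
  alg_deg iota a = (size Q).-1.
Proof. by move=> Qi Qa; rewrite /alg_deg (eqp_size (irreducible_minpoly Qi Qa)). Qed.

End MinimalPolynomials.

Section Expansions.
Variables (K : fieldType) (Q : {poly K}).
Hypotheses (Q_monic : Q \is monic) (Q_size : (1 < size Q)%N).
Implicit Types f : {poly K}.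

Definition digit f i := (f %/ Q ^+ i) %% Q.

Lemma size_digit f i : (size (digit f i) < size Q)%N.
Proof. by rewrite ltn_modp monic_neq0. Qed.

Lemma size_base_exp i : size (Q ^+ i) = ((size Q).-1 * i).+1.
Proof.
by rewrite -(size_exp Q i) prednK // size_poly_gt0 expf_neq0 // monic_neq0.
Qed.

Lemma digit_expansion_rem f n :
  f = \sum_(i < n) digit f i * Q ^+ i + (f %/ Q ^+ n) * Q ^+ n.
Proof.
elim: n => [|n IH]; first by rewrite big_ord0 add0r expr0 divp1 mulr1.
rewrite big_ord_recr /= -addrA {1}IH; congr (_ + _).
rewrite exprSr -divp_divl [Q ^+ n * Q]mulrC mulrA -mulrDl addrC; congr (_ * _).
exact: divp_eq.
Qed.

Lemma divp_base_exp0 f n : (size f <= (size Q).-1 * n)%N -> f %/ Q ^+ n = 0.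
Proof. by move=> h; apply: divp_small; rewrite size_base_exp ltnS. Qed.

Lemma digit_expansion f : f = \sum_(i < size f) digit f i * Q ^+ i.
Proof.
rewrite {1}(digit_expansion_rem f (size f)) divp_base_exp0 ?mul0r ?addr0 //.
by rewrite leq_pmull // -ltnS prednK // ltnW.
Qed.

Lemma digit_small f i : (size f < size Q)%N -> digit f i = if i == 0%N then f else 0.
Proof.
move=> h; rewrite /digit; case: i => [|i]; first by rewrite expr0 divp1 modp_small.
rewrite divp_base_exp0 ?mod0p // mulnS -ltnS -addSn prednK ?(ltnW Q_size) //.
exact: ltn_addr.
Qed.

End Expansions.

Section Truncations.
Variables (K : fieldType) (G : orderedGroupType) (w : valuation {poly K} G).
Variable Q : {poly K}.
Hypotheses (Q_monic : Q \is monic) (Q_size : (1 < size Q)%N).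
Implicit Types f : {poly K}.

Lemma truncation_le f : truncation Q w f <= w f.
Proof.
rewrite {2}(digit_expansion Q_monic Q_size f); apply: v_sum_ge => i _.
by rewrite /truncation (bigD1 i) //= ge_min lexx.
Qed.

Lemma truncation_small f : (size f < size Q)%N -> truncation Q w f = w f.
Proof.
move=> h; apply/le_anti; rewrite truncation_le /=; apply/wt_bigmin_ge => i _.
rewrite -/(digit Q f i) digit_small //; case: ifP => [/eqP->|_].
  by rewrite expr0 mulr1.
by rewrite mul0r val_fun0 le_top.
Qed.

Lemma truncation_base : truncation Q w Q = w Q.
Proof.
apply/le_anti; rewrite truncation_le /=; apply/wt_bigmin_ge => -[[|[|i]] /= _] _.
- by rewrite expr0 divp1 modpp mul0r val_fun0 le_top.
- by rewrite expr1 divpp ?monic_neq0 // modp_small ?size_poly1 // mul1r.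
- rewrite divp_base_exp0 ?mod0p ?mul0r ?val_fun0 ?le_top //.
  by rewrite !mulnS -{1}[size Q]prednK ?(ltnW Q_size) // -add1n leq_add // ?leq_addr // -ltnS
    prednK ?(ltnW Q_size).
Qed.

(** Modulo the support, [f] equals its digit of index 0, and the other terms of the expansion have
    infinite value. Hence [w_Q < w] forces [w Q] to be finite. *)
Lemma truncation_top f : w Q = top -> truncation Q w f = w f.
Proof.
move=> Qt; apply/le_anti; rewrite truncation_le /=; apply/wt_bigmin_ge => -[[|i] /= _] _.
  rewrite expr0 mulr1 divp1; have -> : f %% Q = f - f %/ Q * Q.
    by rewrite {2}(divp_eq f Q) addrC addKr.
  by apply: le_trans (vB _ _ _); rewrite val_funM Qt wt_addtop le_min lexx le_top.
by rewrite val_funM exprS val_funM Qt addtop wt_addtop le_top.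
Qed.

End Truncations.

(** * Pair valuations and their comparison on linear factors *)

Section PairValuations.
Variables (L : closedFieldType) (G : orderedGroupType) (v : valuation L G).
Variables (a : L) (d : G).
Implicit Types (p q : {poly L}) (b : L) (k l : nat) (t s : G).

Let shift p : {poly L} := p \Po ('X + a%:P).

Lemma closed_poly_ind (P : {poly L} -> Prop) :
  (forall c, c != 0 -> P c%:P) ->
  (forall b p, p != 0 -> P p -> P (('X - b%:P) * p)) -> forall p, p != 0 -> P p.
Proof.
move=> PC PX p p0; have [r ->] := closed_field_poly_normal p.
have c0 : lead_coef p != 0 by rewrite lead_coef_eq0.
suff [] : P (lead_coef p *: \prod_(z <- r) ('X - z%:P)) /\
  lead_coef p *: \prod_(z <- r) ('X - z%:P) != 0 by [].
elim: r => [|z r [IH IH0]]; first by rewrite big_nil alg_polyC polyC_eq0; split; [exact: PC|].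
rewrite big_cons scalerAr; split; first exact: PX.
by rewrite mulf_neq0 // polyXsubC_eq0.
Qed.

Lemma pair_valuation0 : pair_valuation v a d 0 = top.
Proof. by rewrite /pair_valuation comp_poly0; exact: (gauss0 v d). Qed.

Lemma pair_valuation1 : pair_valuation v a d 1 = 0.
Proof. by rewrite /pair_valuation -polyC1 comp_polyC; exact: (gauss1 v d). Qed.

Lemma pair_valuationM p q :
  pair_valuation v a d (p * q) = pair_valuation v a d p + pair_valuation v a d q.
Proof. by rewrite /pair_valuation comp_polyM; exact: gaussM. Qed.

Lemma pair_valuationD p q :
  Order.min (pair_valuation v a d p) (pair_valuation v a d q) <= pair_valuation v a d (p + q).
Proof. by rewrite /pair_valuation comp_polyD; exact: gaussD. Qed.

Definition pairv : valuation {poly L} G :=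
  Valuation pair_valuation0 pair_valuation1 pair_valuationM pair_valuationD.

Definition ptop p k t := top_at v d (shift p) k t.

Lemma ptop_val p k t : ptop p k t -> pairv p = fin t.
Proof. exact: top_at_gauss. Qed.

Lemma ptop_mul p q k l t s : ptop p k t -> ptop q l s -> ptop (p * q) (k + l) (t + s).
Proof. by rewrite /ptop /shift comp_polyM; exact: top_at_mul. Qed.

Lemma ptop1 : ptop 1 0 0.
Proof. by rewrite /ptop /shift -polyC1 comp_polyC; apply: top_atC; rewrite val_fun1. Qed.

Lemma ptopC (c : L) t : v c = fin t -> ptop c%:P 0 t.
Proof. by rewrite /ptop /shift comp_polyC; exact: top_atC. Qed.

Lemma ptop_exp p k t n : ptop p k t -> ptop (p ^+ n) (k * n) (t *+ n).
Proof.
move=> h; elim: n => [|n IH]; first by rewrite muln0; exact: ptop1.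
by rewrite exprS mulnS mulrS; exact: ptop_mul.
Qed.

Lemma shift_eq0 p : (shift p == 0) = (p == 0).
Proof. by rewrite comp_poly2_eq0 // -[a]opprK polyCN size_XsubC. Qed.

Lemma ptop_ex p : p != 0 -> exists k t, ptop p k t.
Proof. by rewrite -shift_eq0; exact: top_at_ex. Qed.

Lemma ptop_inj p k l t s : ptop p k t -> ptop p l s -> k = l.
Proof.
move=> h h'; have ets : t = s by apply: fin_inj; apply: etrans (esym (ptop_val h)) (ptop_val h').
move: h h'; rewrite ets => -[ek _ gk] [el _ gl]; apply/eqP;
  rewrite eqn_leq [(k <= l)%N]leqNgt [(l <= k)%N]leqNgt.
by apply/andP; split; apply/negP; [move/gl; rewrite ek ltxx | move/gk; rewrite el ltxx].
Qed.

Lemma pairvC c : pairv c%:P = v c.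
Proof. by rewrite /= /pair_valuation comp_polyC; exact: gaussC. Qed.

Lemma shiftXsubC b : shift ('X - b%:P) = 'X + (a - b)%:P.
Proof. by rewrite /shift comp_polyB comp_polyX comp_polyC -addrA -polyCB. Qed.

Lemma wcoef_shiftX b i : wcoef v d (shift ('X - b%:P)) i =
  if i == 0%N then v (a - b) else if i == 1%N then fin d else top.
Proof.
rewrite shiftXsubC /wcoef coefD coefX coefC; case: i => [|[|i]] /=.
- by rewrite add0r fin0 addr0.
- by rewrite addr0 val_fun1 mulr1n add0r.
- by rewrite addr0 val_fun0.
Qed.

Lemma ptopX_near b : fin d <= v (a - b) -> ptop ('X - b%:P) 1 d.
Proof.
move=> h; split=> [|i|i i1]; rewrite wcoef_shiftX //; last by case: i i1 => [|[]].
by case: i => [|[|i]].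
Qed.

Lemma ptopX_far b t : v (a - b) = fin t -> fin t < fin d -> ptop ('X - b%:P) 0 t.
Proof.
move=> h td; split=> [|i|i i1]; rewrite wcoef_shiftX //; last by case: i i1 => [|[]].
by case: i => [|[|i]]; rewrite /= ?h ?lexx ?(ltW td).
Qed.

(** A root outside the ball of radius [d] around [a] contributes a linear factor whose constant term
    strictly dominates. *)
Lemma ptop_far p : p != 0 -> (forall b, root p b -> v (a - b) < fin d) ->
  exists t, ptop p 0 t.
Proof.
move: p; apply: closed_poly_ind => [c c0 _|b p p0 IH h].
  by have /ntopP[t ct] : v c != top by [rewrite v_ntop]; exists t; exact: ptopC.
have [|t pt] := IH; first by move=> z pz; apply: h; rewrite rootM pz orbT.
have bd : v (a - b) < fin d by apply: h; rewrite rootM root_XsubC eqxx.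
have /ntopP[s bs] := wt_lt_ntop bd; exists (s + t).
by apply: (@ptop_mul _ _ 0 0 _ _ _ pt); apply: ptopX_far; rewrite // -bs.
Qed.

Lemma ptop_near p b k t : root p b -> fin d <= v (a - b) -> ptop p k t -> (0 < k)%N.
Proof.
move=> /factor_theorem[q ->] h pk; have := top_at_neq0 pk.
rewrite shift_eq0 mulf_eq0 => /norP[q0 _]; have [l [s ql]] := ptop_ex q0.
by rewrite (ptop_inj pk (ptop_mul ql (ptopX_near h))) addn1.
Qed.

Lemma coef0_shift p : (shift p)`_0 = p.[a].
Proof. by rewrite -horner_coef0 horner_comp !hornerE. Qed.

Lemma ptop0_horner p t : ptop p 0 t -> v p.[a] = fin t.
Proof. by case=> <- _ _; rewrite /wcoef coef0_shift mulr0n fin0 addr0. Qed.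

(** Index 0 means that the constant term strictly dominates in the expansion in powers of [X - a],
    so [p] has the initial form of the constant [p.[a]]. *)
Lemma ptop0_sim p t : ptop p 0 t -> fin t < pairv (p - (p.[a])%:P).
Proof.
move=> [_ _ gt]; have [->|n0] := eqVneq (p - p.[a]%:P) 0; first by rewrite val_fun0.
have [k [s hs]] := ptop_ex n0; rewrite (ptop_val hs); case: hs => <- _ _.
have coefE i : (shift (p - p.[a]%:P))`_i = if i == 0%N then 0 else (shift p)`_i.
  rewrite /shift comp_polyB comp_polyC coefB coefC; case: ifP => [/eqP->|_].
    by rewrite coef0_shift subrr.
  by rewrite subr0.
rewrite /wcoef coefE; case: k => [|k] /=; first by rewrite val_fun0.
exact: gt.
Qed.

Lemma pairvX b : pairv ('X - b%:P) = Order.min (fin d) (v (a - b)).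
Proof.
have [h|h] := leP (fin d) (v (a - b)); first exact: ptop_val (ptopX_near h).
by have /ntopP[s bs] := wt_lt_ntop h; rewrite bs; apply: ptop_val; apply: ptopX_far;
  rewrite // -bs.
Qed.

Lemma pairv_ntop p : p != 0 -> pairv p != top.
Proof. by move=> /ptop_ex[k [t /ptop_val->]]. Qed.

Section Comparison.
Variable w : valuation {poly L} G.
Hypotheses (wC : forall c, w c%:P = v c) (wXa : w ('X - a%:P) = fin d).

Let XbE b : 'X - b%:P = ('X - a%:P) + (a - b)%:P.
Proof. by rewrite polyCB addrA subrK. Qed.

Lemma pairvX_le b : pairv ('X - b%:P) <= w ('X - b%:P).
Proof. by rewrite pairvX -wXa -wC (XbE b) val_funD. Qed.

Lemma pairvX_eq b : w ('X - b%:P) <= fin d -> pairv ('X - b%:P) = w ('X - b%:P).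
Proof.
move=> h; apply/le_anti; rewrite pairvX_le pairvX le_min h /=.
have e : ('X - b%:P) - ('X - a%:P) = (a - b)%:P.
  by rewrite XbE addrAC subrr add0r.
by have := vB w ('X - b%:P) ('X - a%:P); rewrite e wC wXa min_l.
Qed.

Lemma pairvX_lt b : fin d < w ('X - b%:P) -> pairv ('X - b%:P) < w ('X - b%:P).
Proof. by apply: le_lt_trans; rewrite pairvX ge_min lexx. Qed.

Lemma pairv_le p : pairv p <= w p.
Proof.
have [->|] := eqVneq p 0; first by rewrite !val_fun0.
move: p; apply: closed_poly_ind => [c c0|b p _ IH]; first by rewrite pairvC wC.
by rewrite !val_funM wt_leD // pairvX_le.
Qed.

(** If [w (X - b) <= w (X - a) = d], the ultrametric inequality forces [w (X - b)] to be the minimum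
    of [d] and [v (a - b)], which is the pair valuation; both sides are multiplicative. *)
Lemma pairv_eq p : p != 0 -> (forall b, root p b -> w ('X - b%:P) <= fin d) ->
  pairv p = w p.
Proof.
move: p; apply: closed_poly_ind => [c c0 _|b p _ IH h]; first by rewrite pairvC wC.
rewrite !val_funM pairvX_eq ?h ?rootM ?root_XsubC ?eqxx // IH // => z pz.
by rewrite h // rootM pz orbT.
Qed.

Lemma pairv_lt p b : p != 0 -> root p b -> fin d < w ('X - b%:P) -> pairv p < w p.
Proof.
move=> + /factor_theorem[q eq] h; rewrite eq mulf_eq0 => /norP[q0 _].
by rewrite mulrC !val_funM; apply: wt_ltD; rewrite ?pairvX_lt ?pairv_le ?pairv_ntop.
Qed.

Lemma root_gt_of_pairv_lt p : pairv p < w p -> exists2 b, root p b & fin d < w ('X - b%:P).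
Proof.
have [->|p0] := eqVneq p 0; first by rewrite !val_fun0 ltxx.
move=> h; apply: contrapT => n; move: h; rewrite pairv_eq ?ltxx // => b pb.
by rewrite leNgt; apply/negP => h; apply: n; exists b.
Qed.
End Comparison.

Lemma pairv_sum N n (p : nat -> {poly L}) : (0 < N)%N ->
  (forall i, (i < n)%N -> p i = 0 \/ exists t, ptop (p i) (i * N) t) ->
  pairv (\sum_(i < n) p i) = \big[Order.min/top]_(i < n) pairv (p i).
Proof.
move=> N0 h; rewrite /= /pair_valuation raddf_sum.
apply: (gauss_sum (p := fun i => shift (p i)) N0) => i i_n.
by have [->|] := h i i_n; [left; rewrite /shift comp_poly0 | right].
Qed.

End PairValuations.

(** * Enlarging the value group *)

Section WithTopMap.
Variables (G G' : orderedGroupType) (j : {additive G -> G'}).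
Hypothesis j_mono : {mono j : x y / x <= y}.
Implicit Types x y : withtop G.

Local Notation tmap := (withtop_map j).

Lemma tmap_le x y : (tmap x <= tmap y) = (x <= y).
Proof. by case: x => [a|]; case: y => [b|] //; exact: j_mono. Qed.

Lemma tmap_inj : injective tmap.
Proof. by move=> x y e; apply/le_anti; rewrite -tmap_le -[y <= x]tmap_le e lexx. Qed.

Lemma tmap_lt x y : (tmap x < tmap y) = (x < y).
Proof. by rewrite !ltNge tmap_le. Qed.

Lemma tmap_min x y : tmap (Order.min x y) = Order.min (tmap x) (tmap y).
Proof.
have [h|h] := leP x y; first by rewrite min_l // tmap_le.
by rewrite min_r // tmap_le ltW.
Qed.

Lemma tmapD x y : tmap (x + y) = tmap x + tmap y.
Proof. by case: x => [a|]; case: y => [b|] //; rewrite /= raddfD. Qed.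

Lemma tmap0 : tmap 0 = 0. Proof. by rewrite -fin0 /= raddf0. Qed.

Section MapValuation.
Variables (R : comNzRingType) (v : valuation R G).

Lemma map_val0 : tmap (v 0) = top. Proof. by rewrite val_fun0. Qed.
Lemma map_val1 : tmap (v 1) = 0. Proof. by rewrite val_fun1 tmap0. Qed.
Lemma map_valM f g : tmap (v (f * g)) = tmap (v f) + tmap (v g).
Proof. by rewrite val_funM tmapD. Qed.
Lemma map_valD f g : Order.min (tmap (v f)) (tmap (v g)) <= tmap (v (f + g)).
Proof. by rewrite -tmap_min tmap_le val_funD. Qed.

(** A common extension of [w] and [vb] to polynomials over [Kb] may take values in a larger group,
    so [vb] is pushed along the order embedding [j]. *)
Definition map_valuation : valuation R G' :=
  Valuation map_val0 map_val1 map_valM map_valD.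
End MapValuation.

Lemma pair_valuation_map (L : closedFieldType) (v : valuation L G) a d p :
  pair_valuation (map_valuation v) a (j d) p = tmap (pair_valuation v a d p).
Proof.
rewrite /pair_valuation (big_morph tmap tmap_min (erefl _)).
by apply: eq_bigr => i _; rewrite tmapD /= raddfMn.
Qed.
End WithTopMap.

(** * Truncation at an abstract key polynomial *)

Section KeyPolynomialTheory.
Variables (K : fieldType) (Kb : closedFieldType) (iota : {rmorphism K -> Kb}).
Hypothesis Kb_algebraic : forall a : Kb, algebraicOver iota a.
Variables (G G' : orderedGroupType) (j : {additive G -> G'}).
Hypothesis j_mono : {mono j : x y / x <= y}.
Variables (vb : valuation Kb G) (w : valuation {poly K} G) (wb : valuation {poly Kb} G').
Hypothesis wb_w : forall f : {poly K}, wb (map_poly iota f) = withtop_map j (w f).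
Hypothesis wb_vb : forall a : Kb, wb a%:P = withtop_map j (vb a).
Implicit Types (f g Q : {poly K}) (a b : Kb).

Local Notation "f ^i" := (map_poly iota f) (at level 2, format "f ^i").
Local Notation wX b := (wb ('X - b%:P)).
Local Notation vb' := (map_valuation j_mono vb).

Lemma deltaP f : (1 < size f)%N ->
  (exists2 a, root f^i a & wX a = delta iota wb f) /\
  (forall a, root f^i a -> wX a <= delta iota wb f).
Proof.
move=> sf; apply: (@xgetPex _ top [set d | (exists2 a, root f^i a & wX a = d) /\
  forall a, root f^i a -> wX a <= d]).
have f0 : f^i != 0 by rewrite map_poly_eq0 -size_poly_gt0 ltnW.
have [r fE] := closed_field_poly_normal f^i.
have rE z : root f^i z = (z \in r).
  by rewrite fE rootZ ?lead_coef_eq0 // root_prod_XsubC.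
have [z0 z0f] : exists z, root f^i z.
  by apply/closed_rootP; rewrite size_map_poly; case: size sf => [|[]].
pose F (i : 'I_(size r)) := wX r`_i.
have z0r : z0 \in r by rewrite -rE.
have i0 : (index z0 r < size r)%N by rewrite index_mem.
pose i := [arg max_(i > Ordinal i0) F i]%O; exists (F i); split.
  by exists r`_i => //; rewrite rE mem_nth.
move=> a; rewrite rE => ar; have ia : (index a r < size r)%N by rewrite index_mem.
rewrite /i; case: arg_maxP => // k _ /(_ (Ordinal ia) isT).
by rewrite /F /= nth_index.
Qed.

Lemma delta_max f a : (1 < size f)%N -> root f^i a -> wX a <= delta iota wb f.
Proof. by move=> /deltaP[_]; exact. Qed.

Lemma key_poly_root Q b : abstract_key_poly iota wb Q ->
  (size (minpoly iota b) < size Q)%N -> wX b < delta iota wb Q.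
Proof.
move=> [_ _ Qk] sb; apply: le_lt_trans (Qk (minpoly iota b) _).
  exact: delta_max (minpoly_size_gt1 Kb_algebraic b) (minpoly_root Kb_algebraic b).
by rewrite sb minpoly_size_gt1.
Qed.

Lemma key_poly_root_small Q f b : abstract_key_poly iota wb Q -> f != 0 ->
  (size f < size Q)%N -> root f^i b -> wX b < delta iota wb Q.
Proof.
move=> Qk f0 fQ fb; apply: key_poly_root => //.
exact: leq_ltn_trans (minpoly_size Kb_algebraic f0 fb) fQ.
Qed.

(** A proper factor vanishing at the root where [delta Q] is attained would have smaller degree but
    no smaller [delta]. *)
Lemma key_poly_irreducible Q : abstract_key_poly iota wb Q -> irreducible_poly Q.
Proof.
move=> Qk; have [Qm sQ _] := Qk; split=> // q sq qQ.
have Q0 := monic_neq0 Qm; rewrite -dvdp_size_eqp // eqn_leq dvdp_leq //=.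
have [[a Qa Ea] _] := deltaP sQ; have QE := divpK qQ; set r := Q %/ q in QE.
have r0 : r != 0 by apply: contra_neq Q0 => r0; rewrite -QE r0 mul0r.
have q0 : q != 0 by apply: contra_neq Q0 => q0; rewrite -QE q0 mulr0.
rewrite leqNgt; apply/negP => qltQ; have rltQ : (size r < size Q)%N.
  rewrite -QE size_mul // -subn1 -addnBA ?size_poly_gt0 // -[ltnLHS]addn0 ltn_add2l.
  by rewrite subn_gt0 ltn_neqAle eq_sym sq size_poly_gt0.
have lt f : f != 0 -> (size f < size Q)%N -> root f^i a -> False.
  by move=> f0 fQ fa; have := key_poly_root_small Qk f0 fQ fa; rewrite Ea ltxx.
by move: Qa; rewrite -QE rmorphM rootM => /orP[]; [exact: lt | exact: lt].
Qed.

(** The constant [a - b] is the difference of [X - b] and [X - a], whose values differ. This turns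
    distances in [Kb] into values of linear polynomials. *)
Lemma wX_difference a b : wX b < wX a -> vb' (a - b) = wX b.
Proof.
move=> h; rewrite /= -wb_vb.
have -> : (a - b)%:P = ('X - b%:P) - ('X - a%:P).
  by rewrite opprB [RHS]addrC addrA subrK polyCB.
by rewrite vD_lt // vN.
Qed.

Section TruncationAtKeyPolynomial.
Variables (Q : {poly K}) (a : Kb) (d : G').
Hypotheses (Q_key : abstract_key_poly iota wb Q) (Q_a : root Q^i a).
Hypotheses (a_max : wX a = delta iota wb Q) (a_d : wX a = fin d).

Let Q_monic : Q \is monic. Proof. by case: Q_key. Qed.
Let Q_size : (1 < size Q)%N. Proof. by case: Q_key. Qed.

Lemma key_small_ptop f : f != 0 -> (size f < size Q)%N ->
  exists t, ptop vb' a d f^i 0 t.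
Proof.
move=> f0 fQ; apply: ptop_far; first by rewrite map_poly_eq0.
move=> b fb; have lt : wX b < wX a by rewrite a_max (key_poly_root_small Q_key f0).
by rewrite (wX_difference lt) -a_d.
Qed.

Lemma key_base_ptop : exists k t, (0 < k)%N /\ ptop vb' a d Q^i k t.
Proof.
have [|k [t kt]] := @ptop_ex _ _ vb' a d Q^i; first by rewrite map_poly_eq0 monic_neq0.
by exists k, t; split=> //; apply: ptop_near Q_a _ kt; rewrite subrr val_fun0 le_top.
Qed.

Lemma key_small_val f : (size f < size Q)%N -> pairv vb' a d f^i = wb f^i.
Proof.
have [->|f0 fQ] := eqVneq f 0; first by rewrite rmorph0 !val_fun0.
apply: pairv_eq; rewrite ?map_poly_eq0 // => b fb.
by rewrite -a_d a_max ltW // (key_poly_root_small Q_key f0).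
Qed.

Lemma key_base_val : pairv vb' a d Q^i = wb Q^i.
Proof.
apply: pairv_eq; rewrite ?map_poly_eq0 ?monic_neq0 // => b Qb.
by rewrite -a_d a_max delta_max.
Qed.

(** Digits attain their minimum last at index 0 and [Q] does at some [k > 0], so the term of index
    [i] does at [k * i]; these indices are distinct and [pairv_sum] applies. On digits and on [Q]
    the pair valuation agrees with [wb], because the roots [b] involved satisfy
    [wb (X - b) <= d]. *)
Lemma pairv_truncation f : pairv vb' a d f^i = withtop_map j (truncation Q w f).
Proof.
have [k [t [k0 kt]]] := key_base_ptop.
have -> : f^i = \sum_(i < size f) (digit Q f i * Q ^+ i)^i.
  by rewrite {1}(digit_expansion Q_monic Q_size f) rmorph_sum.
rewrite (pairv_sum (p := fun i => (digit Q f i * Q ^+ i)^i) k0); last first.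
  move=> i _; have [->|n0] := eqVneq (digit Q f i) 0; first by left; rewrite mul0r rmorph0.
  have [s h] := key_small_ptop n0 (size_digit Q_monic f i).
  right; exists (s + t *+ i); rewrite rmorphM rmorphXn mulnC -[(k * i)%N]add0n.
  by apply: ptop_mul => //; exact: ptop_exp.
rewrite /truncation (big_morph (withtop_map j) (tmap_min j_mono) (erefl _)).
apply: eq_bigr => i _; rewrite -wb_w !rmorphM !rmorphXn !val_funM !vX.
by rewrite key_small_val ?size_digit // key_base_val.
Qed.

End TruncationAtKeyPolynomial.

Lemma delta_top_truncation Q f : abstract_key_poly iota wb Q ->
  delta iota wb Q = top -> truncation Q w f = w f.
Proof.
move=> [Qm Qs _] dt; apply: truncation_top => //.
have [[a /factor_theorem[q Qa] Ea] _] := deltaP Qs.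
apply: (tmap_inj j_mono); rewrite -wb_w Qa val_funM Ea dt.
by rewrite wt_addtop.
Qed.

(** The pair valuation at [a] and [delta Q] reduces this to linear factors over [Kb]. For infinite
    [delta Q] the truncation is [w] itself and no root can exceed it. *)
Lemma truncation_ltP Q f : abstract_key_poly iota wb Q -> f != 0 ->
  truncation Q w f < w f <-> exists2 b, root f^i b & delta iota wb Q < wX b.
Proof.
move=> Qk f0; have [Qm Qs _] := Qk; have [[a Qa Ea] _] := deltaP Qs.
have [dt|/ntopP[d dd]] := eqVneq (delta iota wb Q) top.
  rewrite delta_top_truncation // ltxx; split=> // -[b _].
  by rewrite dt ltNge le_top.
have ad : wX a = fin d by rewrite Ea.
rewrite dd -(tmap_lt j_mono) -wb_w -(pairv_truncation Qk Qa Ea ad).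
split; first exact: root_gt_of_pairv_lt.
by move=> [b fb h]; apply: pairv_lt fb h => //; rewrite map_poly_eq0.
Qed.

End KeyPolynomialTheory.

(** * The decomposition group *)

Section SeparableElements.
Variables (K : fieldType) (Kb : closedFieldType) (iota : {rmorphism K -> Kb}).
Hypothesis Kb_algebraic : forall a : Kb, algebraicOver iota a.
Implicit Types (a b : Kb).

(** [K(a, b)] is realized as a tower of two abstract simple extensions, so that the theory of
    separable elements of finite extensions applies inside [Kb]. *)
Lemma finite_extension_pair a b : exists (E : fieldExtType K) (f : {rmorphism E -> Kb}),
  [/\ forall c : K, f c%:A = iota c, exists x, f x = a & exists y, f y = b].
Proof.
have irr1 := minpoly_irreducible Kb_algebraic a.
have r1 := minpoly_root Kb_algebraic a.
pose E1 : fieldExtType K := SubFieldExtType r1 irr1.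
pose f1 : {rmorphism E1 -> Kb} := subfx_inj (iota := iota) (z := a) (p := minpoly iota a).
have f1K (c : K) : f1 c%:A = iota c by exact: subfx_inj_base r1 (irredp_neq0 irr1) c.
have alg1 c : algebraicOver f1 c.
  have [p p0 pc] := Kb_algebraic c; exists (map_poly (in_alg E1) p).
    by rewrite map_poly_eq0.
  by rewrite -map_poly_comp (eq_map_poly (g := iota)).
have irr2 := minpoly_irreducible alg1 b; have r2 := minpoly_root alg1 b.
pose E2 : fieldExtType E1 := SubFieldExtType r2 irr2.
pose f2 : {rmorphism E2 -> Kb} := subfx_inj (iota := f1) (z := b) (p := minpoly f1 b).
have f2E (c : E1) : f2 c%:A = f1 c by exact: subfx_inj_base r2 (irredp_neq0 irr2) c.
exists (baseFieldType E2), f2; split.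
- by move=> c; rewrite -f1K -f2E; congr (f2 _); exact: baseField_scaleE.
- exists (in_alg E2 (subfx_root iota a (minpoly iota a))).
  by rewrite f2E; exact: subfx_inj_root r1 (irredp_neq0 irr1).
- by exists (subfx_root f1 b (minpoly f1 b)); exact: subfx_inj_root r2 (irredp_neq0 irr2).
Qed.

Lemma separable_minpoly_ext (E : fieldExtType K) (f : {rmorphism E -> Kb}) (x : E) :
  (forall c : K, f c%:A = iota c) ->
  separable_poly (minpoly iota (f x)) = separable_element 1%AS x.
Proof.
move=> fK; have /polyOver1P[p pE] := minPolyOver 1%AS x.
have fmap q : map_poly f (map_poly (in_alg E) q) = map_poly iota q.
  by rewrite -map_poly_comp (eq_map_poly (g := iota)).
suff -> : minpoly iota (f x) = p by rewrite /separable_element pE separable_map.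
have pm : p \is monic by rewrite -(map_monic (in_alg E)) -pE monic_minPoly.
have px : root (map_poly iota p) (f x) by rewrite -fmap fmorph_root -pE root_minPoly.
apply/eqP; rewrite -eqp_monic ?minpoly_monic //.
rewrite /eqp (minpoly_dvd Kb_algebraic px) /=.
rewrite -(dvdp_map (in_alg E)) -pE; apply: minPoly_dvdp; first exact: alg_polyOver.
by rewrite -(fmorph_root f) fmap minpoly_root.
Qed.

Lemma separable_subfield : is_subfield [set a | separable_poly (minpoly iota a)].
Proof.
(* Differences and quotients are treated together: [op] is the operation in an abstract extension,
   [opb] its counterpart in [Kb]. *)
have closed (op : forall E : fieldExtType K, E -> E -> E) (opb : Kb -> Kb -> Kb) :
    (forall (E : fieldExtType K) (f : {rmorphism E -> Kb}) x y, f (op E x y) = opb (f x) (f y)) ->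
    (forall (E : fieldExtType K) (U : {subfield E}) x y, x \in U -> y \in U -> op E x y \in U) ->
    forall a b, separable_poly (minpoly iota a) -> separable_poly (minpoly iota b) ->
      separable_poly (minpoly iota (opb a b)).
  move=> opf opU a b; have [E [f [fK [x <-] [y <-]]]] := finite_extension_pair a b.
  rewrite -opf !(separable_minpoly_ext _ fK) => sx sy.
  have sx' := separable_elementS (subv_adjoin 1%AS y) sx.
  (* A primitive element [z] of [K(x, y)] is separable over [K] by transitivity, hence so is
     everything in [K(z)]. *)
  have [z defz] := Primitive_Element_Theorem x sy.
  have /(adjoin_separableP _) : op E x y \in <<1; z>>%AS.
    rewrite /= -defz; apply: (opU _ <<<<1; y>>; x>>%AS); first exact: memv_adjoin.
    by apply: subvP_adjoin; exact: memv_adjoin.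
  by apply; apply: adjoin_separable sy (adjoin_separable sx' _);
    rewrite defz base_separable ?memv_adjoin.
split=> /= [|a b|a b].
- have [E [f [fK _ _]]] := finite_extension_pair 0 0.
  by rewrite -(rmorph1 f) (separable_minpoly_ext _ fK) base_separable // mem1v.
- by apply: (closed (fun E x y => x - y) (fun x y => x - y)) => [E f x y|E U x y];
    [rewrite rmorphB | exact: rpredB].
- by apply: (closed (fun E x y => x / y) (fun x y => x / y)) => [E f x y|E U x y];
    [rewrite fmorph_div | exact: rpred_div].
Qed.

(** Algebraic extensions are purely inseparable over their separable part; in characteristic 0 the
    exponent is 1. *)
Lemma separable_power a : exists2 n, [pchar Kb].-nat n & separable_poly (minpoly iota (a ^+ n)).
Proof.
have [E [f [fK [x <-] _]]] := finite_extension_pair a a.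
have [n /andP[En sn]] := separable_exponent_pchar 1%AS x; exists n.
  by rewrite (eq_pnat _ (fmorph_pchar f)).
by rewrite -rmorphXn (separable_minpoly_ext _ fK).
Qed.

End SeparableElements.

(** * Polynomials with coefficients in a subfield *)

Section Subfields.
Variables (L : fieldType) (S : set L).
Hypothesis S_sub : is_subfield S.

Lemma subfield1 : S 1. Proof. by case: S_sub. Qed.
Lemma subfieldB x y : S x -> S y -> S (x - y). Proof. by case: S_sub => _ h _; exact: h. Qed.
Lemma subfield0 : S 0. Proof. by rewrite -(subrr 1); apply: subfieldB; exact: subfield1. Qed.
Lemma subfieldN x : S x -> S (- x).
Proof. by move=> Sx; rewrite -sub0r; apply: subfieldB => //; exact: subfield0. Qed.
Lemma subfieldD x y : S x -> S y -> S (x + y).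
Proof. by move=> Sx Sy; rewrite -[y]opprK; apply: subfieldB => //; exact: subfieldN. Qed.
Lemma subfield_div x y : S x -> S y -> S (x / y).
Proof. by case: S_sub => _ _ h; exact: h. Qed.
Lemma subfieldV x : S x -> S x^-1.
Proof. by move=> Sx; rewrite -[x^-1]mul1r; apply: subfield_div => //; exact: subfield1. Qed.
Lemma subfieldM x y : S x -> S y -> S (x * y).
Proof. by move=> Sx Sy; rewrite -[y]invrK; apply: subfield_div => //; exact: subfieldV. Qed.
Lemma subfieldX x n : S x -> S (x ^+ n).
Proof.
move=> Sx; elim: n => [|n IH]; first by rewrite expr0; exact: subfield1.
by rewrite exprS; exact: subfieldM.
Qed.
Lemma subfield_sum (I : Type) (r : seq I) (F : I -> L) : (forall i, S (F i)) ->
  S (\sum_(i <- r) F i).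
Proof. by move=> h; elim/big_ind: _; [exact: subfield0 | exact: subfieldD |]. Qed.

Lemma subfield_div_monic (f g : {poly L}) : coefs_in S f -> coefs_in S g -> g \is monic ->
  exists q r, [/\ coefs_in S q, coefs_in S r, f = q * g + r & (size r < size g)%N].
Proof.
move=> + Sg gm; have [n] := ubnP (size f); elim: n f => // n IH f sf Sf.
have [lt|le] := ltnP (size f) (size g).
  by exists 0, f; split=> //; [move=> i; rewrite coef0; exact: subfield0 | rewrite mul0r add0r].
have f0 : (0 < size f)%N by apply: leq_trans le; rewrite size_poly_gt0 monic_neq0.
pose m := lead_coef f *: 'X^(size f - size g); have Sm : coefs_in S m.
  move=> i; rewrite coefZ coefXn; apply: subfieldM; first exact: Sf.
  by case: eqP => _; [exact: subfield1 | exact: subfield0].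
have Smg : coefs_in S (m * g).
  by move=> i; rewrite coefM; apply: subfield_sum => k; exact: subfieldM.
have [|i|q [r [Sq Sr fE sr]]] := IH (f - m * g).
- apply: leq_trans (_ : size f <= n)%N; last by rewrite -ltnS.
  rewrite -(ltn_predK f0) ltnS; apply/leq_sizeP => i.
  rewrite coefB /m -scalerAl coefZ coefXnM leq_eqVlt => /orP[/eqP <-|lt_i].
    rewrite ltnNge -subn1 leq_sub2l ?size_poly_gt0 ?monic_neq0 //=.
    by rewrite subnAC subKn // !subn1 -!lead_coefE (monicP gm) mulr1 subrr.
  have fi : (size f <= i)%N by rewrite -(ltn_predK f0).
  rewrite nth_default // ifF; last by apply/negbTE; rewrite -leqNgt (leq_trans _ fi) ?leq_subr.
  by rewrite nth_default ?mulr0 ?subr0 // leq_subRL ?subnK // (leq_trans _ fi) // leq_subr.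
- by rewrite coefB; exact: subfieldB.
exists (m + q), r; split=> //; last by rewrite mulrDl -addrA -fE addrC subrK.
by move=> i; rewrite coefD; exact: subfieldD.
Qed.

(** By division with remainder, a monic polynomial over [S] of least degree vanishing at [z] divides
    both [f] and [q]; irreducibility makes [f] a constant multiple of it. *)
Lemma irreducible_over_dvd (f q : {poly L}) z : irreducible_over S f ->
  coefs_in S q -> root f z -> root q z -> f %| q.
Proof.
move=> [Sf sf firr] Sq fz qz.
pose P n := `[< exists g, [/\ g \is monic, coefs_in S g, root g z & size g = n] >].
have f0 : f != 0 by rewrite -size_poly_gt0 ltnW.
have exP : exists n, P n.
  exists (size f); apply/asboolP; exists ((lead_coef f)^-1 *: f); split.
  - by rewrite monicE lead_coefZ mulVf // lead_coef_eq0.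
  - by move=> i; rewrite coefZ; apply: subfieldM => //; apply: subfieldV; exact: Sf.
  - by rewrite rootZ // invr_eq0 lead_coef_eq0.
  - by rewrite size_scale // invr_eq0 lead_coef_eq0.
case: (ex_minnP exP) => n /asboolP[g [gm Sg gz sg]] nmin.
have gdvd p : coefs_in S p -> root p z -> exists2 u, coefs_in S u & p = u * g.
  move=> Sp pz; have [u [r [Su Sr pE sr]]] := subfield_div_monic Sp Sg gm.
  exists u => //; suff r0 : r = 0 by rewrite pE r0 addr0.
  apply/eqP; apply: contraT => r0; have rz : root r z.
    by move: pz; rewrite pE !rootE !hornerE (rootP gz) mulr0 add0r.
  have : P (size r).
    apply/asboolP; exists ((lead_coef r)^-1 *: r); split.
    - by rewrite monicE lead_coefZ mulVf // lead_coef_eq0.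
    - by move=> i; rewrite coefZ; apply: subfieldM => //; apply: subfieldV; exact: Sr.
    - by rewrite rootZ // invr_eq0 lead_coef_eq0.
    - by rewrite size_scale // invr_eq0 lead_coef_eq0.
  by move/nmin; rewrite -sg leqNgt sr.
have [u Su fE] := gdvd f Sf fz; have [u' _ ->] := gdvd q Sq qz.
have g1 : (1 < size g)%N by apply: root_size_gt1 gz; exact: monic_neq0.
have [|s1] := firr u g Su Sg fE; last by rewrite s1 in g1.
move=> /eqP/size_poly1P[c c0 uE]; rewrite fE uE mul_polyC dvdpZl //.
exact: dvdp_mull.
Qed.

End Subfields.

Section Decomposition.
Variables (K : fieldType) (Kb : closedFieldType) (iota : {rmorphism K -> Kb}).
Hypothesis Kb_algebraic : forall a : Kb, algebraicOver iota a.
Variables (G : orderedGroupType) (vb : valuation Kb G).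

Definition decomposition (s : {rmorphism Kb -> Kb}) : Prop :=
  [/\ bijective s, forall c, s (iota c) = iota c & forall b, vb (s b) = vb b].

Lemma decomposition_comp s1 s2 : decomposition s1 -> decomposition s2 ->
  decomposition (s2 \o s1 : {rmorphism Kb -> Kb}).
Proof.
move=> [b1 f1 v1] [b2 f2 v2]; split=> [|c|b] /=; first exact: bij_comp.
  by rewrite f1 f2.
by rewrite v2 v1.
Qed.

Lemma decomposition_id : decomposition (idfun : {rmorphism Kb -> Kb}).
Proof. by split=> //; exists id. Qed.

Lemma decomposition_root s f b : decomposition s ->
  root (map_poly iota f) b -> root (map_poly iota f) (s b).
Proof.
move=> [_ fx _] fb; have -> : map_poly iota f = map_poly s (map_poly iota f).
  by rewrite -map_poly_comp; apply: eq_map_poly => c /=; rewrite fx.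
by rewrite fmorph_root.
Qed.

Lemma decomposition_alg_deg s b : decomposition s -> alg_deg iota (s b) = alg_deg iota b.
Proof.
move=> ds; rewrite {2}/alg_deg; apply: (irreducible_alg_deg Kb_algebraic).
  exact: minpoly_irreducible.
exact/decomposition_root/minpoly_root.
Qed.

Lemma henselization_subfield : is_subfield (henselization iota vb).
Proof.
have sep := separable_subfield Kb_algebraic; split.
- by split=> [|s _ _ _]; [exact: subfield1 sep | rewrite rmorph1].
- move=> x y [sx fx] [sy fy]; split=> [|s b1 b2 b3]; first exact: subfieldB sep _ _ sx sy.
  by rewrite rmorphB fx // fy.
- move=> x y [sx fx] [sy fy]; split=> [|s b1 b2 b3]; first exact: subfield_div sep _ _ sx sy.
  by rewrite fmorph_div fx // fy.
Qed.

Lemma poly_pchar_exp (p : {poly Kb}) n : [pchar Kb].-nat n ->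
  p ^+ n = \sum_(i < size p) (p`_i ^+ n) *: 'X^(i * n).
Proof.
move=> pn; rewrite -{1}[p]coefK poly_def.
have pn' : [pchar {poly Kb}].-nat n by rewrite (eq_pnat _ (pchar_poly Kb)).
have n0 : (0 < n)%N by case/andP: pn.
elim/big_rec2: _ => [|i x y _ <-]; first by rewrite expr0n gtn_eqF.
by rewrite exprDn_pchar // exprZn exprM.
Qed.

(* The orbit polynomial P of a root has coefficients fixed by the decomposition   *)
(* group, and a p-power of P has separable ones.                                  *)
Lemma decomposition_transitive (F : {poly K}) t t' :
  irreducible_over (henselization iota vb) (map_poly iota F) ->
  root (map_poly iota F) t -> root (map_poly iota F) t' ->
  exists2 s, decomposition s & s t = t'.
Proof.
move=> Firr Ft Ft'; have F0 : map_poly iota F != 0.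
  by case: Firr => _ sF _; rewrite -size_poly_gt0 ltnW.
have [r FE] := closed_field_poly_normal (map_poly iota F).
have rE z : root (map_poly iota F) z = (z \in r).
  by rewrite FE rootZ ?lead_coef_eq0 // root_prod_XsubC.
pose O z := `[< exists2 s, decomposition s & s t = z >].
pose o := [seq z <- undup r | O z].
have oE z : (z \in o) = O z.
  rewrite mem_filter mem_undup -rE andb_idr // => /asboolP[s ds <-].
  exact: decomposition_root.
pose P := \prod_(z <- o) ('X - z%:P).
(* An element of the decomposition group is injective on the finite orbit [o] and maps it into
   itself, so it permutes the factors of [P]. *)
have Pfix s : decomposition s -> map_poly s P = P.
  move=> ds; rewrite rmorph_prod /=.
  under eq_bigr do rewrite rmorphB /= map_polyX map_polyC.
  rewrite -(big_map s xpredT (fun z => 'X - z%:P)); apply: perm_big.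
  have uo : uniq o by rewrite filter_uniq ?undup_uniq.
  have us : uniq (map s o) by rewrite map_inj_uniq //; exact: fmorph_inj.
  have sub : {subset map s o <= o}.
    move=> _ /mapP[z + ->]; rewrite !oE => /asboolP[u du <-].
    by apply/asboolP; exists (s \o u : {rmorphism Kb -> Kb}) => //; exact: decomposition_comp.
  have so : (size o <= size (map s o))%N by rewrite size_map.
  by apply: uniq_perm => //; exact: (uniq_min_size us sub so).2.
(* One exponent serving all coefficients is the product of the exponents found for each of them. *)
have [N pN sepN] : exists2 N, [pchar Kb].-nat N &
    forall i, separable_poly (minpoly iota (P`_i ^+ N)).
  have sep := separable_subfield Kb_algebraic.
  suff [N pN sepN] : exists2 N, [pchar Kb].-nat N &
    forall i, (i < size P)%N -> separable_poly (minpoly iota (P`_i ^+ N)).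
    exists N => // i; have [/sepN //|h] := ltnP i (size P).
    rewrite nth_default // expr0n gtn_eqF; last by case/andP: pN.
    exact: subfield0 sep.
  elim: (size P) => [|n [N pN IH]]; first by exists 1%N.
  have [M pM sM] := separable_power Kb_algebraic P`_n.
  exists (N * M)%N; first by rewrite pnatM pN.
  move=> i; rewrite ltnS leq_eqVlt => /orP[/eqP->|/IH h].
    by rewrite mulnC exprM; apply: (subfieldX sep).
  by rewrite exprM; apply: (subfieldX sep).
have N0 : (0 < N)%N by case/andP: pN.
have hP i : henselization iota vb (P`_i ^+ N).
  split=> // s b1 b2 b3; have ds : decomposition s by [].
  by rewrite rmorphXn -coef_map Pfix.
have hPN : coefs_in (henselization iota vb) (P ^+ N).
  have sub := henselization_subfield.
  move=> k; rewrite poly_pchar_exp // coef_sum; apply: (subfield_sum sub) => i.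
  rewrite coefZ coefXn; apply: (subfieldM sub) => //.
  by case: (_ == _); [exact: (subfield1 sub) | exact: (subfield0 sub)].
have Pt z : root P z = O z by rewrite root_prod_XsubC oE.
have Ot : O t by apply/asboolP; exists (idfun : {rmorphism Kb -> Kb}) => //;
  exact: decomposition_id.
have rPN z : root (P ^+ N) z = O z by rewrite -Pt !rootE horner_exp expf_eq0 N0.
have PNt : root (P ^+ N) t by rewrite rPN.
(* [P ^+ N] has coefficients in the Henselization and shares the root [t] with the irreducible [F],
   so [F] divides it and all roots of [F] lie in the orbit of [t]. *)
have /dvdpP[q PE] := irreducible_over_dvd henselization_subfield Firr hPN Ft PNt.
have : root (P ^+ N) t' by rewrite PE rootM Ft' orbT.
by rewrite rPN => /asboolP.
Qed.

End Decomposition.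

(** * Distinguished pairs and minimal increase of the truncation *)

Section DistinguishedPairs.
Variables (K : fieldType) (Kb : closedFieldType) (iota : {rmorphism K -> Kb}).
Hypothesis Kb_algebraic : forall a : Kb, algebraicOver iota a.
Variables (G G' : orderedGroupType) (j : {additive G -> G'}).
Hypothesis j_mono : {mono j : x y / x <= y}.
Variables (vb : valuation Kb G) (w : valuation {poly K} G) (wb : valuation {poly Kb} G').
Hypothesis wb_w : forall f : {poly K}, wb (map_poly iota f) = withtop_map j (w f).
Hypothesis wb_vb : forall a : Kb, wb a%:P = withtop_map j (vb a).
Variables (F Q : {poly K}).
Hypothesis F_key : abstract_key_poly iota wb F.
Implicit Types (f : {poly K}) (a b t : Kb).

Local Notation "f ^i" := (map_poly iota f) (at level 2, format "f ^i").
Local Notation wX b := (wb ('X - b%:P)).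

Let F_monic : F \is monic. Proof. by case: F_key. Qed.
Let F_size : (1 < size F)%N. Proof. by case: F_key. Qed.
Let F_neq0 : F != 0. Proof. exact: monic_neq0. Qed.

Lemma vb_difference_le t a b : wX a < wX t -> wX b < wX t ->
  (vb (t - b) <= vb (t - a)) = (wX b <= wX a).
Proof.
move=> ha hb; rewrite -(tmap_le j_mono).
by rewrite -(wX_difference j_mono wb_vb ha) -(wX_difference j_mono wb_vb hb).
Qed.

Lemma vb_difference_lt t a b : wX a < wX t -> wX b < wX t ->
  (vb (t - b) < vb (t - a)) = (wX b < wX a).
Proof. by move=> ha hb; rewrite !ltNge vb_difference_le. Qed.

Lemma truncation_lt_of_size : abstract_key_poly iota wb Q -> (size Q < size F)%N ->
  truncation Q w F < w F.
Proof.
move=> Qk QF; have [_ Qs _] := Qk; have [_ _ Fk] := F_key.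
apply/(truncation_ltP Kb_algebraic j_mono wb_w wb_vb Qk F_neq0).
have [[t Ft Et] _] := deltaP iota wb F_size.
by exists t => //; rewrite Et Fk // Qs.
Qed.

(** Let [t] and [a] realize [delta F] and [delta Q]. An element [b] of smaller degree than [t] and
    closer to it than [a] would have [delta Q < wb (X - b)], so its minimal polynomial would
    contradict the minimality of [F]. Elements of degree below [deg Q] are farther from [t] than [a]
    because [Q] is a key polynomial. *)
Lemma distinguished_of_Phi : abstract_key_poly iota wb Q ->
  Phi (truncation Q w) w F -> (size Q < size F)%N -> distinguished_pair_poly iota vb F Q.
Proof.
move=> Qk [_ _ Fmin] QF; have [Qm Qs _] := Qk.
have Firr := key_poly_irreducible Kb_algebraic F_key.
have Qirr := key_poly_irreducible Kb_algebraic Qk.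
split=> //; have [[t Ft Et] _] := deltaP iota wb F_size.
have [[a Qa Ea] _] := deltaP iota wb Qs; exists t, a; split=> //.
have dt : alg_deg iota t = (size F).-1 := irreducible_alg_deg Kb_algebraic Firr Ft.
have da : alg_deg iota a = (size Q).-1 := irreducible_alg_deg Kb_algebraic Qirr Qa.
have dat : (alg_deg iota a < alg_deg iota t)%N.
  by rewrite dt da -ltnS !prednK // ltnW.
have lt b : (alg_deg iota b < alg_deg iota t)%N -> wX b < wX t.
  move=> db; rewrite Et; apply: (key_poly_root Kb_algebraic F_key).
  by rewrite size_minpoly // -(prednK (ltnW F_size)) -dt ltnS.
split=> // [b db|c dc].
- rewrite vb_difference_le ?lt // leNgt; apply/negP => h.
  have := Fmin (minpoly iota b) (minpoly_monic Kb_algebraic b).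
  rewrite (_ : (truncation Q w (minpoly iota b) < w (minpoly iota b)) = true); last first.
    apply/(truncation_ltP Kb_algebraic j_mono wb_w wb_vb Qk (minpoly_neq0 Kb_algebraic b)).
    by exists b; [exact: minpoly_root | rewrite -Ea].
  by move=> /(_ isT); rewrite size_minpoly // -(prednK (ltnW F_size)) -dt ltnS leqNgt db.
- rewrite vb_difference_lt ?lt ?(ltn_trans dc) // Ea; apply: (key_poly_root Kb_algebraic Qk).
  by rewrite size_minpoly // -(prednK (ltnW Qs)) -da ltnS.
Qed.

Lemma distinguished_decomposition s t a : decomposition iota vb s ->
  distinguished_pair iota vb t a -> distinguished_pair iota vb (s t) (s a).
Proof.
move=> ds [dat hb hc]; have [[s' _ s'K] sf sv] := ds.
have dE b : alg_deg iota (s b) = alg_deg iota b by exact: decomposition_alg_deg ds.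
split=> [|b|c]; first by rewrite !dE.
  by rewrite -(s'K b) !dE -!rmorphB !sv; exact: hb.
by rewrite -(s'K c) !dE -!rmorphB !sv; exact: hc.
Qed.

Lemma Phi_of_distinguished : irreducible_over (henselization iota vb) F^i ->
  Q \is monic -> distinguished_pair_poly iota vb F Q ->
  [/\ abstract_key_poly iota wb Q, val_lt (truncation Q w) w,
      Phi (truncation Q w) w F & (size Q < size F)%N].
Proof.
move=> FirrH Qm [Firr Qirr [t1 [a1 [Ft1 Qa1 D1]]]].
have [[t Ft Et] _] := deltaP iota wb F_size.
(* The given pair may involve a root of [F] other than [t]; an automorphism preserving [vb] moves it
   to [t] and keeps it distinguished. *)
have [s ds st] := decomposition_transitive Kb_algebraic FirrH Ft1 Ft.
have := distinguished_decomposition ds D1; rewrite st.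
have := decomposition_root ds Qa1; move: (s a1) => a Qa {t1 a1 Ft1 Qa1 D1 s ds st}.
move=> [dat near far].
have Qs : (1 < size Q)%N by case: Qirr.
have dt : alg_deg iota t = (size F).-1 := irreducible_alg_deg Kb_algebraic Firr Ft.
have dQ b : root Q^i b -> alg_deg iota b = (size Q).-1 by exact: irreducible_alg_deg.
have QF : (size Q < size F)%N.
  by move: dat; rewrite dt (dQ a Qa) -ltnS !prednK // ltnW.
have lt b : (alg_deg iota b < alg_deg iota t)%N -> wX b < wX t.
  move=> db; rewrite Et; apply: (key_poly_root Kb_algebraic F_key).
  by rewrite size_minpoly // -(prednK (ltnW F_size)) -dt ltnS.
(* Among the [b] of degree below [deg F], [a] maximizes [wb (X - b)]. As all roots of [Q] have such
   a degree, [a] realizes [delta Q]. *)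
have le b : (alg_deg iota b < alg_deg iota t)%N -> wX b <= wX a.
  by move=> db; rewrite -(vb_difference_le (lt a dat) (lt b db)) near.
have [[b0 Qb0 Eb0] _] := deltaP iota wb Qs.
have Ea : wX a = delta iota wb Q.
  by apply/le_anti; rewrite delta_max //= -Eb0 le // (dQ b0 Qb0) -(dQ a Qa).
have Qk : abstract_key_poly iota wb Q.
  split=> // f /andP[f1 fQ]; have f0 : f != 0 by rewrite -size_poly_gt0 ltnW.
  have [[c fc Ec] _] := deltaP iota wb f1; rewrite -Ec -Ea.
  have dc : (alg_deg iota c < alg_deg iota a)%N.
    rewrite (dQ a Qa) -ltnS (prednK (ltnW Qs)) -size_minpoly //.
    exact: leq_ltn_trans (minpoly_size Kb_algebraic f0 fc) fQ.
  by rewrite -(vb_difference_lt (lt a dat)) ?far // lt // (ltn_trans dc).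
have FQ := truncation_lt_of_size Qk QF.
split=> //.
  by split=> [f|e]; [exact: truncation_le | move: FQ; rewrite e ltxx].
split=> // h hm hlt; rewrite leqNgt; apply/negP => hF.
have h0 := monic_neq0 hm.
have /(truncation_ltP Kb_algebraic j_mono wb_w wb_vb Qk h0)[b hb] := hlt.
rewrite -Ea ltNge le // -ltnS dt (prednK (ltnW F_size)) -size_minpoly //.
exact: leq_ltn_trans (minpoly_size Kb_algebraic h0 hb) hF.
Qed.

End DistinguishedPairs.

(** * Residues and liftings *)

Section Residues.
Variables (L : fieldType) (G : orderedGroupType) (v : valuation L G).
Implicit Types x y : L.

Lemma residue_zero x : fin 0 < v x -> residue v x = 0.
Proof. by move=> h; apply/eqP; rewrite residue_eq0 // ltW. Qed.

Lemma residue0 : residue v 0 = 0.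
Proof. by apply: residue_zero; rewrite val_fun0. Qed.

Lemma residueD x y : fin 0 <= v x -> fin 0 <= v y ->
  residue v (x + y) = residue v x + residue v y.
Proof.
move=> hx hy; have hN : fin 0 <= v (- y) by rewrite valN.
rewrite -[y in LHS]opprK residueB // -[- y]sub0r residueB ?val_fun0 ?le_top //.
by rewrite residue0 sub0r opprK.
Qed.

Lemma residue_sum (I : Type) (r : seq I) (F : I -> L) : (forall i, fin 0 <= v (F i)) ->
  residue v (\sum_(i <- r) F i) = \sum_(i <- r) residue v (F i).
Proof.
move=> h; elim: r => [|i r IH]; first by rewrite !big_nil residue0.
by rewrite !big_cons residueD ?IH //; apply: v_sum_ge => k _.
Qed.

Lemma vX_ge0 x n : fin 0 <= v x -> fin 0 <= v (x ^+ n).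
Proof.
move=> h; elim: n => [|n IH]; first by rewrite expr0 val_fun1.
by rewrite exprS val_funM -[fin 0]addr0 wt_leD.
Qed.

Lemma residueX x n : fin 0 <= v x -> residue v (x ^+ n) = residue v x ^+ n.
Proof.
move=> h; elim: n => [|n IH]; first by rewrite !expr0 residue1.
by rewrite !exprS residueM ?IH // vX_ge0.
Qed.

Lemma residue_eq x y : fin 0 <= v x -> fin 0 <= v y ->
  (residue v x = residue v y) <-> fin 0 < v (x - y).
Proof.
move=> hx hy; have hxy : fin 0 <= v (x - y).
  by apply: le_trans (vB _ _ _); rewrite le_min hx.
rewrite -residue_eq0 // residueB //; split=> [->|]; first by rewrite subrr.
by rewrite subr_eq0 => /eqP.
Qed.

Lemma v_simV x x' : v x < v (x - x') -> v x^-1 < v (x^-1 - x'^-1).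
Proof.
move=> h; have x0 : x != 0 by rewrite -(v_ntop v) (wt_lt_ntop h).
have x'0 : x' != 0 by rewrite -(v_ntop v) (v_sim h) v_ntop.
have -> : x^-1 - x'^-1 = (x' - x) * (x^-1 * x'^-1).
  by rewrite mulrBl mulrCA divff // mulr1 mulrA divff // mul1r.
rewrite val_funM -(vN v (x' - x)) opprB; have vxt : v x != top by rewrite v_ntop.
have e : v x + v (x^-1 * x'^-1) = v x^-1.
  rewrite -(v_sim h) -val_funM; congr (v _); rewrite mulrC mulfVK //.
by rewrite -e wt_ltD2rE // v_ntop mulf_neq0 ?invr_eq0.
Qed.

Lemma v_simX x x' n : v x < v (x - x') -> v (x ^+ n) < v (x ^+ n - x' ^+ n).
Proof.
move=> h; elim: n => [|n IH]; first by rewrite !expr0 subrr val_fun0 val_fun1.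
by rewrite !exprS; exact: v_simM.
Qed.

Lemma v_sim_sym x x' : v x < v (x - x') -> v x' < v (x' - x).
Proof. by move=> h; rewrite (v_sim h) -opprB vN. Qed.

Lemma v_sim_trans x y z : v x < v (x - y) -> v y < v (y - z) -> v x < v (x - z).
Proof.
move=> h h'; have -> : x - z = (x - y) + (y - z).
  by rewrite addrA subrK.
by apply: lt_le_trans (val_funD _ _ _); rewrite lt_min h -(v_sim h).
Qed.

Lemma residue_sim x x' : fin 0 <= v x -> v x < v (x - x') -> residue v x = residue v x'.
Proof.
by move=> h s; apply/residue_eq; rewrite ?(v_sim s) //; exact: le_lt_trans h s.
Qed.
End Residues.

(** On the right the indices [e * k] run past [n], where the terms vanish. *)
Lemma sum_multiples (V : zmodType) (T : nat -> V) e n : (0 < e)%N ->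
  (forall i, ~~ (e %| i)%N -> T i = 0) -> (forall i, (n <= i)%N -> T i = 0) ->
  \sum_(i < n) T i = \sum_(k < n) T (e * k)%N.
Proof.
move=> e0 Te Tn; transitivity (\sum_(i < e * n) T i).
  rewrite -(big_mkord xpredT T) -[RHS](big_mkord xpredT T).
  rewrite [RHS](big_cat_nat (n := n)) //=; last by rewrite leq_pmull.
  by rewrite [X in _ = _ + X]big_nat_cond [X in _ = _ + X]big1 ?addr0 // => i /andP[/andP[h _]
    _]; exact: Tn.
elim: {Tn}n => [|n IH]; first by rewrite muln0 !big_ord0.
rewrite big_ord_recr -IH /= mulnS addnC.
rewrite -(big_mkord xpredT T) (big_cat_nat (n := (e * n)%N)) ?leq_addr //=.
rewrite big_mkord; congr (_ + _); rewrite -{1}[(e * n)%N]add0n big_addn addKn.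
rewrite (big_ltn e0) add0n big_nat_cond big1 ?addr0 // => i /andP[/andP[i0 ie] _].
by apply: Te; rewrite dvdn_addl ?dvdn_mulr // gtnNdvd.
Qed.

(** * Residues of polynomials divided by powers of h *)

Section LiftingData.
Variables (K : fieldType) (Kb : closedFieldType) (iota : {rmorphism K -> Kb}).
Hypothesis Kb_algebraic : forall a : Kb, algebraicOver iota a.
Variables (G : orderedGroupType) (vb : valuation Kb G).
Variables (u : valuation {fraction {poly K}} G) (W : valuation {fraction {poly Kb}} G).
Variables (a : Kb) (d c : G) (e : nat) (h : {poly K}).
Hypothesis data : lifting_data iota vb u W a d c e h.
Implicit Types (f g : {poly K}) (b : Kb).

Local Notation "f ^i" := (map_poly iota f) (at level 2, format "f ^i").
Local Notation "f ^F" := ((map_poly iota f)%:F) (at level 2, format "f ^F").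
Local Notation cst b := ((b%:P)%:F : {fraction {poly Kb}}).
Local Notation Q := (minpoly iota a).
Local Notation S := (@residue_field_adjoin _ _ iota _ vb W a).

Lemma adjoin_subfield : is_subfield (adjoin iota a).
Proof.
split=> [M [[M1 _ _] _] //|x y Sx Sy M MS|x y Sx Sy M MS].
  by case: (MS) => -[_ MB _] _; apply: MB; [exact: Sx | exact: Sy].
by case: (MS) => -[_ _ MD] _; apply: MD; [exact: Sx | exact: Sy].
Qed.

Lemma adjoin_base (x : K) : adjoin iota a (iota x).
Proof. by move=> M [_ MS]; apply: MS; left; exists x. Qed.

Lemma adjoin_gen : adjoin iota a a. Proof. by move=> M [_ MS]; apply: MS; right. Qed.

Lemma adjoin_horner f : adjoin iota a f^i.[a].
Proof.
have sub := adjoin_subfield; rewrite horner_coef; apply: (subfield_sum sub) => i.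
apply: (subfieldM sub); first by rewrite coef_map; exact: adjoin_base.
exact: (subfieldX sub) adjoin_gen.
Qed.

(** [K(a)] is the smallest subfield containing [K] and [a], so it lies in the image of the abstract
    extension defined by [Q], whose elements are remainders modulo [Q]. *)
Lemma adjoin_small b : adjoin iota a b -> exists2 f : {poly K}, (size f < size Q)%N & f^i.[a] = b.
Proof.
have Qa := minpoly_root Kb_algebraic a; have Q0 := minpoly_neq0 Kb_algebraic a.
pose inj : subFExtend iota a Q -> Kb := subfx_inj.
move=> /(_ [set b | exists x, inj x = b]); case=> [|x <-].
  split; first split => /= [|x y [x' <-] [y' <-]|x y [x' <-] [y' <-]].
  - by exists 1; rewrite /inj rmorph1.
  - by exists (x' - y'); rewrite /inj rmorphB.
  - by exists (x' / y'); rewrite /inj fmorph_div.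
  move=> x [[y _ <-]|->]; first by exists y%:A; exact: subfx_inj_base Qa Q0 y.
  by exists (subfx_root iota a Q); exact: subfx_inj_root Qa Q0.
have [q ->] := subfxE x; exists (q %% Q); first by rewrite ltn_modp.
rewrite /inj subfx_inj_eval // [in RHS](divp_eq q Q) rmorphD rmorphM /= !hornerE.
by rewrite (rootP Qa) mulr0 add0r.
Qed.

Lemma W_poly f : W f^F = u f%:F. Proof. exact: ld_u data f. Qed.
Lemma W_pairv p : W p%:F = pairv vb a d p. Proof. exact: ld_W data p. Qed.
Lemma W_cst b : W (cst b) = vb b. Proof. by rewrite W_pairv pairvC. Qed.

Lemma e_gt0 : (0 < e)%N. Proof. exact: ld_e_gt0 data. Qed.

Lemma Q_monic : Q \is monic. Proof. exact: minpoly_monic. Qed.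
Lemma Q_size : (1 < size Q)%N. Proof. exact: minpoly_size_gt1. Qed.

(** The roots of [f] have smaller degree than [a], so by minimality of the pair none of them lies in
    the ball of radius [d] around [a]. *)
Lemma small_ptop f : f != 0 -> (size f < size Q)%N -> exists t, ptop vb a d f^i 0 t.
Proof.
move=> f0 fQ; apply: ptop_far; first by rewrite map_poly_eq0.
move=> b fb; rewrite ltNge; apply/negP => ab.
have [_ /(_ b ab)] := ld_minimal_pair data; apply/negP; rewrite -ltnNge -ltnS.
rewrite -!size_minpoly //; apply: leq_ltn_trans fQ; exact: minpoly_size.
Qed.

Lemma base_ptop : exists k, (0 < k)%N /\ ptop vb a d Q^i k c.
Proof.
have [|k [t kt]] := @ptop_ex _ _ vb a d Q^i; first by rewrite map_poly_eq0 minpoly_neq0.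
have -> : c = t.
  apply: fin_inj; apply: etrans (ptop_val kt).
  by rewrite -(ld_c data) -(ld_u data) W_pairv.
exists k; split=> //; apply: ptop_near (minpoly_root Kb_algebraic a) _ kt.
by rewrite subrr val_fun0 le_top.
Qed.

Lemma u_base : u Q%:F = fin c. Proof. exact: ld_c data. Qed.
Lemma W_base : W Q^F = fin c. Proof. by rewrite W_poly u_base. Qed.

Lemma small_sim f : f != 0 -> (size f < size Q)%N -> W f^F < W (f^F - cst f^i.[a]).
Proof.
move=> f0 fQ; have [t ft] := small_ptop f0 fQ.
by rewrite -rmorphB !W_pairv (ptop_val ft); exact: ptop0_sim.
Qed.

Lemma small_W f : (size f < size Q)%N -> W f^F = vb f^i.[a].
Proof.
have [->|f0 fQ] := eqVneq f 0; first by rewrite !rmorph0 horner0 !val_fun0.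
by rewrite -W_cst; apply/esym/v_sim; exact: small_sim.
Qed.

Lemma small_horner_neq0 f : f != 0 -> (size f < size Q)%N -> f^i.[a] != 0.
Proof.
move=> f0 fQ; apply: contraTN fQ => fa; rewrite -leqNgt.
by apply: minpoly_size => //; exact/rootP/eqP.
Qed.

Lemma u_small_ntop f : f != 0 -> u f%:F != top.
Proof. by move=> f0; rewrite v_ntop tofrac_eq0. Qed.

Lemma u_expansion n (g : nat -> {poly K}) : (forall i, (size (g i) < size Q)%N) ->
  u (\sum_(i < n) g i * Q ^+ i)%:F = \big[Order.min/top]_(i < n) u (g i * Q ^+ i)%:F.
Proof.
move=> gs; have [k [k0 kt]] := base_ptop; rewrite -W_poly rmorph_sum /= W_pairv.
rewrite (pairv_sum (p := fun i => (g i * Q ^+ i)^i) k0).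
  by apply: eq_bigr => i _; rewrite -W_poly W_pairv.
move=> i _; have [->|n0] := eqVneq (g i) 0; first by left; rewrite mul0r rmorph0.
have [s hs] := small_ptop n0 (gs i).
right; exists (s + c *+ i); rewrite rmorphM rmorphXn mulnC -[(k * i)%N]add0n.
by apply: ptop_mul => //; exact: ptop_exp.
Qed.

Local Notation Gam := (value_group_adjoin iota vb a).

Lemma value_group_adjoin0 : Gam 0.
Proof. by exists 1; [exact: subfield1 adjoin_subfield | rewrite val_fun1]. Qed.

Lemma value_group_adjoinB x y : Gam x -> Gam y -> Gam (x - y).
Proof.
move=> [b Sb bx] [b' Sb' by']; exists (b / b'); last exact: vdiv.
exact: subfield_div adjoin_subfield _ _ Sb Sb'.
Qed.

Lemma value_group_adjoinMn x n : Gam x -> Gam (x *+ n).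
Proof.
move=> hx; elim: n => [|n IH]; first exact: value_group_adjoin0.
by rewrite mulrSr -[x in _ + x]opprK; apply: value_group_adjoinB IH _; rewrite -sub0r;
  exact: value_group_adjoinB value_group_adjoin0 hx.
Qed.

Lemma value_group_adjoin_small f t : (size f < size Q)%N -> u f%:F = fin t -> Gam t.
Proof.
move=> fQ ft; exists f^i.[a]; first exact: adjoin_horner.
by rewrite -small_W // W_poly.
Qed.

(** Subtracting multiples of [c *+ e] brings [n] down to its remainder modulo [e], which is 0 by
    minimality of [e]. *)
Lemma ramification_dvd n : Gam (c *+ n) -> (e %| n)%N.
Proof.
move=> hn; rewrite /dvdn -leqn0 leqNgt; apply/negP => r0.
have := ld_e_min data r0; rewrite leqNgt ltn_mod e_gt0 => /(_ _)/negP[] //.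
have -> : c *+ (n %% e) = c *+ n - (c *+ e) *+ (n %/ e).
  by rewrite {2}(divn_eq n e) mulrnDr mulnC mulrnA addrC addKr.
by apply: value_group_adjoinB hn _; apply: value_group_adjoinMn; exact: ld_e data.
Qed.

Local Notation ha := h^i.[a].

Lemma h_W : W h^F = fin (c *+ e). Proof. by rewrite W_poly; exact: ld_h_u data. Qed.
Lemma h_neq0 : h != 0.
Proof. by apply: contra_eq_neq (ld_h_u data) => ->; rewrite tofrac0 val_fun0. Qed.
Lemma ha_neq0 : ha != 0. Proof. by rewrite -(v_ntop vb) (ld_h_vb data). Qed.
Lemma hF_neq0 : h^F != 0. Proof. by rewrite tofrac_eq0 map_poly_eq0 h_neq0. Qed.
Lemma hXF_neq0 n : h^F ^+ n != 0. Proof. by rewrite expf_neq0 // hF_neq0. Qed.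
Lemma hX_W n : W (h^F ^+ n) = fin (c *+ (e * n)). Proof. by rewrite (vX_fin _ h_W) mulrnA. Qed.
Lemma h_sim : W h^F < W (h^F - cst ha).
Proof. exact: small_sim h_neq0 (ld_h_size data). Qed.

(** A fraction of value 0; its residue [yres] is the element Y at which residue polynomials of
    liftings are evaluated. *)
Definition yfrac := Q^F ^+ e / h^F.
Definition yres := residue W yfrac.

Lemma yres_quot : quot_residue iota W (Q ^+ e) h = yres.
Proof. by rewrite /quot_residue rmorphXn tofracXn. Qed.

Lemma quot_residueX f n : quot_residue iota W f (h ^+ n) = residue W (f^F / h^F ^+ n).
Proof. by rewrite /quot_residue rmorphXn tofracXn. Qed.

Lemma W_yfrac : W yfrac = fin 0.
Proof. by rewrite (vdiv (vX_fin _ W_base) h_W) subrr. Qed.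

Lemma yfracX n : yfrac ^+ n = Q^F ^+ (e * n) / h^F ^+ n.
Proof. by rewrite expr_div_n -exprM. Qed.

(** The element of [K(a)] whose residue is the coefficient of the [k]-th power of Y in the residue
    of [f Q^(ek) / h^N]. *)
Definition rcoef f k N : Kb := f^i.[a] * ha ^+ k / ha ^+ N.

Lemma adjoin_rcoef f k N : adjoin iota a (rcoef f k N).
Proof.
have sub := adjoin_subfield; have hx n : adjoin iota a (ha ^+ n).
  by apply: (subfieldX sub); exact: adjoin_horner.
apply: (subfield_div sub) => //; apply: (subfieldM sub) => //; exact: adjoin_horner.
Qed.

Lemma W_div_ge0 f N : fin (c *+ (e * N)) <= u f%:F -> fin 0 <= W (f^F / h^F ^+ N).
Proof. by move=> hf; apply: vdiv_ge0; rewrite ?hXF_neq0 // hX_W W_poly. Qed.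

(* f Q^(ek) / h^N = (f h^k / h^N) (Q^e / h)^k, and f, h may be replaced by their     *)
(* values at a.                                                                    *)
Lemma residue_term f k N : (size f < size Q)%N ->
  fin (c *+ (e * N)) <= u (f * Q ^+ (e * k))%:F ->
  fin 0 <= vb (rcoef f k N) /\
  residue W ((f * Q ^+ (e * k))^F / h^F ^+ N) = residue W (cst (rcoef f k N)) * yres ^+ k.
Proof.
have [->|f0] := eqVneq f 0.
  by rewrite /rcoef !mul0r map_poly0 horner0 !tofrac0 !mul0r polyC0 tofrac0 !residue0 mul0r
    !val_fun0 !le_top.
move=> fQ /W_div_ge0; rewrite rmorphM rmorphXn rmorphM rmorphXn /=.
have -> : f^F * Q^F ^+ (e * k) / h^F ^+ N = (f^F * h^F ^+ k / h^F ^+ N) * yfrac ^+ k.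
  by rewrite yfracX mulf_div [_ * h^F ^+ k * _]mulrAC -mulf_div divff ?hXF_neq0 // mulr1.
set x := _ / _; have yX : W (yfrac ^+ k) = fin 0 by rewrite (vX_fin _ W_yfrac) mul0rn.
rewrite val_funM yX fin0 addr0 => x_ge0.
have xs : W x < W (x - cst (rcoef f k N)).
  have -> : cst (rcoef f k N) = cst f^i.[a] * cst ha ^+ k / cst ha ^+ N.
    apply: (@mulIf _ (cst ha ^+ N)); first by rewrite expf_neq0 // tofrac_eq0 polyC_eq0 ha_neq0.
    rewrite divfK; last by rewrite expf_neq0 // tofrac_eq0 polyC_eq0 ha_neq0.
    have cM p q : cst (p * q) = cst p * cst q by rewrite polyCM tofracM.
    have cX p n : cst (p ^+ n) = cst p ^+ n by rewrite polyC_exp tofracXn.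
    by rewrite -!cX -!cM /rcoef divfK // expf_neq0 // ha_neq0.
  apply: v_simM; first by apply: v_simM; [exact: small_sim | apply: v_simX; exact: h_sim].
  by apply: v_simV; apply: v_simX; exact: h_sim.
split; first by rewrite -W_cst (v_sim xs).
rewrite residueM ?yX // residueX ?W_yfrac // (residue_sim _ xs) //.
Qed.

(** A term whose index [i] is not divisible by [e] cannot have value [c *+ (e * N)], since this
    would put [c *+ i] into the value group of [K(a)]; so its residue is 0. The other terms are
    given by [residue_term]. *)
Lemma residue_expansion n (g : nat -> {poly K}) N :
  (forall i, (size (g i) < size Q)%N) -> (forall i, (n <= i)%N -> g i = 0) ->
  fin (c *+ (e * N)) <= u (\sum_(i < n) g i * Q ^+ i)%:F ->
  let V := \poly_(k < n) residue W (cst (rcoef (g (e * k)%N) k N)) in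
  coefs_in S V /\ residue W ((\sum_(i < n) g i * Q ^+ i)^F / h^F ^+ N) = V.[yres].
Proof.
move=> gs gn; rewrite u_expansion // => /wt_bigmin_ge ge V.
have {}ge i : fin (c *+ (e * N)) <= u (g i * Q ^+ i)%:F.
  have [i_n|/gn->] := ltnP i n; first exact: (ge (Ordinal i_n)).
  by rewrite mul0r tofrac0 val_fun0 le_top.
have term k := residue_term (gs (e * k)%N) (ge (e * k)%N).
split=> [k|].
  rewrite coef_poly; case: ifP => _; last first.
    exists 0; rewrite ?residue0 //; split; last by rewrite val_fun0 le_top.
    exact: subfield0 adjoin_subfield.
  exists (rcoef (g (e * k)%N) k N) => //.
  by split; [exact: adjoin_rcoef | exact: (term k).1].
rewrite rmorph_sum /= rmorph_sum mulr_suml residue_sum; last first.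
  by move=> i; exact: W_div_ge0.
rewrite (sum_multiples (T := fun i => residue W ((g i * Q ^+ i)^F / h^F ^+ N)) e_gt0).
- by rewrite horner_poly; apply: eq_bigr => k _; exact: (term k).2.
- move=> i ei; apply: residue_zero; have [->|g0] := eqVneq (g i) 0.
    by rewrite mul0r !rmorph0 mul0r val_fun0.
  rewrite vdiv_gt0E ?hXF_neq0 // hX_W W_poly lt_neqAle ge andbT; apply: contraNneq ei => /esym E.
  have /ntopP[t gt] := u_small_ntop g0.
  have {}E : c *+ i = c *+ (e * N) - t.
    apply: fin_inj; apply: (@wt_addI _ (fin t)) => //; rewrite -!finD subrK -E.
    by rewrite rmorphM rmorphXn /= val_funM (vX_fin _ u_base) gt -finD addrC.
  apply: ramification_dvd; rewrite E; apply: value_group_adjoinB;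
    last exact: value_group_adjoin_small gt.
  by rewrite mulrnA; apply: value_group_adjoinMn; exact: ld_e data.
- by move=> i /gn->; rewrite mul0r !rmorph0 mul0r residue0.
Qed.

(** Each coefficient of [V] is the residue of some [b] in [K(a)]. Writing [b * (ha ^+ n / ha ^+ k)]
    as the value at [a] of some [r] of degree below [deg Q] makes [rcoef r k n] equal to [b], and
    the terms [r Q^(ek)] add up to [f]. *)
Lemma residue_lift V n : coefs_in S V -> (size V <= n.+1)%N ->
  exists f : {poly K}, [/\ (size f <= (size Q).-1 * (e * n).+1)%N, fin (c *+ (e * n)) <= u f%:F
    & residue W (f^F / h^F ^+ n) = V.[yres]].
Proof.
move=> SV sV; have hr k : exists r : {poly K}, [/\ (size r < size Q)%N,
    fin 0 <= vb (rcoef r k n) & V`_k = residue W (cst (rcoef r k n))].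
  have [b [Sb b0] Eb] := SV k; have sub := adjoin_subfield.
  have hx m : adjoin iota a (ha ^+ m).
    by apply: (subfieldX sub); exact: adjoin_horner.
  have [r sr Er] := adjoin_small (subfieldM sub Sb (subfield_div sub (hx n) (hx k))).
  exists r; suff -> : rcoef r k n = b by split.
  by rewrite /rcoef Er mulrA divfK ?mulfK // expf_neq0 // ha_neq0.
have [r {}hr] := choice hr; exists (\sum_(k < n.+1) r k * Q ^+ (e * k)).
have uh k : (k <= n)%N -> fin (c *+ (e * n)) <= u (r k * Q ^+ (e * k))%:F.
  move=> kn; have [sr r0 _] := hr k; rewrite rmorphM rmorphXn /= val_funM (vX_fin _ u_base).
  have : vb (rcoef (r k) k n) + vb (ha ^+ n) = vb (r k)^i.[a] + vb (ha ^+ k).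
    by rewrite -!val_funM /rcoef divfK // expf_neq0 // ha_neq0.
  rewrite !(vX_fin _ (ld_h_vb data)) -small_W // W_poly -!mulrnA => <-.
  by rewrite -[leLHS]add0r -fin0 wt_leD.
split.
- apply: leq_trans (size_sum _ _ _) _; apply/bigmax_leqP => k _.
  have [sr _ _] := hr k; apply: leq_trans (size_polyMleq _ _) _.
  rewrite size_base_exp ?Q_monic // addnS /= mulnS leq_add //.
    by rewrite -ltnS (prednK (ltnW Q_size)).
  by rewrite leq_mul2l leq_mul2l -ltnS ltn_ord !orbT.
- by rewrite rmorph_sum; apply: v_sum_ge => k _; apply: uh; rewrite -ltnS.
- rewrite rmorph_sum /= rmorph_sum mulr_suml residue_sum; last first.
    by move=> k; apply: W_div_ge0; apply: uh; rewrite -ltnS.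
  rewrite (horner_coef_wide _ sV); apply: eq_bigr => k _.
  have [sr _ ->] := hr k; apply: (residue_term sr _).2.
  by apply: uh; rewrite -ltnS.
Qed.

(** Clearing the denominator [h ^+ n] leaves terms [p k] that attain their minimum last at the
    distinct indices [k * (l * e)], so nothing cancels. *)
Lemma W_yfrac_combination n (b : nat -> Kb) k0 : (k0 < n)%N ->
  (forall k, fin 0 <= vb (b k)) -> vb (b k0) = fin 0 ->
  W (\sum_(k < n) cst (b k) * yfrac ^+ k) = fin 0.
Proof.
move=> k0n b_ge bk0.
pose p k := (b k)%:P * Q^i ^+ (e * k) * h^i ^+ (n - k).
have hn0 := hXF_neq0 n; apply: (@wt_addI _ (W (h^F ^+ n))); first by rewrite v_ntop.
rewrite -val_funM mulr_suml fin0 add0r hX_W.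
have -> : \sum_(k < n) cst (b k) * yfrac ^+ k * h^F ^+ n = (\sum_(k < n) p k)%:F.
  rewrite rmorph_sum; apply: eq_bigr => k _; rewrite /p !rmorphM !rmorphXn /= yfracX -!mulrA.
  congr (_ * (_ * _)); apply: (@mulfI _ (h^F ^+ k)); first exact: hXF_neq0.
  by rewrite mulVKf ?hXF_neq0 // -exprD subnKC // ltnW.
have [l [l0 lt]] := base_ptop.
have [s hs] := small_ptop h_neq0 (ld_h_size data).
have se : s = c *+ e by apply: fin_inj; rewrite -(ptop_val hs) -W_pairv h_W.
rewrite W_pairv (pairv_sum (N := (l * e)%N)); last 2 first.
- by rewrite muln_gt0 l0 e_gt0.
- move=> k kn; have [b0|b0] := eqVneq (b k) 0; first by left; rewrite /p b0 !mul0r.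
  have /ntopP[t bt] : vb (b k) != top by rewrite v_ntop.
  right; exists (t + c *+ (e * k) + s *+ (n - k)).
  rewrite (_ : k * (l * e) = (0 + l * (e * k) + 0 * (n - k)))%N; last first.
    by rewrite mul0n addn0 add0n mulnC mulnA.
  apply: ptop_mul; last exact: ptop_exp.
  by apply: ptop_mul; [exact: ptopC | exact: ptop_exp].
have pE k : (k <= n)%N -> pairv vb a d (p k) = vb (b k) + fin (c *+ (e * n)).
  move=> kn; rewrite /p !val_funM pairvC (vX_fin _ (ptop_val lt)) (vX_fin _ (ptop_val hs)).
  by rewrite -addrA -finD se -mulrnA -mulrnDr -mulnDr subnKC.
apply: (@wt_bigmin_eq _ _ _ _ (Ordinal k0n)) => [k|]; last first.
  by rewrite pE 1?ltnW // bk0 fin0 add0r.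
by rewrite pE; [rewrite -[leLHS]add0r -fin0 wt_leD | rewrite ltnW].
Qed.

(** The coefficients of [V] lift to elements of nonnegative value, the leading one of value 0, so
    the lifted combination of powers of [yfrac] has value 0 and a nonzero residue. The coefficients
    may be residues of any elements of [Kb]. *)
Lemma yres_transcendental (V : {poly residue_field W}) : V != 0 ->
  (forall k, exists2 b, fin 0 <= vb b & V`_k = residue W (cst b)) -> V.[yres] != 0.
Proof.
move=> V0 hV.
have {}hV k : exists b, fin 0 <= vb b /\ V`_k = residue W (cst b).
  by have [b] := hV k; exists b.
have [b hb] := choice hV; pose k0 := (size V).-1.
have k0V : (k0 < size V)%N by rewrite prednK // size_poly_gt0.
have bk0 : vb (b k0) = fin 0.
  apply/le_anti; rewrite (hb k0).1 andbT leNgt; apply/negP => gt.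
  have := lead_coef_eq0 V; rewrite lead_coefE (hb k0).2 residue_zero ?W_cst //.
  by rewrite eqxx (negPf V0).
have t_ge k : fin 0 <= W (cst (b k) * yfrac ^+ k).
  by rewrite val_funM W_cst (vX_fin _ W_yfrac) mul0rn fin0 addr0 (hb k).1.
have -> : V.[yres] = residue W (\sum_(k < size V) cst (b k) * yfrac ^+ k).
  rewrite residue_sum // horner_coef; apply: eq_bigr => k _.
  rewrite (hb k).2 residueM ?residueX ?W_yfrac ?W_cst ?(hb k).1 //.
  by rewrite (vX_fin _ W_yfrac) mul0rn.
rewrite residue_eq0 (W_yfrac_combination k0V (fun k => (hb k).1) bk0) ?ltxx //.
Qed.

End LiftingData.

Lemma size_mul_const (R : idomainType) (p q : {poly R}) : size p = 1%N -> size (p * q) = size q.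
Proof. by move=> /eqP/size_poly1P[x x0 ->]; rewrite size_Cmul. Qed.

Lemma root_sub_eq (R : nzRingType) (p q : {poly R}) x : p.[x] = q.[x] -> root (p - q) x.
Proof. by move=> e; rewrite rootE hornerD hornerN e subrr. Qed.

Section CompValuation.
Variables (R R' : comNzRingType) (f : {rmorphism R -> R'}) (G : orderedGroupType).
Variable v : valuation R' G.

Lemma comp_val0 : v (f 0) = top. Proof. by rewrite rmorph0 val_fun0. Qed.
Lemma comp_val1 : v (f 1) = 0. Proof. by rewrite rmorph1 val_fun1. Qed.
Lemma comp_valM x y : v (f (x * y)) = v (f x) + v (f y).
Proof. by rewrite rmorphM val_funM. Qed.
Lemma comp_valD x y : Order.min (v (f x)) (v (f y)) <= v (f (x + y)).
Proof. by rewrite rmorphD val_funD. Qed.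

Definition comp_valuation : valuation R G :=
  Valuation comp_val0 comp_val1 comp_valM comp_valD.
End CompValuation.

Section ResidueFieldAdjoin.
Variables (K : fieldType) (Kb : closedFieldType) (iota : {rmorphism K -> Kb}).
Variables (G : orderedGroupType) (vb : valuation Kb G) (W : valuation {fraction {poly Kb}} G).
Hypothesis W_vb : forall b, W (b%:P)%:F = vb b.
Variable a : Kb.
Local Notation S := (@residue_field_adjoin _ _ iota _ vb W a).

Lemma residue_adjoin0 : S 0.
Proof.
exists 0; rewrite ?residue0 //; split; last by rewrite val_fun0 le_top.
exact: subfield0 (adjoin_subfield iota a).
Qed.

Lemma residue_adjoinD x y : S x -> S y -> S (x + y).
Proof.
move=> [b [Sb b0] ->] [b' [Sb' b'0] ->]; exists (b + b').
  split; first exact: subfieldD (adjoin_subfield iota a) _ _ Sb Sb'.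
  by apply: le_trans (val_funD _ _ _); rewrite le_min b0.
by rewrite polyCD tofracD residueD // W_vb.
Qed.

Lemma residue_adjoinN x : S x -> S (- x).
Proof.
move=> [b [Sb b0] ->]; exists (- b).
  by split; [exact: subfieldN (adjoin_subfield iota a) _ Sb | rewrite vN].
by rewrite -sub0r -residue0 -residueB ?W_vb ?val_fun0 ?le_top // sub0r polyCN tofracN.
Qed.

Lemma residue_adjoinM x y : S x -> S y -> S (x * y).
Proof.
move=> [b [Sb b0] ->] [b' [Sb' b'0] ->]; exists (b * b').
  split; first exact: subfieldM (adjoin_subfield iota a) _ _ Sb Sb'.
  by rewrite val_funM -[fin 0]addr0 wt_leD.
by rewrite polyCM tofracM residueM // W_vb.
Qed.

Lemma coefs_adjoinBM (f p q : {poly residue_field W}) :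
  coefs_in S f -> coefs_in S p -> coefs_in S q -> coefs_in S (f - p * q).
Proof.
move=> hf hp hq k; rewrite coefB; apply: residue_adjoinD; first exact: hf.
apply: residue_adjoinN; rewrite coefM; elim/big_ind: _ => [||i _].
- exact: residue_adjoin0.
- exact: residue_adjoinD.
- by apply: residue_adjoinM; [exact: hp | exact: hq].
Qed.
End ResidueFieldAdjoin.

(** * Minimal increase and irreducible residue polynomials *)

Section MinimalIncrease.
Variables (K : fieldType) (Kb : closedFieldType) (iota : {rmorphism K -> Kb}).
Hypothesis Kb_algebraic : forall a : Kb, algebraicOver iota a.
Variables (G : orderedGroupType) (vb : valuation Kb G).
Variables (u : valuation {fraction {poly K}} G) (W : valuation {fraction {poly Kb}} G).
Variables (a : Kb) (d c : G) (e : nat) (h : {poly K}).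
Hypothesis data : lifting_data iota vb u W a d c e h.
Local Notation "f ^i" := (map_poly iota f) (at level 2, format "f ^i").
Local Notation "f ^F" := ((map_poly iota f)%:F) (at level 2, format "f ^F").
Local Notation cst b := ((b%:P)%:F : {fraction {poly Kb}}).
Local Notation Q := (minpoly iota a).
Local Notation n := (size Q).-1.
Local Notation S := (@residue_field_adjoin _ _ iota _ vb W a).
Local Notation ha := h^i.[a].

Let U : valuation {poly K} G := comp_valuation (@tofrac {poly K}) u.
Variable w : valuation {poly K} G.
Hypotheses (U_le : forall f, U f <= w f) (w_base : w Q = U Q).
Hypothesis w_small : forall f : {poly K}, (size f < size Q)%N -> U f = w f.
Implicit Types (f g F : {poly K}) (b : Kb).

Let Qm : Q \is monic := Q_monic Kb_algebraic a.
Let Qs : (1 < size Q)%N := Q_size Kb_algebraic a.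
Let n_gt0 : (0 < n)%N. Proof. by rewrite -ltnS prednK // ltnW. Qed.
Let U_base : U Q = fin c := u_base data.
Let e0 : (0 < e)%N := e_gt0 data.
Let WU (f : {poly K}) : W f^F = U f := W_poly data f.

Lemma U_ntop f : (U f != top) = (f != 0). Proof. by rewrite /U /= v_ntop tofrac_eq0. Qed.

Definition increase_minimal F : Prop :=
  [/\ F \is monic, U F < w F
    & forall g, g \is monic -> U g < w g -> (size F <= size g)%N].

(** Dividing by the leading coefficient, on which both valuations agree, would give a monic
    polynomial smaller than [F]. *)
Lemma increase_minimal_below F f : increase_minimal F -> (size f < size F)%N -> U f = w f.
Proof.
move=> [_ _ Fmin] fF; have [->|f0] := eqVneq f 0; first by rewrite !val_fun0.
apply/le_anti; rewrite U_le andTb leNgt; apply/negP => lt.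
have lc0 : lead_coef f != 0 by rewrite lead_coef_eq0.
pose g := (lead_coef f)^-1 *: f.
have fE : f = (lead_coef f)%:P * g by rewrite mul_polyC scalerA divff // scale1r.
have gm : g \is monic by rewrite monicE lead_coefZ mulVf.
have := Fmin g gm; rewrite size_scale ?invr_eq0 // leqNgt fF => /(_ _)/negP; apply => //.
move: lt; rewrite fE !val_funM -(w_small (f := (lead_coef f)%:P)); last first.
  by rewrite size_polyC lc0.
by rewrite ![U _%:P + _]addrC wt_ltD2rE // U_ntop polyC_eq0.
Qed.

Lemma digit_oob F i : (size F <= n * i)%N -> digit Q F i = 0.
Proof. by move=> le; rewrite /digit (divp_base_exp0 Qm le) mod0p. Qed.

Lemma digit_neq0_size F i : digit Q F i != 0 -> (n * i < size F)%N.
Proof. by apply: contraR; rewrite -leqNgt => /digit_oob->. Qed.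

(** Let [i0] and [i1] be the least and the greatest index at which the expansion of [F] attains its
    value. Dividing the initial form of [F] by [A], the product of the digit of index [i1] and
    [Q ^+ i0], gives a monic [gg] of degree [deg Q * (i1 - i0)] at which [w] still exceeds [U].
    Minimality of [F] forces [i0 = 0] and [deg F = deg Q * i1], so the leading digit of the monic
    [F] is 1. *)
Lemma increase_minimal_leading F : increase_minimal F -> exists i, [/\ (0 < i)%N,
  size F = (n * i).+1, digit Q F i = 1, U F = fin (c *+ i) & U (digit Q F 0) = fin (c *+ i)].
Proof.
move=> Fmin; have [Fm FU Fle] := Fmin; have F0 := monic_neq0 Fm.
have /ntopP[mu Fmu] : U F != top by rewrite U_ntop.
pose g := digit Q F; have gs i : (size (g i) < size Q)%N := size_digit Qm F i.
have FE : F = \sum_(i < size F) g i * Q ^+ i := digit_expansion Qm Qs F.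
have minE := u_expansion Kb_algebraic data (size F) gs; rewrite -FE [LHS]Fmu in minE.
have g_ge i : fin mu <= U (g i * Q ^+ i).
  have [iF|Fi] := ltnP i (size F).
    by move/eqP: minE; rewrite eq_le => /andP[/wt_bigmin_ge/(_ (Ordinal iF) isT)].
  by rewrite /g digit_oob ?mul0r ?val_fun0 ?le_top // (leq_trans Fi) // leq_pmull.
pose P i := (i < size F)%N && (U (g i * Q ^+ i) == fin mu).
have exP : exists i, P i.
  have [E|[i iF Ei]] := wt_bigmin_ordP (size F) (fun i => U (g i * Q ^+ i)).
    by rewrite /= -minE in E.
  by exists i; rewrite /P iF Ei minE eqxx.
case: (ex_minnP exP) => i0 Pi0 i0_min.
case: (@ex_maxnP P (size F) exP) => [i /andP[/ltnW] //|i1 Pi1 i1_max].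
have gnz i : P i -> g i != 0.
  by case/andP => _; apply: contraTneq => ->; rewrite mul0r val_fun0.
have ga_neq0 i : P i -> (g i)^i.[a] != 0.
  by move=> Pi; apply: (small_horner_neq0 Kb_algebraic (gnz _ Pi) (gs i)).
pose b := (g i1)^i.[a]; have b0 : b != 0 := ga_neq0 _ Pi1.
(* Digits are divided after evaluation at [a]. Requiring [r = 1] at [i1] makes [gg] monic. *)
have hr i : exists r : {poly K}, [/\ (size r < size Q)%N,
  r^i.[a] = (g i)^i.[a] / b & i = i1 -> r = 1].
  have [->|ne] := eqVneq i i1; first by exists 1; rewrite size_poly1 rmorph1 hornerC divff.
  have [|r rs re] := @adjoin_small _ _ iota Kb_algebraic a ((g i)^i.[a] / b).
    by apply: (subfield_div (adjoin_subfield iota a)); exact: adjoin_horner.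
  by exists r; split=> // e'; rewrite e' eqxx in ne.
have [r {}hr] := choice hr.
have r1 : r i1 = 1 by have [_ _ ->] := hr i1.
have i01 : (i0 <= i1)%N by apply: i0_min.
pose gg := \sum_(i < size F | P i) r i * Q ^+ (i - i0).
have [ggm ggs] : gg \is monic /\ size gg = (n * (i1 - i0)).+1.
  have i1F : (i1 < size F)%N by case/andP: Pi1.
  pose rest := \sum_(i < size F | P i && (i != Ordinal i1F)) r i * Q ^+ (i - i0).
  have ggE : gg = Q ^+ (i1 - i0) + rest by rewrite /gg (bigD1 (Ordinal i1F)) //= r1 mul1r.
  have sQ : size (Q ^+ (i1 - i0)) = (n * (i1 - i0)).+1 by exact: size_base_exp.
  have srest : (size rest < size (Q ^+ (i1 - i0)))%N.
    rewrite sQ ltnS; apply: leq_trans (size_sum _ _ _) _; apply/bigmax_leqP => i /andP[Pi ne].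
    have [rs _ _] := hr i; apply: leq_trans (size_polyMleq _ _) _.
    rewrite size_base_exp // addnS /=.
    have lt : (i - i0 < i1 - i0)%N.
      rewrite ltn_sub2r //; last by rewrite ltn_neqAle i1_max // andbT;
        apply: contraNneq ne => e'; apply/eqP/val_inj.
      apply: leq_ltn_trans (i0_min i Pi) _.
      by rewrite ltn_neqAle i1_max // andbT; apply: contraNneq ne => e'; apply/eqP/val_inj.
    apply: leq_trans (_ : n + n * (i - i0) <= _)%N; last by rewrite -mulnS leq_mul2l lt orbT.
    by rewrite leq_add2r -ltnS (prednK (ltnW Qs)).
  by rewrite ggE monicE lead_coefDl // size_polyDl // (monicP (monic_exp _ Qm)).
pose A := g i1 * Q ^+ i0.
have AE : U A = w A.
  by rewrite /A !val_funM !vX -w_base w_small.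
have A0 : U A != top by rewrite U_ntop mulf_neq0 ?expf_neq0 ?gnz ?monic_neq0.
(* [F] and [A * gg] have the same initial form: off the minimal indices the terms have larger value,
   and on them [g i] and [g i1 * r i] evaluate at [a] to the same element. *)
have sim : U F < U (F - A * gg).
  rewrite Fmu; have -> : F - A * gg =
    \sum_(i < size F) (if P i then (g i - g i1 * r i) else g i) * Q ^+ i.
    rewrite [X in X - _]FE (bigID (fun i : 'I__ => P i)) [RHS](bigID (fun i : 'I__ => P i)) /=.
    rewrite addrAC; congr (_ + _); last first.
      by apply: eq_bigr => i /negPf->.
    rewrite mulr_sumr -sumrB; apply: eq_bigr => i Pi; rewrite Pi mulrBl; congr (_ - _).
    rewrite /A -!mulrA; congr (_ * _); rewrite mulrCA; congr (_ * _).
    by rewrite -exprD subnKC // i0_min.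
  apply: v_sum_gt => // i _; case: ifPn => [Pi|nP]; last first.
    rewrite lt_neqAle g_ge andbT eq_sym; move: nP; rewrite /P ltn_ord /=; exact: id.
  have [rs ra _] := hr i; have [_ /eqP gmu] := andP Pi.
  have ra0 : r i != 0.
    by apply: contraTneq (ga_neq0 _ Pi) => r0; move/eqP: ra;
      rewrite r0 rmorph0 horner0 eq_sym mulf_eq0 invr_eq0 (negPf b0) orbF negbK.
  rewrite -gmu !val_funM wt_ltD2rE; last by rewrite U_ntop expf_neq0 // monic_neq0.
  have s1 := small_sim Kb_algebraic data (gnz _ Pi) (gs i).
  have s2 := v_simM (small_sim Kb_algebraic data (gnz _ Pi1) (gs i1)) (small_sim Kb_algebraic
    data ra0 rs).
  have s2' : W (g i1 * r i)^F < W ((g i1 * r i)^F - cst (g i)^i.[a]).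
    by move: s2; rewrite -!tofracM -rmorphM -polyCM ra mulrCA divff // mulr1.
  have := v_sim_trans s1 (v_sim_sym s2'); rewrite -rmorphB -rmorphB !WU; exact: id.
(* Having [U < w] depends only on the initial form, and [A] cancels because [U A = w A] is
   finite. *)
have ggU : U gg < w gg.
  have : U (A * gg) < w (A * gg).
    rewrite (v_sim sim); apply: lt_le_trans (_ : Order.min (w F) (w (F - A * gg)) <= _).
      by rewrite lt_min FU (lt_le_trans sim).
    by apply: le_trans (vB _ _ _) _; rewrite opprB addrC subrK.
  by rewrite (val_funM U A) (val_funM w A) -AE ![U A + _]addrC wt_ltD2rE.
have := Fle gg ggm ggU; rewrite ggs => sF.
have sF1 : (n * i1 < size F)%N by apply: digit_neq0_size; exact: gnz Pi1.
have i00 : i0 = 0%N.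
  have := leq_trans sF1 sF; rewrite ltnS leq_mul2l eqn0Ngt n_gt0 /= => le.
  apply/eqP; rewrite -leqn0 -(leq_add2r i1) add0n.
  by rewrite -[leqRHS](subnK i01) addnC leq_add2r.
have sFE : size F = (n * i1).+1.
  by apply/eqP; rewrite eqn_leq sF1 andbT; move: sF; rewrite i00 subn0.
have g1 : g i1 = 1.
  have sA : size (F %/ Q ^+ i1) = 1%N.
    by rewrite size_divp ?expf_neq0 ?monic_neq0 // size_base_exp // sFE subSn // subnn.
  have /eqP/size_poly1P[x x0 Ax] := sA.
  have : lead_coef F = 1 by exact/monicP.
  rewrite (divp_eq F (Q ^+ i1)) lead_coefDl; last first.
    rewrite Ax mul_polyC size_scale // ltn_modp expf_neq0 // monic_neq0 //.
  rewrite lead_coefM (monicP (monic_exp _ Qm)) mulr1 Ax lead_coefC => x1.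
  by rewrite /g /digit Ax x1 modp_small // size_poly1.
have muE : mu = c *+ i1.
  have [_ /eqP] := andP Pi1; rewrite g1 mul1r (vX_fin _ U_base) => E.
  by apply: fin_inj.
exists i1; rewrite -muE; split=> //.
  rewrite lt0n; apply/eqP => i10; move: FU; rewrite w_small ?ltxx //.
  by rewrite sFE i10 muln0.
have [_ /eqP] := andP Pi0; rewrite i00 expr0 mulr1; exact: id.
Qed.

Lemma U_sub_lift m f g : U f = fin (c *+ (e * m)) -> fin (c *+ (e * m)) <= U g ->
  residue W (f^F / h^F ^+ m) = residue W (g^F / h^F ^+ m) -> U f < U (f - g).
Proof.
move=> hf hg E; have /residue_eq := E; rewrite -mulrBl -tofracB -rmorphB.
rewrite vdiv_gt0E ?(hXF_neq0 data) // (hX_W data) WU hf; apply.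
  by apply: (W_div_ge0 data); rewrite [u _]hf.
exact: (W_div_ge0 data).
Qed.

Lemma residue_lift_neq0 m f : U f = fin (c *+ (e * m)) -> residue W (f^F / h^F ^+ m) != 0.
Proof.
move=> hf; rewrite residue_eq0; last by apply: (W_div_ge0 data); rewrite [u _]hf.
by rewrite vdiv_gt0E ?(hXF_neq0 data) // (hX_W data) WU hf ltxx.
Qed.

Lemma residue_liftM m1 m2 f g : fin (c *+ (e * m1)) <= U f -> fin (c *+ (e * m2)) <= U g ->
  residue W ((f * g)^F / h^F ^+ (m1 + m2)) =
  residue W (f^F / h^F ^+ m1) * residue W (g^F / h^F ^+ m2).
Proof.
move=> hf hg; rewrite -residueM; try exact: (W_div_ge0 data).
by rewrite rmorphM rmorphM exprD mulf_div.
Qed.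

(** The constant digit has value [c *+ i1], so [i1 = e m], and [F / h ^+ m] has a residue polynomial
    [V], monic of degree [m] with nonzero constant term. A proper factorization of [V] would lift to
    polynomials of degree below [deg F], where [w] agrees with [U], and their product would have the
    initial form of [F], where [w] exceeds [U]. *)
Lemma increase_minimal_lifting F : increase_minimal F ->
  exists V : {poly residue_field W},
    [/\ irreducible_over S V, V != 'X & lifting iota vb u a c e h F V].
Proof.
move=> Fmin; have [Fm FU _] := Fmin.
have [i1 [i1_gt0 sF g1 FE gE]] := increase_minimal_leading Fmin.
have gs i : (size (digit Q F i) < size Q)%N := size_digit Qm F i.
have /dvdnP[m i1E] : (e %| i1)%N.
  by apply: (ramification_dvd data);
    apply: (value_group_adjoin_small Kb_algebraic data (gs 0%N)) gE.
rewrite mulnC in i1E; have m_gt0 : (0 < m)%N by move: i1_gt0; rewrite i1E muln_gt0 => /andP[].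
rewrite i1E in sF g1 FE gE.
have F_ge : fin (c *+ (e * m)) <= u (\sum_(i < size F) digit Q F i * Q ^+ i)%:F.
  by rewrite -(digit_expansion Qm Qs F) -[u _]/(U F) FE.
have [|SV EV] := residue_expansion Kb_algebraic data gs _ F_ge.
  by move=> i Fi; apply: digit_oob; apply: leq_trans Fi _; rewrite leq_pmull.
rewrite -(digit_expansion Qm Qs F) in EV; set V := \poly_(k < _) _ in SV EV.
have rc0 k N : rcoef iota a h 0 k N = 0 by rewrite /rcoef rmorph0 horner0 !mul0r.
have ha0 := ha_neq0 data.
have mF : (m < size F)%N.
  by rewrite sF ltnS mulnA leq_pmull // muln_gt0 n_gt0.
have Vm : V`_m = 1.
  rewrite coef_poly mF g1 /rcoef rmorph1 hornerC mul1r divff ?expf_neq0 //.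
  by rewrite polyC1 tofrac1 residue1.
have V_gt k : (m < k)%N -> V`_k = 0.
  move=> mk; rewrite coef_poly; case: ifP => // _;
    rewrite digit_oob ?rc0 ?polyC0 ?tofrac0 ?residue0 //.
  by rewrite sF ltn_pmul2l // ltn_pmul2l.
have V_size : size V = m.+1.
  apply/eqP; rewrite eqn_leq; apply/andP; split; first by apply/leq_sizeP => k; exact: V_gt.
  by rewrite ltnNge; apply/negP => /leq_sizeP/(_ m (leqnn m))/eqP; rewrite Vm oner_eq0.
have Vmonic : V \is monic by rewrite monicE lead_coefE V_size Vm.
have g0v : vb (digit Q F 0)^i.[a] = fin (c *+ (e * m)).
  by rewrite -(small_W Kb_algebraic data (gs 0%N)) WU gE.
have hmv : vb (ha ^+ m) = fin (c *+ (e * m)) by rewrite (vX_fin _ (ld_h_vb data)) mulrnA.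
have rv : vb (rcoef iota a h (digit Q F 0) 0 m) = fin 0.
  by rewrite /rcoef expr0 mulr1 (vdiv g0v hmv) subrr.
have V00 : V`_0 != 0.
  by rewrite coef_poly (leq_ltn_trans _ mF) // muln0 residue_eq0 (W_cst data) rv ?lexx // ltxx.
clearbody V; exists V; split; last first.
- exists m; split=> //; first by rewrite sF /= mulnC.
  + by rewrite tofracXn (vX_fin _ (ld_h_u data)) -mulrnA -FE.
  + by rewrite (quot_residueX _ _ _ _) EV -(yres_quot _ _ _ _ _).
- by apply/eqP => VX; move: V00; rewrite VX coefX eqxx.
split; [exact: SV | by rewrite V_size ltnS | move=> q r Sq Sr VE].
have [q1|q1] := eqVneq (size q) 1%N; first by left.
have [r1|r1] := eqVneq (size r) 1%N; first by right.
have V0 : V != 0 by exact: monic_neq0.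
have q0 : q != 0 by apply: contra_neq V0 => q0; rewrite VE q0 mul0r.
have r0 : r != 0 by apply: contra_neq V0 => r0; rewrite VE r0 mulr0.
have [k kq] : exists k, size q = k.+2.
  by case: (size q) q1 (size_poly_gt0 q) => [|[|k]] //; [rewrite q0 | exists k].
have [l lr] : exists l, size r = l.+2.
  by case: (size r) r1 (size_poly_gt0 r) => [|[|l]] //; [rewrite r0 | exists l].
have mE : m = (k.+1 + l.+1)%N.
  by apply/eqP; rewrite -eqSS -V_size VE size_mul // kq lr addSn addnS.
(* The size of the lift is at most [deg Q * (e * k'.+1 + 1)], which does not exceed
   [deg Q * (e * m) = deg F] because [e >= 1] and [k'.+2 <= m]. *)
have lift p k' : coefs_in S p -> size p = k'.+2 -> (k'.+1 < m)%N -> exists f : {poly K},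
    [/\ U f = w f, fin (c *+ (e * k'.+1)) <= U f & residue W (f^F / h^F ^+ k'.+1) = p.[yres
      iota W a e h]].
  move=> Sp sp km; have [|f [sf fU Ef]] := residue_lift Kb_algebraic data (n := k'.+1) Sp.
    by rewrite sp.
  exists f; split=> //; apply: (increase_minimal_below Fmin); apply: leq_ltn_trans sf _.
  rewrite sF ltnS leq_mul2l; apply/orP; right; apply: leq_trans (_ : e * k'.+2 <= _)%N.
    by rewrite [leqRHS]mulnS -[leqLHS]add1n leq_add2r.
  by rewrite leq_mul2l km orbT.
have [|f [fw fU Ef]] := lift q k Sq kq; first by rewrite mE addnS ltnS leq_addr.
have [|g [gw gU Eg]] := lift r l Sr lr; first by rewrite mE addSn ltnS leq_addl.
have fgU : fin (c *+ (e * m)) <= U (f * g).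
  by rewrite val_funM mE mulnDr mulrnDr finD wt_leD.
have E : residue W (F^F / h^F ^+ m) = residue W ((f * g)^F / h^F ^+ m).
  by rewrite EV VE hornerM -Ef -Eg -residue_liftM // mE.
have dU := U_sub_lift FE fgU E; rewrite FE in dU.
have : fin (c *+ (e * m)) < w (f * g).
  have -> : f * g = F - (F - f * g) by rewrite opprB addrC subrK.
  apply: lt_le_trans (vB _ _ _); rewrite lt_min -FE FU FE /=.
  exact: lt_le_trans dU (U_le _).
rewrite val_funM -fw -gw -val_funM => lt.
have := residue_lift_neq0 FE; rewrite E residue_zero ?eqxx //.
by rewrite vdiv_gt0E ?(hXF_neq0 data) // (hX_W data) WU.
Qed.

(* If g has minimal degree with U g < w g, dividing F by g shows that the residue  *)
(* polynomial of g divides that of F.                                              *)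
Lemma lifting_increase_minimal F (V : {poly residue_field W}) :
  U F < w F -> irreducible_over S V -> lifting iota vb u a c e h F V ->
  increase_minimal F.
Proof.
move=> FU [_ _ Virr] [m [m_gt0 Vm sV SV] [Fm sF _ FE EF]].
split=> // g gm gU; rewrite leqNgt; apply/negP => gF.
pose P k := `[< exists g, [/\ g \is monic, U g < w g & size g = k] >].
have exP : exists k, P k by exists (size g); apply/asboolP; exists g.
case: (ex_minnP exP) => k /asboolP[g0 [g0m g0U sg0]] kmin {exP}.
have g0F : (size g0 < size F)%N.
  by rewrite sg0; apply: leq_ltn_trans gF; apply: kmin; apply/asboolP; exists g.
have g0min : increase_minimal g0.
  by split=> // g1 g1m g1U; rewrite sg0; apply: kmin; apply/asboolP; exists g1.
have [V0 [_ _ [m0 [m0_gt0 V0m sV0 SV0] [_ sg0E _ g0E Eg0]]]] := increase_minimal_lifting g0min.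
have m0m : (m0 < m)%N.
  have F1 : (0 < size F)%N by apply: leq_trans g0F.
  have g01 : (0 < size g0)%N by rewrite size_poly_gt0 monic_neq0.
  move: g0F; rewrite -(prednK F1) -(prednK g01) ltnS sF sg0E.
  by rewrite ltn_pmul2r ?ltn_pmul2l.
have m0mE : (m - m0 + m0)%N = m by rewrite subnK // ltnW.
have FE' : U F = fin (c *+ (e * m)) := FE.
have g0E' : U g0 = fin (c *+ (e * m0)) := g0E.
set q := F %/ g0; set r := F %% g0; have Fqr : F = q * g0 + r := divp_eq F g0.
have rw : U r = w r.
  by apply: (increase_minimal_below g0min); rewrite ltn_modp monic_neq0.
have Fr : q * g0 = F - r by rewrite Fqr addrK.
have q0 : q != 0.
  rewrite -size_poly_gt0 size_divp ?monic_neq0 // subn_gt0.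
  by rewrite (leq_ltn_trans (leq_pred _)).
(* Otherwise [w F > U F >= U r = w r] gives [w (q * g0) = U r]; but [w] exceeds [U] at [q * g0],
   where [U] is at least [U r]. So [F] and [q * g0] have the same initial form. *)
have rU : U F < U r.
  rewrite ltNge; apply/negP => le; have wE : w (q * g0) = U r.
    by rewrite Fr -opprB vN vD_lt -?rw // vN (le_lt_trans le).
  have : U (q * g0) < w (q * g0).
    by rewrite !val_funM addrC [ltRHS]addrC; apply: wt_ltD; rewrite ?U_ntop.
  rewrite wE Fr ltNge => /negP; apply; apply: le_trans (vB _ _ _).
  by rewrite le_min le lexx.
have qgE : U (q * g0) = fin (c *+ (e * m)).
  by rewrite Fr -FE'; apply: v_sim; rewrite opprB addrC subrK.
have qE : U q = fin (c *+ (e * (m - m0))).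
  apply: (@wt_addI _ (U g0)); first by rewrite g0E'.
  by rewrite -val_funM qgE g0E' -finD -mulrnDr -mulnDr m0mE.
have [Vq SVq Eq] : exists2 Vq : {poly residue_field W}, coefs_in S Vq
    & residue W (q^F / h^F ^+ (m - m0)) = Vq.[yres iota W a e h].
  have q_ge : fin (c *+ (e * (m - m0))) <= u (\sum_(i < size q) digit Q q i * Q ^+ i)%:F.
    by rewrite -(digit_expansion Qm Qs q) -[u _]/(U q) qE.
  have [|SVq Eq] := residue_expansion Kb_algebraic data (size_digit Qm q) _ q_ge.
    by move=> i qi; apply: digit_oob; apply: leq_trans qi _; rewrite leq_pmull.
  by rewrite -(digit_expansion Qm Qs q) in Eq; eexists; [exact: SVq | exact: Eq].
have EF' : residue W (F^F / h^F ^+ m) = V.[yres iota W a e h].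
  by rewrite -(quot_residueX _ _ _ _) -(yres_quot _ _ _ _ _).
have Eg0' : residue W (g0^F / h^F ^+ m0) = V0.[yres iota W a e h].
  by rewrite -(quot_residueX _ _ _ _) -(yres_quot _ _ _ _ _).
have FqgE : residue W (F^F / h^F ^+ m) = residue W ((q * g0)^F / h^F ^+ m).
  apply/residue_eq.
  - by apply: (W_div_ge0 data); rewrite -[u _]/(U F) FE'.
  - by apply: (W_div_ge0 data); rewrite -[u _]/(U (q * g0)) qgE.
  rewrite -mulrBl -tofracB -rmorphB vdiv_gt0E ?(hXF_neq0 data) // (hX_W data) WU.
  by rewrite Fr opprB addrC subrK -FE'.
have VYE : V.[yres iota W a e h] = (Vq * V0).[yres iota W a e h].
  rewrite hornerM -Eq -Eg0' -EF' FqgE -{1}m0mE; apply: residue_liftM.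
    by rewrite qE.
  by rewrite g0E'.
(* Both sides agree at [yres], which is transcendental over the residue field of [K(a)]. *)
have VE : V = Vq * V0.
  apply/eqP; rewrite -subr_eq0; apply: contraT => D0.
  have D_S := coefs_adjoinBM (W_cst data) SV SVq SV0.
  have /negP[] := yres_transcendental Kb_algebraic data D0 (fun i => let: ex_intro2 b (conj _
    b0) E := D_S i in ex_intro2 _ _ b b0 E).
  exact: root_sub_eq VYE.
have [sVq|] := Virr Vq V0 SVq SV0 VE; last by rewrite sV0 => -[m00]; rewrite m00 in m0_gt0.
have := size_mul_const V0 sVq; rewrite -VE sV sV0 => -[mE].
by rewrite mE ltnn in m0m.
Qed.
End MinimalIncrease.

(** * Residue-transcendental extensions *)

Section FractionValuation.
Variables (R : idomainType) (G : orderedGroupType) (w : valuation R G).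
Hypothesis w_top : forall x, w x = top -> x = 0.
Implicit Types (x y : {fraction R}) (m n d : R).

Lemma fraction_ex x : exists n d, d != 0 /\ x = n%:F / d%:F.
Proof.
elim/quotW: x => r; have r0 := denom_ratioP r; exists (frac r).1, (frac r).2; split=> //.
have d0 : ((frac r).2)%:F != 0 by rewrite tofrac_eq0.
apply: (mulIf d0); rewrite divfK //; unlock FracField.tofrac.
rewrite -[LHS]FracField.pi_mul; apply/eqmodP.
rewrite /= FracField.equivfE /FracField.mulf !numden_Ratio ?mulf_neq0 ?oner_neq0 //.
by rewrite !mulr1 mulrC.
Qed.

Lemma w_neq0 n : n != 0 -> w n != top.
Proof. by apply: contra_neq => /w_top. Qed.

(** The value is characterized by [y + w d = w n] instead of a difference, as [w n] may be infinite;
    cross-multiplication gives independence of the representation. *)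
Lemma fraction_val_ex x : exists y : withtop G,
  forall n d, d != 0 -> x = n%:F / d%:F -> y + w d = w n.
Proof.
have [n [d [d0 ->]]] := fraction_ex x; have /ntopP[b db] := w_neq0 d0.
pose y : withtop G := if w n is Some a then fin (a - b) else top.
have yE : y + w d = w n.
  by rewrite /y db; case: (w n) => [a|] //; rewrite -finD subrK.
exists y => n' d' d'0 /eqP; rewrite eqr_div ?tofrac_eq0 // -!tofracM tofrac_eq => /eqP E.
apply: (@wt_addI _ (w d)); first by rewrite db.
by rewrite -(val_funM w n') -E val_funM -yE addrAC.
Qed.

Definition fraction_val x : withtop G := projT1 (cid (fraction_val_ex x)).

Lemma fraction_valE n d : d != 0 -> fraction_val (n%:F / d%:F) + w d = w n.
Proof. by move=> d0; rewrite /fraction_val; case: cid => y /= h; exact: h. Qed.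

Lemma fraction_val_eq n d (y : withtop G) : d != 0 -> y + w d = w n ->
  fraction_val (n%:F / d%:F) = y.
Proof. by move=> d0 e; apply: (@wt_addI _ (w d)); rewrite ?w_neq0 // fraction_valE. Qed.

Lemma fraction_val_tofrac n : fraction_val n%:F = w n.
Proof.
by rewrite -[n%:F]divr1 -tofrac1; apply: fraction_val_eq; rewrite ?oner_neq0 // val_fun1 addr0.
Qed.

Lemma fraction_val0 : fraction_val 0 = top.
Proof. by rewrite -tofrac0 fraction_val_tofrac val_fun0. Qed.

Lemma fraction_val1 : fraction_val 1 = 0.
Proof. by rewrite -tofrac1 fraction_val_tofrac val_fun1. Qed.

Lemma fraction_valM x y : fraction_val (x * y) = fraction_val x + fraction_val y.
Proof.
have [n [d [d0 ->]]] := fraction_ex x; have [n' [d' [d'0 ->]]] := fraction_ex y.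
rewrite mulf_div -!tofracM; apply: fraction_val_eq; first exact: mulf_neq0.
by rewrite !val_funM addrACA !fraction_valE.
Qed.

Lemma fraction_valD x y : Order.min (fraction_val x) (fraction_val y) <= fraction_val (x + y).
Proof.
have [n [d [d0 ->]]] := fraction_ex x; have [n' [d' [d'0 ->]]] := fraction_ex y.
have dd0 : d * d' != 0 by exact: mulf_neq0.
rewrite addf_div ?tofrac_eq0 // -!tofracM -tofracD.
rewrite -(wt_leD2rE _ _ (w_neq0 dd0)) fraction_valE //.
apply: le_trans (val_funD _ _ _); rewrite le_min; apply/andP; split.
  rewrite !val_funM -(fraction_valE n d0) addrA wt_leD2r // wt_leD2r //.
  by rewrite ge_min lexx.
rewrite !val_funM -(fraction_valE n' d'0) [w d + _]addrC addrA wt_leD2r //.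
by rewrite wt_leD2r // ge_min lexx orbT.
Qed.

Definition fraction_valuation : valuation {fraction R} G :=
  Valuation fraction_val0 fraction_val1 fraction_valM fraction_valD.

End FractionValuation.

(** * Algebraic dependence in K(x) and in its residue field *)

Section LinearDependence.
Variable K : fieldType.

Lemma poly_dependence (I : finType) (p : I -> {poly K}) m :
  (forall i, (size (p i) <= m)%N) -> (m < #|I|)%N ->
  exists2 c : I -> K, exists i, c i != 0 & \sum_i c i *: p i = 0.
Proof.
move=> sp mI; pose A := \matrix_(i < #|I|, j < m) (p (enum_val i))`_j.
have : kermx A != 0.
  rewrite kermx_eq0 /row_free; apply: contraTneq mI => <-.
  by rewrite -leqNgt rank_leq_col.
case/rowV0Pn => r rA r0; have {}rA : r *m A = 0 by apply/sub_kermxP.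
exists (fun i => r 0 (enum_rank i)).
  have /rV0Pn[i ri] := r0; exists (enum_val i); by rewrite enum_valK.
apply/polyP => j; rewrite coef0 coef_sum.
have [jm|mj] := ltnP j m; last first.
  by rewrite big1 // => i _; rewrite coefZ nth_default ?mulr0 // (leq_trans (sp i)).
have := congr1 (fun M : 'M_(1, m) => M 0 (Ordinal jm)) rA; rewrite !mxE => rAj.
rewrite -[RHS]rAj (reindex (@enum_val I predT)) /=; last first.
  by exists enum_rank => i _; [exact: enum_valK | exact: enum_rankK].
by apply: eq_bigr => i _; rewrite coefZ mxE enum_valK.
Qed.

End LinearDependence.

Lemma clear_denominators (L : fieldType) (x f g f' g' : L) k l N : g != 0 -> g' != 0 ->
  (k <= N)%N -> (l <= N)%N ->
  x * (f / g) ^+ k * (f' / g') ^+ l * (g * g') ^+ N =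
  x * ((f ^+ k * g ^+ (N - k)) * (f' ^+ l * g' ^+ (N - l))).
Proof.
move=> g0 g'0 kN lN.
have cancel (y z : L) m : z != 0 -> (m <= N)%N -> (y / z) ^+ m * z ^+ N = y ^+ m * z ^+ (N - m).
  by move=> z0 mN; rewrite expr_div_n -{1}(subnKC mN) exprD mulrA divfK // expf_neq0.
by rewrite -(cancel f) // -(cancel f') // [(g * g') ^+ N]exprMn -[x * _ * _]mulrA -mulrA mulrACA.
Qed.

Section FractionDependence.
Variable K : fieldType.
Implicit Types (s t : {fraction {poly K}}).

Lemma size_exp_le (p : {poly K}) k N : (k <= N)%N ->
  ((size (p ^+ k)).-1 <= N * (size p).-1)%N.
Proof.
move=> kN; have [->|p0] := eqVneq p 0.
  by rewrite size_poly0 muln0 expr0n; case: eqP => _; rewrite ?size_poly1 ?size_poly0.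
by rewrite -subn1 leq_subLR add1n (leq_trans (size_poly_exp_leq p k)) // ltnS mulnC leq_mul2r
  kN orbT.
Qed.

Lemma size_mul_pred (p q : {poly K}) : ((size (p * q)%R).-1 <= (size p).-1 + (size q).-1)%N.
Proof.
have [->|p0] := eqVneq p 0; first by rewrite mul0r size_poly0.
have [->|q0] := eqVneq q 0; first by rewrite mulr0 size_poly0.
rewrite size_mul // -[size p in leqLHS]prednK ?size_poly_gt0 //.
by rewrite -[size q in leqLHS]prednK ?size_poly_gt0 // addSn addnS.
Qed.

(* K(x) has transcendence degree 1 over K: the (k, l)-monomials with k, l < N in   *)
(* two fractions have a common denominator for which the numerators have degree    *)
(* O(N), while there are N^2 of them.                                              *)
Lemma fraction_dependence s t : exists N (c : 'I_N * 'I_N -> K),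
  (exists i, c i != 0) /\ \sum_i ((c i)%:P)%:F * t ^+ i.1 * s ^+ i.2 = 0.
Proof.
have [f [g [g0 tE]]] := fraction_ex t; have [f' [g' [g'0 sE]]] := fraction_ex s.
pose B := ((size f).-1 + (size g).-1 + ((size f').-1 + (size g').-1))%N.
(* The numerators span a space of dimension at most [N B + 1], less than their number
   [N^2 = N B + 2 N]. *)
pose N := B.+2; pose p (i : 'I_N * 'I_N) :=
  (f ^+ i.1 * g ^+ (N - i.1)) * (f' ^+ i.2 * g' ^+ (N - i.2)).
have sp i : (size (p i) <= (N * B).+1)%N.
  have pred n m : (n.-1 <= m)%N -> (n <= m.+1)%N by case: n.
  apply: pred; apply: leq_trans (size_mul_pred _ _) _; rewrite /B mulnDr leq_add //.
    apply: leq_trans (size_mul_pred _ _) _; rewrite mulnDr leq_add // size_exp_le //.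
      exact/ltnW/ltn_ord.
    exact: leq_subr.
  apply: leq_trans (size_mul_pred _ _) _; rewrite mulnDr leq_add // size_exp_le //.
    exact/ltnW/ltn_ord.
  exact: leq_subr.
have [|c c0 cE] := poly_dependence sp.
  rewrite card_prod !card_ord; have -> : (N * N = N * B + (N * 2))%N by rewrite -mulnDr addn2.
  by rewrite -addn1 ltn_add2l /N muln2.
exists N, c; split=> //.
have gg0 : (g%:F * g'%:F) ^+ N != 0 by rewrite expf_neq0 // mulf_neq0 // tofrac_eq0.
apply: (mulIf gg0); rewrite mul0r -[RHS](rmorph0 (@tofrac {poly K})) -cE rmorph_sum /= mulr_suml.
apply: eq_bigr => i _; rewrite -mul_polyC tE sE /p !tofracM !tofracXn.
by apply: clear_denominators; rewrite ?tofrac_eq0 // ltnW.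
Qed.

Variables (G : orderedGroupType) (v : valuation K G) (u : valuation {fraction {poly K}} G).
Hypothesis u_v : forall c, u (c%:P)%:F = v c.

(** Lift [z] and [y] to [t] and [s] in [K(x)] and divide an algebraic relation between them by a
    coefficient of least value. Its residue is a nontrivial relation, and it remains nontrivial as a
    polynomial in [z] because [y] is transcendental. *)
Lemma residue_algebraic (y : residue_field u) :
  ~ algebraic_over (@base_residue_field _ _ v u) y ->
  forall z, algebraic_over (field_gen (@base_residue_field _ _ v u `|` [set y])) z.
Proof.
set M := field_gen _ => y_tr z.
have M_sub : is_subfield M.
  split=> [A [[A1 _ _] _] //|p q Sp Sq A AS|p q Sp Sq A AS].
    by case: (AS) => -[_ AB _] _; apply: AB; [exact: Sp | exact: Sq].
  by case: (AS) => -[_ _ AD] _; apply: AD; [exact: Sp | exact: Sq].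
have M_base c : fin 0 <= v c -> M (residue u (c%:P)%:F).
  by move=> c0 A [_ AS]; apply: AS; left; exists c.
have M_y : M y by move=> A [_ AS]; apply: AS; right.
have [t t0 tz] := residueP z; have [s s0 sy] := residueP y.
have [N [c [[i1 ci1] cE]]] := fraction_dependence s t.
pose i0 := [arg min_(i < i1) v (c i)]%O.
have i0_min i : v (c i0) <= v (c i) by rewrite /i0; case: arg_minP => // j _; exact.
have ci0 : c i0 != 0.
  rewrite -(v_ntop v); apply: contraTneq (i0_min i1) => ->.
  by rewrite -ltNge lt_neqAle le_top v_ntop ci1.
pose c' i := c i / c i0; have c'0 : c' i0 = 1 by rewrite /c' divff.
have c'_ge i : fin 0 <= v (c' i) by exact: vdiv_ge0.
have c'E : \sum_i ((c' i)%:P)%:F * t ^+ i.1 * s ^+ i.2 = 0.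
  apply: (etrans (y := ((c i0)^-1%:P)%:F * \sum_i ((c i)%:P)%:F * t ^+ i.1 * s ^+ i.2)).
    rewrite mulr_sumr; apply: eq_bigr => i _.
    by rewrite !mulrA -tofracM -polyCM [_^-1 * _]mulrC.
  by rewrite cE mulr0.
pose C k l : K := if (insub k : option 'I_N, insub l : option 'I_N) is (Some k', Some l')
  then c' (k', l') else 0.
have CE (k l : 'I_N) : C k l = c' (k, l) by rewrite /C !valK.
have C_ge k l : fin 0 <= v (C k l).
  by rewrite /C; case: insub => [k'|]; [case: insub => [l'|] |];
    rewrite ?c'_ge // val_fun0 le_top.
pose q k := \poly_(l < N) residue u ((C k l)%:P)%:F.
pose p := \poly_(k < N) (q k).[y].
have q_base k : coefs_in (@base_residue_field _ _ v u) (q k).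
  move=> l; rewrite coef_poly; case: ifP => _; first by exists (C k l).
  by exists 0; rewrite ?val_fun0 ?le_top // polyC0 tofrac0 residue0.
have uC_ge k l : fin 0 <= u ((C k l)%:P)%:F by rewrite u_v.
exists p; split.
- apply: contra_notN y_tr => /eqP p0; exists (q i0.1); split=> //.
    apply/eqP => /(congr1 (fun r : {poly _} => r`_i0.2)).
    rewrite coef_poly ltn_ord coef0 CE -surjective_pairing c'0 polyC1 tofrac1 residue1.
    by apply/eqP; exact: oner_neq0.
  by have := congr1 (fun r : {poly _} => r`_i0.1) p0; rewrite coef_poly ltn_ord coef0 => /eqP.
- move=> k; rewrite coef_poly; case: ifP => _; last exact: subfield0 M_sub.
  rewrite horner_coef; apply: (subfield_sum M_sub) => l; apply: (subfieldM M_sub).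
    by have [x x0 ->] := q_base k l; exact: M_base.
  exact: (subfieldX M_sub).
- apply/rootP; rewrite horner_poly.
  have term_ge (i : 'I_N * 'I_N) : fin 0 <= u (((c' i)%:P)%:F * t ^+ i.1 * s ^+ i.2).
    by rewrite !val_funM -[fin 0]addr0 -[fin 0]addr0 !wt_leD ?vX_ge0 ?u_v.
  have := congr1 (residue u) c'E; rewrite residue_sum // residue0 => E.
  have {}E : \sum_(k < N) \sum_(l < N)
      residue u (((c' (k, l))%:P)%:F * t ^+ k * s ^+ l) = 0.
    by rewrite pair_bigA /= -[RHS]E; apply: eq_bigr => -[k l] _.
  rewrite -[RHS]E.
  apply: eq_bigr => k _; rewrite horner_poly mulr_suml; apply: eq_bigr => l _.
  have c_ge : fin 0 <= u (((c' (k, l))%:P)%:F) by rewrite u_v.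
  have ct_ge : fin 0 <= u (((c' (k, l))%:P)%:F * t ^+ k).
    by rewrite val_funM -[fin 0]addr0 wt_leD // vX_ge0.
  by rewrite residueM ?vX_ge0 // residueM ?vX_ge0 // !residueX // -tz -sy CE mulrAC.
Qed.
End FractionDependence.

Lemma clear_powers (L : fieldType) (C : nat -> L) (q h : L) e n : h != 0 ->
  (\sum_(k < n) C k * (q ^+ e / h) ^+ k) * h ^+ n =
  \sum_(k < n) C k * q ^+ (e * k) * h ^+ (n - k).
Proof.
move=> h0; rewrite mulr_suml; apply: eq_bigr => k _.
rewrite expr_div_n -exprM -!mulrA; congr (_ * (_ * _)).
have -> : h ^+ n = h ^+ k * h ^+ (n - k) by rewrite -exprD subnKC // ltnW.
by rewrite mulKf // expf_neq0.
Qed.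

Section ResidueTranscendence.
Variables (K : fieldType) (Kb : closedFieldType) (iota : {rmorphism K -> Kb}).
Hypothesis Kb_algebraic : forall a : Kb, algebraicOver iota a.
Variables (G : orderedGroupType) (v : valuation K G) (vb : valuation Kb G).
Hypothesis vb_v : forall c, vb (iota c) = v c.
Variables (u : valuation {fraction {poly K}} G) (W : valuation {fraction {poly Kb}} G).
Variables (a : Kb) (d c : G) (e : nat) (h : {poly K}).
Hypothesis data : lifting_data iota vb u W a d c e h.

Lemma u_yfrac_combination n (b : nat -> K) k0 : (k0 < n)%N ->
  (forall k, fin 0 <= v (b k)) -> v (b k0) = fin 0 ->
  u (\sum_(k < n) ((b k)%:P)%:F * ((minpoly iota a)%:F ^+ e / h%:F) ^+ k) = fin 0.
Proof.
move=> k0n b_ge bk0; set s := \sum_(k < n) _; set Q := minpoly iota a in s *.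
have h0 : h%:F != 0 by rewrite tofrac_eq0 (h_neq0 data).
pose P : {poly K} := \sum_(k < n) (b k)%:P * Q ^+ (e * k) * h ^+ (n - k).
have PE : P%:F = s * h%:F ^+ n.
  rewrite /s (clear_powers (fun k => ((b k)%:P)%:F)) // rmorph_sum; apply: eq_bigr => k _.
  by rewrite /= !tofracM !tofracXn.
have PbE : (map_poly iota P)%:F = (\sum_(k < n) ((iota (b k))%:P)%:F * yfrac iota a e h ^+ k) *
    (map_poly iota h)%:F ^+ n.
  rewrite /yfrac (clear_powers (fun k => ((iota (b k))%:P)%:F)) ?(hF_neq0 data) //.
  rewrite rmorph_sum rmorph_sum; apply: eq_bigr => k _ /=.
  by rewrite !rmorphM !rmorphXn /= map_polyC.
have := W_poly data P; rewrite PbE PE !val_funM.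
rewrite (W_yfrac_combination Kb_algebraic data (b := fun k => iota (b k)) k0n); last 2 first.
- by move=> k; rewrite vb_v.
- by rewrite vb_v.
rewrite (hX_W data) (vX_fin _ (ld_h_u data)) -mulrnA => E.
by apply/esym/(@wt_addI _ (fin (c *+ (e * n)))).
Qed.

Lemma lifting_data_transcendental :
  (forall x : K, u (x%:P)%:F = v x) -> residue_transcendental v u.
Proof.
move=> u_v; split=> //; pose yf := (minpoly iota a)%:F ^+ e / h%:F.
have yf0 : u yf = fin 0.
  by rewrite (vdiv (vX_fin _ (ld_c data)) (ld_h_u data)) subrr.
suff y_tr : ~ algebraic_over (@base_residue_field _ _ v u) (residue u yf).
  by exists (residue u yf); split=> // z; exact: residue_algebraic.
move=> [p [p0 Sp py]].
have hp k : exists b, fin 0 <= v b /\ p`_k = residue u (b%:P)%:F.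
  by have [b b0 pb] := Sp k; exists b.
have [b hb] := choice hp; pose k0 := (size p).-1.
have k0p : (k0 < size p)%N by rewrite prednK // size_poly_gt0.
have bk0 : v (b k0) = fin 0.
  apply/le_anti; rewrite (hb k0).1 andbT leNgt; apply/negP => gt.
  have := lead_coef_eq0 p; rewrite lead_coefE (hb k0).2 residue_zero ?u_v //.
  by rewrite eqxx (negPf p0).
have t_ge k : fin 0 <= u (((b k)%:P)%:F * yf ^+ k).
  by rewrite val_funM u_v (vX_fin _ yf0) mul0rn fin0 addr0 (hb k).1.
have yf_ge : fin 0 <= u yf by rewrite yf0.
have yfX_ge k : fin 0 <= u (yf ^+ k) by exact: vX_ge0.
have b_ge k : fin 0 <= u ((b k)%:P)%:F by rewrite u_v (hb k).1.
have pE : p.[residue u yf] = residue u (\sum_(k < size p) ((b k)%:P)%:F * yf ^+ k).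
  rewrite residue_sum // horner_coef; apply: eq_bigr => k _.
  by rewrite (hb k).2 -(residueX k yf_ge) -(residueM (b_ge k) (yfX_ge k)).
have uE := u_yfrac_combination k0p (fun k => (hb k).1) bk0.
have : residue u (\sum_(k < size p) ((b k)%:P)%:F * yf ^+ k) = 0 by rewrite -pE; exact/rootP.
by move/eqP; rewrite residue_eq0 uE ?ltxx.
Qed.
End ResidueTranscendence.

(** * Lifting data for the truncation at a key polynomial *)

Section Construction.
Variables (K : fieldType) (Kb : closedFieldType) (iota : {rmorphism K -> Kb}).
Hypothesis Kb_algebraic : forall a : Kb, algebraicOver iota a.
Variables (G G' : orderedGroupType) (j : {additive G -> G'}).
Hypothesis j_mono : {mono j : x y / x <= y}.
Variables (v : valuation K G) (vb : valuation Kb G) (w : valuation {poly K} G) (wb : valuation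
  {poly Kb} G').
Hypothesis vb_v : forall c, vb (iota c) = v c.
Hypothesis w_v : forall c, w c%:P = v c.
Hypothesis wb_w : forall f : {poly K}, wb (map_poly iota f) = withtop_map j (w f).
Hypothesis wb_vb : forall a : Kb, wb a%:P = withtop_map j (vb a).
Implicit Types (f g Q : {poly K}) (a b : Kb).

Local Notation "f ^i" := (map_poly iota f) (at level 2, format "f ^i").
Local Notation wX b := (wb ('X - b%:P)).
Local Notation vb' := (map_valuation j_mono vb).

Lemma closed_nth_root (z : Kb) k : (0 < k)%N -> exists y, y ^+ k = z.
Proof.
move=> k0; have /closed_rootP[y] : size ('X^k - z%:P) != 1%N.
  by rewrite size_XnsubC // eqSS -lt0n.
by rewrite rootE !hornerE subr_eq0 => /eqP; exists y.
Qed.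

(** The value group of the algebraically closed [Kb] is divisible, and the ordered group [G'] is
    torsion-free. *)
Lemma value_group_div (x : G') (g : G) k : (0 < k)%N -> value_group vb g ->
  x *+ k = j g -> exists2 d, value_group vb d & x = j d.
Proof.
move=> k0 [z zg] xg; have [y yz] := closed_nth_root z k0.
have /ntopP[d yd] : vb y != top.
  by apply: contra_eq_neq zg => yt; rewrite -yz vX yt -(prednK k0) mulrS addtop.
exists d; first by exists y.
apply: (oag_mulrnI k0); rewrite xg -raddfMn; congr (j _).
by apply: fin_inj; rewrite -zg -yz (vX_fin _ yd).
Qed.

(** If the terms with nonzero digits had pairwise distinct values, [w f] would be their minimum,
    which is the truncation. *)
Lemma equal_digit_values Q f : Q \is monic -> (1 < size Q)%N -> truncation Q w f < w f ->
  exists i k, [/\ (i < k)%N, digit Q f i != 0, digit Q f k != 0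
    & w (digit Q f i * Q ^+ i) = w (digit Q f k * Q ^+ k)].
Proof.
move=> Qm Qs lt; apply: contrapT => n; move: lt; rewrite {2}(digit_expansion Qm Qs f).
rewrite (v_sum_distinct (F := fun i => digit Q f i * Q ^+ i)) ?ltxx // => i k /andP[ik _] E.
have [D|Di] := eqVneq (digit Q f i) 0; first by rewrite D mul0r val_fun0.
have [D|Dk] := eqVneq (digit Q f k) 0; first by rewrite E D mul0r val_fun0.
by case: n; exists i, k.
Qed.

Section Data.
Variable Q : {poly K}.
Hypothesis Q_key : abstract_key_poly iota wb Q.
Variables (a : Kb) (dl : G').
Hypotheses (Q_a : root Q^i a) (a_max : wX a = delta iota wb Q) (a_dl : wX a = fin dl).

Let Qm : Q \is monic. Proof. by case: Q_key. Qed.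
Let Qs : (1 < size Q)%N. Proof. by case: Q_key. Qed.
Let Qirr : irreducible_poly Q := key_poly_irreducible Kb_algebraic Q_key.

Lemma key_minpoly : minpoly iota a = Q.
Proof. exact: minpoly_eq. Qed.

Lemma key_small_horner f : (size f < size Q)%N -> w f = vb f^i.[a].
Proof.
have [->|f0] := eqVneq f 0; first by rewrite rmorph0 horner0 !val_fun0.
move=> fQ; apply: (tmap_inj j_mono); rewrite -wb_w.
rewrite -(key_small_val Kb_algebraic j_mono wb_vb Q_key a_max a_dl fQ).
have [t ft] := key_small_ptop Kb_algebraic j_mono wb_vb Q_key a_max a_dl f0 fQ.
by rewrite (ptop_val ft); apply/esym; exact: ptop0_horner ft.
Qed.

(** Two terms of equal value at indices [i < k] make [c *+ (k - i)] a difference of values of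
    elements of [K(a)]. *)
Lemma key_value_torsion f c : w Q = fin c -> truncation Q w f < w f ->
  exists2 k, (0 < k)%N & value_group_adjoin iota vb a (c *+ k).
Proof.
move=> Qc lt; have [i [k [ik Di Dk E]]] := equal_digit_values Qm Qs lt.
have val m : digit Q f m != 0 -> exists2 g,
  value_group_adjoin iota vb a g & w (digit Q f m) = fin g.
  move=> Dm; have Ds : (size (digit Q f m) < size Q)%N by exact: size_digit.
  have /ntopP[g gE] : vb (digit Q f m)^i.[a] != top.
    rewrite v_ntop; apply: contraTN Ds => Da; rewrite -leqNgt.
    have -> : size Q = size (minpoly iota a) by rewrite key_minpoly.
    by apply: minpoly_size => //; exact/rootP/eqP.
  exists g; first by exists (digit Q f m)^i.[a]; [exact: adjoin_horner | exact: gE].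
  by rewrite key_small_horner.
have [gi Si Ei] := val i Di; have [gk Sk Ek] := val k Dk.
exists (k - i)%N; first by rewrite subn_gt0.
move: E; rewrite !val_funM !(vX_fin _ Qc) Ei Ek -!finD => /fin_inj E.
suff -> : c *+ (k - i) = gi - gk by apply: value_group_adjoinB.
apply: (@addrI _ gk); rewrite [RHS]addrC subrK; apply: (@addIr _ (c *+ i)).
by rewrite -addrA -mulrnDr subnK // ltnW.
Qed.

(** The last minimal coefficient [q] of [Q] at [a] gives [c = vb q + l dl] with [l > 0], so a
    positive multiple of [dl] comes from the value group of [vb], which is divisible. *)
Lemma key_radius_value c k : w Q = fin c -> (0 < k)%N -> value_group_adjoin iota vb a (c *+ k) ->
  exists2 d, value_group vb d & dl = j d.
Proof.
move=> Qc k0 [z _ zk].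
have [l [t [l0 lt]]] := key_base_ptop j_mono vb dl Q_key Q_a.
have tE : t = j c.
  apply: fin_inj; apply: etrans (esym (ptop_val lt)) _.
  by rewrite (key_base_val j_mono wb_vb Q_key a_max a_dl) wb_w Qc.
case: lt => E _ _; rewrite /wcoef tE in E; set q := (_ \Po _)`_l in E.
have /ntopP[g qg] : vb q != top.
  by apply/eqP => qt; move: E; rewrite /= qt.
have {}E : dl *+ l = j (c - g).
  move: E; rewrite /= qg /= -finD => /fin_inj E.
  by rewrite raddfB -E addrC addKr.
apply: (@value_group_div dl (c *+ k - g *+ k) (l * k)); first by rewrite muln_gt0 l0.
  exists (z / q ^+ k); apply: vdiv => //; exact: vX_fin.
by rewrite mulrnA E -mulrnBl raddfMn.
Qed.

End Data.

(** Once [w_Q < w], the radius [delta Q] comes from the value group of [vb]. The pair valuation is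
    then defined with values in [G], is finite off 0 and extends to fractions; on [K[x]] it
    restricts to [w_Q]. *)
Lemma key_poly_lifting_data Q : abstract_key_poly iota wb Q ->
  val_lt (truncation Q w) w ->
  exists u : valuation {fraction {poly K}} G,
    [/\ forall f : {poly K}, u f%:F = truncation Q w f, residue_transcendental v u
      & exists (W : valuation {fraction {poly Kb}} G) a d c e h,
          lifting_data iota vb u W a d c e h /\ minpoly iota a = Q].
Proof.
move=> Qk [_ ne]; have [Qm Qs _] := Qk.
have [f lt] : exists f, truncation Q w f < w f.
  apply: contrapT => nex; apply: ne => f; apply/le_anti; rewrite truncation_le //=.
  by rewrite leNgt; apply/negP => lt; apply: nex; exists f.
have /ntopP[c Qc] : w Q != top.
  by apply/eqP => Qt; move: lt; rewrite truncation_top // ltxx.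
have [[a Qa Ea] _] := deltaP iota wb Qs.
have /ntopP[dl Edl] : wX a != top.
  by rewrite Ea; apply/eqP => dt; move: lt;
    rewrite (delta_top_truncation j_mono wb_w f Qk dt) ltxx.
have [k0 k0_gt0 ck0] := key_value_torsion Qk Qa Ea Edl Qc lt.
have [d d_val dE] := key_radius_value Qk Qa Ea Edl Qc k0_gt0 ck0.
have mQ : minpoly iota a = Q := key_minpoly Qk Qa.
have truncE g : pairv vb a d g^i = truncation Q w g.
  apply: (tmap_inj j_mono); rewrite /= -(pair_valuation_map j_mono) -dE.
  exact: (pairv_truncation Kb_algebraic j_mono wb_w wb_vb Qk Qa Ea Edl).
pose U : valuation {poly K} G := comp_valuation (map_poly iota) (pairv vb a d).
have U_top g : U g = top -> g = 0.
  by move=> /eqP Ug; apply/eqP; apply: contraTT Ug => g0; apply: pairv_ntop; rewrite map_poly_eq0.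
pose u := fraction_valuation U_top; have uE g : u g%:F = truncation Q w g.
  by rewrite -truncE; exact: (fraction_val_tofrac U_top g).
have W_top p : pairv vb a d p = top -> p = 0.
  by move=> /eqP Wp; apply/eqP; apply: contraTT Wp; exact: pairv_ntop.
pose W := fraction_valuation W_top.
have WE p : W p%:F = pair_valuation vb a d p := fraction_val_tofrac W_top p.
pose P k := (0 < k)%N && `[< value_group_adjoin iota vb a (c *+ k) >].
have exP : exists k, P k by exists k0; rewrite /P k0_gt0; apply/asboolP.
case: (ex_minnP exP) => e /andP[e_gt0 /asboolP ce] e_min.
(* [h] represents an element of [K(a)] whose value is [c *+ e]. *)
have [b Sb be] := ce; have [h hs hb] := adjoin_small Kb_algebraic Sb.
have data : lifting_data iota vb u W a d c e h.
  split=> //.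
  - split=> // b' ab'; rewrite leqNgt; apply/negP => lt'.
    have : wX b' < wX a.
      rewrite Ea; apply: (key_poly_root Kb_algebraic Qk).
      by rewrite -mQ !size_minpoly // ltnS.
    move=> lt2; have := wX_difference j_mono wb_vb lt2 => E.
    move: lt2; rewrite -E Edl dE ltNge => /negP; apply.
    by rewrite -[fin (j d)]/(withtop_map j (fin d)) tmap_le.
  - by move=> p; rewrite WE uE -truncE.
  - by rewrite mQ uE truncation_base.
  - by move=> i i0 ci; apply: e_min; rewrite /P i0; apply/asboolP.
  - rewrite uE truncation_small ?mQ //; last by rewrite -mQ.
    by rewrite (key_small_horner Qk Ea Edl) ?hb // -mQ.
  - by rewrite hb.
exists u; split=> //; last by exists W, a, d, c, e, h.
apply: (lifting_data_transcendental Kb_algebraic vb_v data) => x.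
rewrite uE truncation_small // ?w_v //.
by apply: leq_ltn_trans Qs; rewrite size_polyC; case: (x != 0).
Qed.

End Construction.

Theorem theorem6p5
  (K : fieldType) (G : orderedGroupType) (v : valuation K G)
  (Kb : closedFieldType) (iota : {rmorphism K -> Kb})
  (Kb_algebraic : forall a : Kb, algebraicOver iota a)
  (vb : valuation Kb G) (vb_v : forall a : K, vb (iota a) = v a)
  (w : valuation {poly K} G) (w_v : forall a : K, w a%:P = v a)
  (G' : orderedGroupType) (j : {additive G -> G'}) (j_mono : {mono j : x y / x <= y})
  (wb : valuation {poly Kb} G')
  (wb_w : forall f : {poly K}, wb (map_poly iota f) = withtop_map j (w f))
  (wb_vb : forall a : Kb, wb a%:P = withtop_map j (vb a))
  (F Q : {poly K}) (F_key : abstract_key_poly iota wb F)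
  (F_irr : irreducible_over (henselization iota vb) (map_poly iota F))
  (Q_monic : Q \is monic) :
  let st_i := distinguished_pair_poly iota vb F Q in
  let st_ii :=
    [/\ abstract_key_poly iota wb Q, val_lt (truncation Q w) w,
        Phi (truncation Q w) w F & (size Q).-1 < (size F).-1]%N in
  let st_iii :=
    [/\ abstract_key_poly iota wb Q, val_lt (truncation Q w) w
      & exists u : valuation {fraction {poly K}} G,
          [/\ forall f : {poly K}, u f%:F = truncation Q w f,
              residue_transcendental v u
            & nontrivial_irreducible_lifting iota vb u Q F]] in
  (st_i <-> st_ii) /\ (st_ii <-> st_iii).
Proof.
move=> st_i st_ii st_iii.
have F0 : (0 < size F)%N by case: F_key => _ /ltnW.
have size_pred : (1 < size Q)%N -> ((size Q).-1 < (size F).-1)%N = (size Q < size F)%N.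
  by move=> Q1; rewrite -ltnS !prednK // ltnW.
split; split.
- move=> D; have [Qk Qw FQ QF] :=
    Phi_of_distinguished Kb_algebraic j_mono wb_w wb_vb F_key F_irr Q_monic D.
  by split=> //; rewrite size_pred //; case: Qk.
- move=> [Qk _ FQ QF]; rewrite size_pred in QF; last by case: Qk.
  exact: (distinguished_of_Phi Kb_algebraic j_mono wb_w wb_vb F_key).
- move=> [Qk Qw FQ QF]; split=> //; have [_ Qs _] := Qk.
  have [u [uE u_tr [W [a [d [c [e [h [data aQ]]]]]]]]] :=
    key_poly_lifting_data Kb_algebraic j_mono vb_v w_v wb_w wb_vb Qk Qw.
  exists u; split=> //.
  have U_le f : comp_valuation (@tofrac {poly K}) u f <= w f.
    by rewrite /= uE truncation_le.
  have w_base : w (minpoly iota a) = comp_valuation (@tofrac {poly K}) u (minpoly iota a).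
    by rewrite /= uE aQ truncation_base.
  have w_small (f : {poly K}) : (size f < size (minpoly iota a))%N ->
      comp_valuation (@tofrac {poly K}) u f = w f.
    by rewrite aQ => fQ; rewrite /= uE truncation_small.
  have F_min : increase_minimal u w F.
    have [Fm FU Fle] := FQ; split=> // [|g gm]; first by rewrite /= uE.
    by rewrite /= uE; exact: Fle.
  have [V [Virr VX VF]] := increase_minimal_lifting Kb_algebraic data U_le w_base w_small F_min.
  exists W, a, d, c, e, h, V; split=> //; split=> //.
  by apply/eqP; rewrite gtn_eqF.
- move=> [Qk Qw [u [uE _ [W [a [d [c [e [h [V [data aQ Virr VX [VF sFQ]]]]]]]]]]]].
  have [_ Qs _] := Qk.
  (* [deg F] is [e m deg Q], so a nontrivial lifting has larger degree than [Q]; then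
     [delta Q < delta F], since [F] is a key polynomial, and [w_Q F < w F]. *)
  have QF : (size Q < size F)%N.
    rewrite -size_pred // ltn_neqAle; apply/andP; split; first by apply/eqP => e'; apply: sFQ.
    case: VF => m [m0 _ _ _] [_ -> _ _ _]; rewrite aQ leq_pmull // muln_gt0 m0.
    by rewrite (ld_e_gt0 data).
  have FU := truncation_lt_of_size Kb_algebraic j_mono wb_w wb_vb F_key Qk QF.
  have U_le f : comp_valuation (@tofrac {poly K}) u f <= w f.
    by rewrite /= uE truncation_le.
  have w_base : w (minpoly iota a) = comp_valuation (@tofrac {poly K}) u (minpoly iota a).
    by rewrite /= uE aQ truncation_base.
  have w_small (f : {poly K}) : (size f < size (minpoly iota a))%N ->
      comp_valuation (@tofrac {poly K}) u f = w f.
    by rewrite aQ => fQ; rewrite /= uE truncation_small.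
  have FU' : comp_valuation (@tofrac {poly K}) u F < w F by rewrite /= uE.
  have [Fm _ Fle] :=
    lifting_increase_minimal Kb_algebraic data U_le w_base w_small FU' Virr VF.
  split=> //; last by rewrite size_pred.
  by split=> // g gm gU; apply: Fle; rewrite //= uE.
Qed.
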